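(* Let $h>0$, and let $x:[0,+\infty)\to\Omega$ be a free time minimizer of the action functional $\mathcal{A}_h$ of the Newtonian $N$-body problem, with center of mass at rest. Then, writing $x(t)=(r_1(t),\dots,r_N(t))$, we have \[\lim_{t\to+\infty}\|r_i(t)-r_j(t)\|=+\infty\] for all $1\le i<j\le N$.
   Context: Let $E$ be a (finite-dimensional) Euclidean space, $N\ge 2$, and let $m_1,\dots,m_N>0$ be masses. A configuration is $x=(r_1,\dots,r_N)\in E^N$; write $r_{ij}=\|r_i-r_j\|$. $\Omega\subset E^N$ is the open dense set of configurations without collisions, i.e. with $r_i\ne r_j$ whenever $i\neq j$. The Newtonian potential is $U(x)=\sum_{i<j}m_im_j/r_{ij}$ (equal to $+\infty$ outside $\Omega$), and $E^N$ carries the mass norm $\|v\|^2=\sum_i m_i\|v_i\|^2$. The Lagrangian is $L(x,v)=\frac12\|v\|^2+U(x)\in\mathbb{R}\cup\{+\infty\}$. For $h\ge 0$ and an absolutely continuous curve $\gamma:[a,b]\to E^N$, set $\mathcal{A}_h(\gamma)=\int_a^b L(\gamma(t),\dot\gamma(t))\,dt+h(b-a)$. For $x,y\in E^N$ let $\phi_h(x,y)$ be the infimum of $\mathcal{A}_h(\gamma)$ over all $\tau>0$ and all absolutely continuous $\gamma:[0,\tau]\to E^N$ with $\gamma(0)=x$, $\gamma(\tau)=y$ (the time $\tau$ is free, and competing curves may pass through collisions). A curve $x:[0,+\infty)\to\Omega$ (absolutely continuous on compact intervals) is a free time minimizer of $\mathcal{A}_h$ if $\mathcal{A}_h(x|_{[a,b]})=\phi_h(x(a),x(b))$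 for every compact interval $[a,b]\subset[0,+\infty)$. Center of mass at rest means that $\sum_i m_i r_i(t)$ is constant in $t$. *)

(* Defs.v *)
From HB Require Import structures.
From mathcomp Require Import all_boot all_order all_algebra.
From mathcomp Require Import all_classical all_reals all_analysis.

Set Implicit Arguments.
Unset Strict Implicit.
Unset Printing Implicit Defensive.

Import Order.TTheory GRing.Theory Num.Theory.
Import numFieldNormedType.Exports.

Local Open Scope classical_set_scope.
Local Open Scope ring_scope.

(* The Euclidean space is R^d for an arbitrary d.  A configuration of N bodies
   is the N x d matrix whose i-th row is the position of the i-th body.  The
   library norm `|_| on matrices is the sup norm, hence a separate norm here. *)
Definition enorm (R : realType) (d : nat) (v : 'rV[R]_d) : R :=
  Num.sqrt (\sum_(k < d) v 0 k ^+ 2).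

Definition mutual_dist (R : realType) (N d : nat) (x : 'M[R]_(N, d))
    (i j : 'I_N) : R :=
  enorm (row i x - row j x).

Definition collision_free (R : realType) (N d : nat) : set 'M[R]_(N, d) :=
  [set x | forall i j : 'I_N, i != j -> row i x != row j x].

Definition mass_norm (R : realType) (N d : nat) (m : 'I_N -> R)
    (v : 'M[R]_(N, d)) : R :=
  Num.sqrt (\sum_(i < N) m i * enorm (row i v) ^+ 2).

Definition potential (R : realType) (N d : nat) (m : 'I_N -> R)
    (x : 'M[R]_(N, d)) : \bar R :=
  if x \in @collision_free R N d
  then (\sum_(i < N) \sum_(j < N | (i < j)%N)
          m i * m j / mutual_dist x i j)%:E
  else +oo%E.

Definition lagrangian (R : realType) (N d : nat) (m : 'I_N -> R)
    (x v : 'M[R]_(N, d)) : \bar R :=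
  ((2^-1 * mass_norm m v ^+ 2)%:E + potential m x)%E.

Definition abs_continuous (R : realType) (V : normedModType R) (a b : R)
    (f : R -> V) : Prop :=
  forall e : R, 0 < e -> exists2 delta : R, 0 < delta &
    forall (n : nat) (s t : 'I_n -> R),
      (forall k, [/\ a <= s k, s k <= t k & t k <= b]) ->
      trivIset [set: 'I_n] (fun k => `]s k, t k[%classic) ->
      \sum_(k < n) (t k - s k) < delta ->
      \sum_(k < n) `|f (t k) - f (s k)| < e.

(* Curves on [a, b] are total functions of which only the values on [a, b]
   matter.  For an absolutely continuous curve the derivative exists almost
   everywhere on [a, b]; its default value elsewhere does not affect the
   integral. *)
Definition action (R : realType) (N d : nat) (m : 'I_N -> R) (h a b : R)
    (gamma : R -> 'M[R]_(N, d)) : \bar R :=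
  (\int[@lebesgue_measure R]_(t in `[a, b])
      lagrangian m (gamma t) (derive1 gamma t)
   + (h * (b - a))%:E)%E.

Definition action_potential (R : realType) (N d : nat) (m : 'I_N -> R) (h : R)
    (x y : 'M[R]_(N, d)) : \bar R :=
  ereal_inf [set A | exists tau : R, exists gamma : R -> 'M[R]_(N, d),
    [/\ 0 < tau, abs_continuous 0 tau gamma, gamma 0 = x, gamma tau = y
      & A = action m h 0 tau gamma]].

Definition free_time_minimizer (R : realType) (N d : nat) (m : 'I_N -> R)
    (h : R) (x : R -> 'M[R]_(N, d)) : Prop :=
  [/\ forall t : R, 0 <= t -> collision_free (x t),
      forall a b : R, 0 <= a -> a < b -> abs_continuous a b x
    & forall a b : R, 0 <= a -> a < b ->
        action m h a b x = action_potential m h (x a) (x b)].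

Definition center_of_mass_at_rest (R : realType) (N d : nat) (m : 'I_N -> R)
    (x : R -> 'M[R]_(N, d)) : Prop :=
  exists c : 'rV[R]_d, forall t : R, 0 <= t ->
    \sum_(i < N) m i *: row i (x t) = c.

(* Main.v *)
(* Averaging two opposite variations x + rho V and x - rho V of a minimizer x cancels the kinetic
   cross term and bounds the integral of U(x) by |V|^2 times the integral of rho'^2 plus the mean
   of the integrals of U over the two varied curves.  In dimension at least 2, V moves the k-th
   body by k Y, with Y a vector of a fixed plane drawn according to the isotropic Cauchy density
   and truncated to a box of size L.  In the plane, the Cauchy average of 1/|q + sigma Y| is
   1/sqrt(|q|^2 + sigma^2), since this density is the balayage of a point mass at height 1; for
   larger dimensions it is at most that.  Hence every interaction 1/r gets replaced by
   1/sqrt(r^2 + rho^2), at the price of O(L^2) times the integral of rho'^2 and of a relative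
   truncation error O(1/L).

   With rho growing like the power 3/4 of the distance to the ends of a window of length 2T and L
   fixed, this bounds the integral of U on any such window by C (lambda^2 / T + T / lambda), lambda
   being the height of rho; so U is integrable uniformly on unit windows, and so is the velocity,
   because the minimizer is not improved by running it at half speed.  If some r_ij did not tend to
   infinity, it would thus be bounded on unit windows [c, c + 1] with c arbitrarily large.  The
   first estimate with a parabolic rho of height 1 on [c - T, c + T] would then give a positive
   lower bound for a quantity O(L^2 / T) + O(1 / L) (lambda^2 / T + T / lambda), which tends to 0
   for T = q^20, lambda = q^12, L = q^9.

   In dimension 1 the order of the bodies is preserved, and one varies in the single direction in
   which each body moves by its rank.  The cross term is a difference of values of
   sum_i m_i rank_i x_i, which Chebyshev's sum inequality bounds from below because the center of
   mass is at rest. *)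
From HB Require Import structures.
Require Import Defs.
From mathcomp Require Import all_boot all_order all_algebra.
From mathcomp Require Import all_classical all_reals all_analysis.
From mathcomp Require Import measurable_realfun ring lra.
Import Order.TTheory GRing.Theory Num.Theory.
Import numFieldNormedType.Exports.
Local Open Scope classical_set_scope.
Local Open Scope ring_scope.

Set Implicit Arguments.
Unset Strict Implicit.
Unset Printing Implicit Defensive.

(** * Absolutely continuous functions *)

Section AbsolutelyContinuous.
Context {R : realType}.
Implicit Types (a b : R) (p q : R * R).

(** A varied curve may run into collisions, so along a fixed direction the potential of the
    variation can be infinite; only its average over directions is controlled. The Cauchy density
    has infinite second moment, so the averaged kinetic cost would be infinite: this forces the
    truncation. The variation inequality is averaged over the box only; the potentials of the varied
    curves, being nonnegative, are then integrated over the whole plane, where the average is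
    explicit. The loss is a fraction O(1/L) of the integral of U itself, which is why a bound on
    that integral, growing slower than the window, has to come first.

    The exponent 3/4 lies strictly between 1/2, above which rho'^2 is integrable at the ends of the
    window, and 1, below which 1/rho is.

    On the line, a single variation suffices: it rises in unit time and returns slowly, so that the
    boundary terms stay bounded although only a lower bound is known at the far end.

    Being a minimizer does not include that the action is finite; this is proved before any kinetic
    energy is cancelled. *)

Definition sep2 p q := (p.2 <= q.1) || (q.2 <= p.1).
Definition inside a b p := [&& a <= p.1, p.1 <= p.2 & p.2 <= b].

(** Lists, unlike indexed families, can be concatenated and refined one interval at a time. [sep2]
    compares end points, so it also separates degenerate intervals, for which disjointness of the
    open intervals says nothing. *)
Lemma abs_continuous_seq (V : normedModType R) a b (f : R -> V) :
  abs_continuous a b f -> forall e : R, 0 < e -> exists2 delta : R, 0 < delta &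
  forall l : seq (R * R), all (inside a b) l -> pairwise sep2 l ->
    \sum_(p <- l) (p.2 - p.1) < delta ->
    \sum_(p <- l) `|f p.2 - f p.1| < e.
Proof.
move=> acf e e0; have [delta d0 H] := acf e e0; exists delta => // l lab lsep ld.
have := H (size l) (fun k => (tnth (in_tuple l) k).1) (fun k => (tnth (in_tuple l) k).2).
rewrite -(big_tnth _ _ _ xpredT (fun p => `|f p.2 - f p.1|)).
rewrite -(big_tnth _ _ _ xpredT (fun p => p.2 - p.1)).
apply => //.
- by move=> k; have /and3P[] := allP lab _ (mem_tnth k (in_tuple l)).
- apply/trivIsetP => i j _ _ ij; apply/seteqP; split => // r [].
  have sepij : sep2 (tnth (in_tuple l) i) (tnth (in_tuple l) j) || sep2 (tnth (in_tuple l) j) (tnth (in_tuple l) i).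
    have [ij'|ij'] := ltnP i j.
      rewrite !(tnth_nth (0,0)) /=.
      by have /(pairwiseP (0,0)) -> := lsep; rewrite ?inE ?ltn_ord.
    have ji : (j < i)%N by rewrite ltn_neqAle ij' andbT; apply: contra ij => /eqP/val_inj ->.
    rewrite !(tnth_nth (0,0)) /= orbC.
    by have /(pairwiseP (0,0)) -> := lsep; rewrite ?inE ?ltn_ord.
  rewrite /= !in_itv/= => /andP[ri1 ri2] /andP[rj1 rj2].
  by move: sepij; rewrite /sep2 -orbA => /or4P[] h; lra.
Qed.

Fixpoint steps a (s : seq R) : seq (R * R) :=
  if s is x :: s' then (a, x) :: steps x s' else [::].

Lemma variation_steps a b (f : R -> R) s : itv_partition a b s ->
  variation a b f s = \sum_(p <- steps a s) `|f p.2 - f p.1|.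
Proof.
move=> /variation_zip ->; elim: s a => [|x s ih] a; first by rewrite !big_nil.
by rewrite /= !big_cons /= ih.
Qed.

Lemma steps_le a b s : itv_partition a b s -> all (fun p => (a <= p.1) && (p.2 <= b)) (steps a s).
Proof.
elim: s a => [|x s ih] a //= h; have xb := itv_partition_cons h; have ax : a < x by case: (h) => /= /andP[].
rewrite lexx/=; have := itv_partition_le xb => -> /=.
by apply: sub_all (ih _ xb) => p /andP[xp ->]; rewrite (le_trans (ltW ax) xp).
Qed.

Lemma steps_nd a b s : itv_partition a b s -> all (fun p => p.1 <= p.2) (steps a s).
Proof.
elim: s a => [|x s ih] a //= h; have xb := itv_partition_cons h; have ax : a < x by case: (h) => /= /andP[].
by rewrite ltW// ih.
Qed.

Lemma steps_sum a b s : itv_partition a b s -> \sum_(p <- steps a s) (p.2 - p.1) = b - a.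
Proof.
elim: s a => [|x s ih] a /= h; first by rewrite big_nil (itv_partition_nil h) subrr.
have xb := itv_partition_cons h; have ax : a < x by case: (h) => /= /andP[].
by rewrite big_cons ih//=; ring.
Qed.

Lemma steps_sep a b s : itv_partition a b s -> pairwise sep2 (steps a s).
Proof.
elim: s a => [|x s ih] a //= h; have xb := itv_partition_cons h; have ax : a < x by case: (h) => /= /andP[].
rewrite (ih _ xb) andbT; apply: sub_all (steps_le xb) => p /andP[xp _].
by rewrite /sep2/= xp.
Qed.

Lemma sep2C p q : sep2 p q = sep2 q p.
Proof. exact: orbC. Qed.

Lemma sep2_inside p q r : inside p.1 p.2 q -> sep2 p r -> sep2 q r.
Proof. by rewrite /sep2/inside/= => /and3P[h1 h2 h3] /orP[] h; apply/orP; [left|right]; lra. Qed.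

Lemma inside_trans a b p q : inside a b p -> inside p.1 p.2 q -> inside a b q.
Proof. by move=> /and3P[? ? ?] /and3P[? ? ?]; apply/and3P; split; lra. Qed.

Lemma steps_inside a b s : itv_partition a b s -> all (inside a b) (steps a s).
Proof.
move=> h; apply/allP => p ps; have /andP[h1 h2] := allP (steps_le h) _ ps.
by rewrite /inside h1 h2 (allP (steps_nd h) _ ps).
Qed.

(* The increments over [l1] are replaced by total variations one interval at a time. *)
Lemma sum_total_variation_le a b (f : R -> R) (e delta : R) :
  (forall l, all (inside a b) l -> pairwise sep2 l ->
    \sum_(p <- l) (p.2 - p.1) < delta -> \sum_(p <- l) `|f p.2 - f p.1| < e) ->
  forall l1 l2, all (inside a b) (l1 ++ l2) -> pairwise sep2 (l1 ++ l2) ->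
    \sum_(p <- l1 ++ l2) (p.2 - p.1) < delta ->
  (\sum_(p <- l1) total_variation p.1 p.2 f + (\sum_(p <- l2) `|f p.2 - f p.1|)%:E <= e%:E)%E.
Proof.
move=> H; elim=> [|p l1 ih] l2.
  by move=> h1 h2 h3; rewrite big_nil add0e lee_fin ltW// H.
rewrite cat_cons /= => /andP[abp abl] /andP[sp sl]; rewrite big_cons => sd.
have p0 : p.1 <= p.2 by case/and3P: abp.
have abl1 : all (inside a b) l1 by move: abl; rewrite all_cat => /andP[].
rewrite big_cons -addeA.
set X := (X in (_ + X)%E).
have key s : itv_partition p.1 p.2 s -> ((variation p.1 p.2 f s)%:E + X <= e%:E)%E.
  move=> hs; rewrite (variation_steps _ hs) /X addeCA -EFinD -big_cat.
  have ss := allP (steps_inside hs).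
  apply: ih.
  - move: abl; rewrite !all_cat => /andP[-> ->] /=; rewrite andbT.
    by apply/allP => q /ss; exact: inside_trans.
  - move: sl sp; rewrite !pairwise_cat all_cat allrel_catr => /and3P[-> -> ->] /andP[sp1 sp2].
    rewrite (steps_sep hs) !andbT /=; apply/andP; split.
      apply/allrelP => x y /= xl ys; rewrite sep2C.
      by apply: (sep2_inside (ss _ ys)); exact: (allP sp1).
    apply/allrelP => x y /= xs yl.
    by apply: (sep2_inside (ss _ xs)); exact: (allP sp2).
  - move: sd; rewrite !big_cat /= (steps_sum hs); lra.
have X0 : (0 <= X)%E.
  rewrite adde_ge0 ?lee_fin ?sumr_ge0//.
  rewrite big_seq; apply: sume_ge0 => q ql; apply: total_variation_ge0.
  by have /and3P[] := allP abl1 _ ql.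
have [pe|pne] := eqVneq p.1 p.2.
  have := key [::]; rewrite variation_nil pe total_variationxx; apply.
  by split => //=; apply/eqP.
have plt : p.1 < p.2 by rewrite lt_neqAle pne.
(* Finiteness of [X], needed to move it to the other side, comes from the trivial partition. *)
have Xfin : X \is a fin_num.
  rewrite ge0_fin_numE//; apply: (@le_lt_trans _ _ e%:E); last exact: ltry.
  apply: le_trans (key _ (itv_partition1 plt)).
  by rewrite leeDr// lee_fin variation_ge0.
rewrite -leeBrDr//; apply: ub_ereal_sup => _ [_ [s hs <-] <-].
by rewrite leeBrDr// key.
Qed.

Lemma total_variation_abs_continuous a b (f : R -> R) : abs_continuous a b f ->
  forall e : R, 0 < e -> exists2 delta : R, 0 < delta &
  forall l : seq (R * R), all (inside a b) l -> pairwise sep2 l ->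
    \sum_(p <- l) (p.2 - p.1) < delta ->
  (\sum_(p <- l) total_variation p.1 p.2 f <= e%:E)%E.
Proof.
move=> acf e e0; have [delta d0 H] := abs_continuous_seq acf e0; exists delta => // l h1 h2 h3.
have := sum_total_variation_le H (l1 := l) (l2 := [::]).
by rewrite cats0 big_nil adde0; apply.
Qed.

(** The interval is cut into pieces of length at most [delta / 2], each of total variation at most
    1. *)
Lemma abs_continuous_bounded_variation a b (f : R -> R) : a <= b -> abs_continuous a b f ->
  bounded_variation a b f.
Proof.
move=> ab acf; apply/bounded_variationP => //.
have [delta d0 H] := total_variation_abs_continuous acf (@ltr01 R).
have key n : forall c, c \in `[a, b] -> c - a <= n%:R * (delta / 2) -> total_variation a c f \is a fin_num.
  elim: n => [|n ih] c; rewrite in_itv/= => /andP[ac cb].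
    rewrite mul0r => ca; have -> : c = a by lra.
    by rewrite total_variationxx.
  move=> cn; pose c' := Num.max a (c - delta / 2).
  have ac' : a <= c' by rewrite le_max lexx.
  have c'c : c' <= c by rewrite ge_max ac; lra.
  rewrite (total_variationD _ ac' c'c) fin_numD ih/=; first last.
  - move: cn; rewrite -natr1 mulrDl mul1r /c' => cn; rewrite lerBlDr ge_max; apply/andP; split; last by lra.
    by rewrite lerDr mulr_ge0// ltW// divr_gt0.
  - by rewrite in_itv/= ac' (le_trans c'c).
  rewrite ge0_fin_numE ?total_variation_ge0//.
  have := H [:: (c', c)]; rewrite !big_seq1/= => /(_ _ isT) h.
  apply: (@le_lt_trans _ _ 1%:E); last exact: ltry.
  apply: h; first by rewrite /inside/= ac' c'c cb.
  have : c - delta / 2 <= c' by rewrite le_max lexx orbT.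
  by lra.
pose n := Num.truncn ((b - a) / (delta / 2)).
apply: (key n.+1); first by rewrite in_itv/= ab lexx.
rewrite -ler_pdivrMr ?divr_gt0// ltW//.
exact: truncnS_gt.
Qed.

(** The final bound is weak because for variation functions it is inherited from suprema over
    partitions. *)
Definition seq_ac a b (f : R -> R) := forall e : R, 0 < e ->
  exists2 delta : R, 0 < delta &
  forall l : seq (R * R), all (inside a b) l -> pairwise sep2 l ->
    \sum_(p <- l) (p.2 - p.1) < delta ->
    \sum_(p <- l) `|f p.2 - f p.1| <= e.

Lemma abs_continuous_seq_ac a b (f : R -> R) : abs_continuous a b f -> seq_ac a b f.
Proof.
move=> acf e e0; have [delta d0 H] := abs_continuous_seq acf e0.
by exists delta => // l h1 h2 h3; rewrite ltW// H.
Qed.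

Lemma total_variation_seq_ac a b (f : R -> R) : a <= b -> abs_continuous a b f ->
  seq_ac a b (fun t => fine (total_variation a t f)).
Proof.
move=> ab acf e e0; have [delta d0 H] := total_variation_abs_continuous acf e0.
have bv := abs_continuous_bounded_variation ab acf.
exists delta => // l h1 h2 h3.
rewrite -lee_fin -sumEFin; apply: le_trans (H l h1 h2 h3).
rewrite !big_seq; apply: lee_sum => p pl.
have /and3P[ap p12 pb] := allP h1 _ pl.
have f1 : total_variation a p.1 f \is a fin_num.
  by apply/bounded_variationP => //; apply: bounded_variationl bv => //; lra.
have f2 : total_variation p.1 p.2 f \is a fin_num.
  apply/bounded_variationP => //; apply: (@bounded_variationl _ _ _ b) => //.
  by apply: bounded_variationr bv => //; lra.
rewrite (total_variationD _ ap p12) fineD// addrAC subrr add0r.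
by rewrite ger0_norm ?fineK// fine_ge0// total_variation_ge0.
Qed.

Lemma seq_acB a b (f g : R -> R) : seq_ac a b f -> seq_ac a b g -> seq_ac a b (fun t => f t - g t).
Proof.
move=> hf hg e e0; have e20 : 0 < e / 2 by lra.
have [d1 d10 h1] := hf _ e20; have [d2 d20 h2] := hg _ e20.
exists (Num.min d1 d2); first by rewrite lt_min d10.
move=> l l1 l2; rewrite lt_min => /andP[l3 l4].
rewrite (splitr e); apply: le_trans (lerD (h1 _ l1 l2 l3) (h2 _ l1 l2 l4)).
rewrite -big_split/=; apply: ler_sum => p _.
have -> : f p.2 - g p.2 - (f p.1 - g p.1) = (f p.2 - f p.1) - (g p.2 - g p.1) by ring.
exact: ler_normB.
Qed.

(** Precomposition with this retraction extends a function on [[a, b]] by constants, which provides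
    the global monotonicity, continuity or measurability that Stieltjes measures and Tonelli's
    theorem require. *)
Definition clamp a b (t : R) := Num.max a (Num.min b t).

Lemma clamp_itv a b t : a <= b -> (a <= clamp a b t) && (clamp a b t <= b).
Proof. by move=> ab; rewrite /clamp le_max lexx/= ge_max ab/= ge_min lexx. Qed.

Lemma clamp_id a b t : a <= t -> t <= b -> clamp a b t = t.
Proof. by move=> at' tb; rewrite /clamp min_r// max_r. Qed.

Lemma clamp_nd a b s t : s <= t -> clamp a b s <= clamp a b t.
Proof.
move=> st; rewrite /clamp /Num.max /Num.min; do ! case: ifPn => //; rewrite -?leNgt => *; lra.
Qed.

Lemma clamp_lip a b s t : s <= t -> clamp a b t - clamp a b s <= t - s.
Proof.
move=> st; rewrite /clamp /Num.max /Num.min; do ! case: ifPn => //; rewrite -?leNgt => *; lra.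
Qed.

Lemma seq_ac_continuous a b (f : R -> R) : a <= b -> seq_ac a b f -> continuous (f \o clamp a b).
Proof.
move=> ab hf t; apply/cvgrPdist_le => /= e e0; have [d d0 H] := hf _ e0.
near=> u.
have key s s' : s <= s' -> s' - s < d -> `|f (clamp a b s') - f (clamp a b s)| <= e.
  move=> ss sd; have := H [:: (clamp a b s, clamp a b s')].
  rewrite !big_seq1/= ; apply => //.
    rewrite /inside/= clamp_nd// !andbT; have /andP[-> _] := clamp_itv s ab.
    by have /andP[_ ->] := clamp_itv s' ab.
  by apply: le_lt_trans sd; exact: clamp_lip.
have tu : `|t - u| < d by near: u; apply: cvgr_dist_lt.
have [tu'|/ltW ut] := leP t u.
  by rewrite distrC key// -(ger0_norm (_ : 0 <= u - t)) ?subr_ge0// distrC.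
by rewrite key// -(ger0_norm (_ : 0 <= t - u)) ?subr_ge0.
Unshelve. all: by end_near. Qed.

Lemma lebesgue_stieltjes_itv (G : cumulative R R) s t : s <= t ->
  lebesgue_stieltjes_measure G `]s, t] = (G t - G s)%:E.
Proof.
move=> st; rewrite /lebesgue_stieltjes_measure /measure_extension measurable_mu_extE/=.
  by rewrite wlength_itv_bnd.
exact: is_ocitv.
Qed.

Local Notation mu := (@lebesgue_measure R).

(** Finite measure excludes unbounded intervals, and the end points are then the infimum and the
    supremum. *)
Lemma open_interval_pair (I : set R) : open I -> is_interval I -> (mu I < +oo)%E ->
  exists p : R * R, p.1 <= p.2 /\ I = `]p.1, p.2[%classic.
Proof.
move=> oI iI mI; have [I0|/set0P I0] := eqVneq I set0.
  by exists (0, 0); split => //=; rewrite I0 set_itvoo0.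
have E := iI; move/is_intervalP : E => E.
have lI : has_lbound I.
  apply: contrapT => h; move: mI; rewrite E /Rhull; rewrite asboolF//.
  by case: ifP => _; rewrite lebesgue_measure_itv/= ?ltNyr ?ltNyy/= ?ltxx.
have uI : has_ubound I.
  apply: contrapT => h; move: mI; rewrite E /Rhull; rewrite (asboolF h).
  by case: ifP => _; rewrite lebesgue_measure_itv/= ?ltry ?ltNyy/= ?ltxx.
exists (inf I, sup I); split => /=; last first.
  have := interval_bounded_interior iI lI uI.
  by rewrite (interior_id I).1// => {1}->; apply/seteqP; split => x /=; rewrite in_itv.
have [x Ix] := I0.
by apply: (@le_trans _ _ x); [exact: ge_inf|exact: ub_le_sup].
Qed.

Lemma sep2_itvoo p q : p.1 < p.2 -> q.1 < q.2 -> `]p.1, p.2[ `&` `]q.1, q.2[ = set0 :> set R -> sep2 p q.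
Proof.
move=> p12 q12 pq; apply: contrapT => /negP; rewrite /sep2 negb_or -!ltNge => /andP[h1 h2].
have : (`]p.1, p.2[ `&` `]q.1, q.2[ : set R) ((Num.max p.1 q.1 + Num.min p.2 q.2) / 2).
  rewrite /= !in_itv /= /Num.max /Num.min; do ! case: ifPn; rewrite -?leNgt => *; split; apply/andP; split; lra.
by rewrite pq.
Qed.

(** * Density of a nondecreasing absolutely continuous function *)

Section density.
Variables (a b : R) (g : R -> R).
Hypothesis ab : a <= b.
Hypothesis gac : seq_ac a b g.
Hypothesis gnd : {in `[a, b] &, nondecreasing_fun g}.

Let G := g \o clamp a b.

Let Gnd : nondecreasing G.
Proof.
move=> s t st; rewrite /G/=; apply: gnd; rewrite ?in_itv/= ?clamp_itv//.
exact: clamp_nd.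
Qed.

Let Grc : right_continuous G.
Proof. by apply: right_continuousW; exact: seq_ac_continuous. Qed.

HB.instance Definition _ := isCumulative.Build R _ R G Gnd Grc.

Let nu := lebesgue_stieltjes_measure G.

Let nu_oc s t : s <= t -> nu `]s, t] = (G t - G s)%:E.
Proof. exact: lebesgue_stieltjes_itv. Qed.

Let Gbound s t : G t - G s <= g b - g a.
Proof.
rewrite lerB// /G/=; apply: gnd; rewrite ?in_itv/= ?clamp_itv// ?lexx ?ab//.
by have /andP[] := clamp_itv t ab.
by have /andP[] := clamp_itv s ab.
Qed.

Let nu_fin : fin_num_fun nu.
Proof.
apply: lty_fin_num_fun.
(* The line is the increasing union of the intervals []-n, n]], each of measure at most
   [g b - g a]. *)
rewrite -(bigcup_itvT false false).
pose I n : set R := `]- (n%:R), n%:R]%classic.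
have h : (nu \o I) n @[n --> \oo] --> nu (\bigcup_n I n).
  apply: nondecreasing_cvg_mu; rewrite /I//; first exact: bigcup_measurable.
  by move=> *; apply/subsetPset/subset_itv; rewrite leBSide/= ?lerN2 ler_nat.
apply: (@le_lt_trans _ _ (g b - g a)%:E); last exact: ltry.
rewrite -[X in (X <= _)%E](cvg_lim _ h)//.
apply: lime_le; first by apply/cvg_ex; eexists; exact: h.
by apply: nearW => n; rewrite /= nu_oc ?lee_fin ?Gbound// ge0_cp.
Qed.

(** A null set lies in an open set of Lebesgue measure less than [d]. The components of that set are
    disjoint intervals, so [g] increases by at most [e] over any finitely many of them, hence over
    all. *)
Let nu_dom : nu `<< mu.
Proof.
apply/null_content_dominatesP => A mA A0.
apply/eqP; rewrite eq_le measure_ge0 andbT; apply/lee_addgt0Pr => e e0; rewrite add0e.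
have [d d0 H] := gac e0.
have [U [oU AU Ud]] : exists U : set R, [/\ open U, A `<=` U & (mu (U `\` A) < d%:E)%E].
  by apply: lebesgue_regularity_outer => //; rewrite A0.
have mU : measurable U by exact: open_measurable.
have {}Ud : (mu U < d%:E)%E.
  have -> : U = A `|` (U `\` A) by rewrite setDUK.
  rewrite measureU//; first by rewrite A0 add0e.
    exact: measurableD.
  by rewrite setDE setICA setICr setI0.
apply: (@le_trans _ _ (nu U)); first by apply: le_measure; rewrite ?inE.
pose I := open_disjoint_itv oU.
have mI k : measurable (I k) by apply: open_measurable; exact: open_disjoint_itv_open.
have UI : U = \bigcup_k I k by exact: open_disjoint_itv_bigcup.
have tI : trivIset setT I by exact: open_disjoint_itv_trivIset.
have hp k : exists p : R * R, p.1 <= p.2 /\ I k = `]p.1, p.2[%classic.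
  apply: open_interval_pair.
  - exact: open_disjoint_itv_open.
  - exact: open_disjoint_itv_is_interval.
  - apply: (@le_lt_trans _ _ (mu U)); last by apply: (lt_trans Ud); exact: ltry.
    have IU : I k `<=` U by rewrite [X in _ `<=` X]UI; exact: bigcup_sup.
    by apply: le_measure => //; rewrite inE; [exact: mI|exact: mU].
pose p k := sval (cid (hp k)).
have p12 k : (p k).1 <= (p k).2 by rewrite /p; case: cid => ? [].
have pI k : I k = `](p k).1, (p k).2[%classic by rewrite /p; case: cid => ? [].
have -> : (nu U = \sum_(0 <= k <oo | k \in setT) nu (I k))%E.
  by rewrite [X in nu X]UI; exact: (@measure_bigcup _ _ _ (lebesgue_stieltjes_measure G) setT I (fun k _ => mI k) tI).
apply: lime_le; first exact: is_cvg_nneseries.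
apply: nearW => n.
(* Empty components are dropped, because disjointness yields [sep2] for nondegenerate intervals
   only. Clamping the end points turns the increments of [G] into increments of [g] inside
   [[a, b]]. *)
pose l0 := [seq p k | k <- iota 0 n & (p k).1 < (p k).2].
pose l := [seq (clamp a b q.1, clamp a b q.2) | q <- l0].
have lsep : pairwise sep2 l0.
  pose ks := [seq k <- iota 0 n | (p k).1 < (p k).2].
  rewrite (_ : l0 = map p ks)// pairwise_map.
  have uks : pairwise (fun i j : nat => i != j) ks by rewrite -uniq_pairwise filter_uniq// iota_uniq.
  have kks : all (mem ks) ks by apply/allP.
  apply: sub_in_pairwise kks uks => i j /=; rewrite !mem_filter => /andP[hi _] /andP[hj _] ij.
  by apply: sep2_itvoo => //; rewrite -!pI; move/trivIsetP : tI; exact.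
have -> : (\sum_(0 <= k < n | k \in setT) nu (I k))%E = (\sum_(k <- iota 0 n | ((p k).1 < (p k).2)%R) nu (I k))%E.
  rewrite /index_iota subn0 (eq_bigl xpredT); last by move=> k; rewrite in_setT.
  rewrite [RHS]big_mkcond; apply: eq_bigr => k _; case: ifPn => //; rewrite -leNgt => pk.
  by rewrite pI set_itv_ge ?measure0// bnd_simp -leNgt.
apply: (@le_trans _ _ (\sum_(q <- l) `|g q.2 - g q.1|)%:E).
  rewrite /l /l0 !big_map big_filter -sumEFin; apply: lee_sum => k pk.
  apply: (@le_trans _ _ (nu `](p k).1, (p k).2])).
    apply: le_measure; rewrite ?inE; [exact: mI|exact: measurable_itv|].
    by rewrite pI; apply: subset_itvl; rewrite bnd_simp.
  by rewrite nu_oc// lee_fin; exact: ler_norm.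
rewrite lee_fin; apply: H.
- rewrite /l /l0 !all_map; apply/allP => k; rewrite mem_filter => /andP[/ltW pk _] /=.
  rewrite /inside/= clamp_nd//; have /andP[-> _] := clamp_itv (p k).1 ab.
  by have /andP[_ ->] := clamp_itv (p k).2 ab.
- rewrite /l pairwise_map; apply: sub_pairwise lsep => q r /=; rewrite /sep2/=.
  by move=> /orP[] /(clamp_nd a b) ->; rewrite ?orbT.
- apply: (@le_lt_trans _ _ (\sum_(q <- l0) (q.2 - q.1))).
    rewrite /l big_map /l0 !big_map !big_filter; apply: ler_sum => k /ltW pk /=.
    exact: clamp_lip.
  rewrite -lte_fin; apply: le_lt_trans Ud.
  rewrite /l0 big_map big_filter -sumEFin.
  apply: (@le_trans _ _ (\sum_(0 <= k < n) mu (I k))%E).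
    rewrite /index_iota subn0 big_mkcond; apply: lee_sum => k _.
    case: ifPn => pk //; rewrite pI.
    by rewrite [X in (_ <= X)%E]lebesgue_measure_itv/= lte_fin pk.
  have -> : (mu U = \sum_(0 <= k <oo | k \in setT) mu (I k))%E.
    by rewrite [X in mu X]UI; exact: (@measure_bigcup _ _ _ mu setT I (fun k _ => mI k) tI).
  rewrite [in X in (_ <= X)%E](eq_eseriesl (Q := xpredT)); last by move=> k; rewrite in_setT.
  exact: nneseries_lim_ge.
Qed.

Lemma nondecreasing_density : exists phi : R -> R,
  [/\ mu.-integrable setT (EFin \o phi), forall t, 0 <= phi t &
   forall s t, s <= t -> (\int[mu]_(x in `]s, t]) (phi x)%:E = (G t - G s)%:E)%E].
Proof.
pose nuf : {finite_measure set _ -> \bar R} := HB.pack (lebesgue_stieltjes_measure G) (@Measure_isFinite.Build _ _ _ (lebesgue_stieltjes_measure G) nu_fin).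
have [phi [phi0 phifin phii phinu]] := @radon_nikodym_sigma_finite _ _ _ mu nuf nu_dom.
have E : EFin \o (fine \o phi) = phi by apply/funext => t; rewrite /= fineK.
exists (fine \o phi); split.
- by rewrite E.
- by move=> t; rewrite /= fine_ge0.
- move=> s t st; transitivity (nuf `]s, t]%classic); last exact: nu_oc.
  rewrite phinu; last exact: measurable_itv.
  by apply: eq_integral => x _; rewrite /= fineK.
Qed.

End density.

(* By Jordan decomposition, it suffices to consider nondecreasing functions, for which the density is
   the Radon-Nikodym derivative of the Stieltjes measure. *)
Theorem abs_continuous_FTC a b (f : R -> R) : a < b -> abs_continuous a b f ->
  exists g : R -> R, [/\ mu.-integrable setT (EFin \o g),
    forall s t, a <= s -> s <= t -> t <= b -> \int[mu]_(x in `[s, t]) g x = f t - f s &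
    {ae mu, forall t, a < t < b -> is_derive t 1 f (g t)}].
Proof.
move=> ab acf; have ab' := ltW ab.
have bv := abs_continuous_bounded_variation ab' acf.
pose V t := fine (total_variation a t f).
have Vac : seq_ac a b V by exact: total_variation_seq_ac.
pose W t := V t - f t.
have Wac : seq_ac a b W by apply: seq_acB => //; exact: abs_continuous_seq_ac.
have tvfin s t : a <= s -> s <= t -> t <= b -> total_variation s t f \is a fin_num.
  move=> as' st tb; apply/bounded_variationP => //; apply: (@bounded_variationl _ _ _ b) => //.
  by apply: bounded_variationr bv => //; lra.
have VE s t : a <= s -> s <= t -> t <= b -> V t - V s = fine (total_variation s t f).
  move=> as' st tb; rewrite /V (total_variationD _ as' st) fineD ?tvfin//; last lra.
  by rewrite addrAC subrr add0r.
have Vnd : {in `[a, b] &, nondecreasing_fun V}.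
  move=> s t; rewrite !in_itv/= => /andP[as' sb] /andP[at' tb] st.
  by rewrite -subr_ge0 VE// fine_ge0// total_variation_ge0.
have Wnd : {in `[a, b] &, nondecreasing_fun W}.
  move=> s t; rewrite !in_itv/= => /andP[as' sb] /andP[at' tb] st.
  rewrite -subr_ge0; have -> : W t - W s = (V t - V s) - (f t - f s) by rewrite /W; ring.
  rewrite VE// subr_ge0 -lee_fin fineK ?tvfin//.
  by apply: le_trans (total_variation_ge _ st); rewrite lee_fin ler_norm.
have [g1 [ig1 g10 Hg1]] := nondecreasing_density ab' Vac Vnd.
have [g2 [ig2 g20 Hg2]] := nondecreasing_density ab' Wac Wnd.
pose g t := g1 t - g2 t.
have ig : mu.-integrable setT (EFin \o g).
  by rewrite (_ : _ \o _ = ((EFin \o g1) \- (EFin \o g2))%E)//; exact: integrableB.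
have igS (A : set R) (h : R -> R) : measurable A -> mu.-integrable setT (EFin \o h) -> mu.-integrable A (EFin \o h).
  by move=> mA; apply: integrableS.
have Hg s t : a <= s -> s <= t -> t <= b -> \int[mu]_(x in `[s, t]) g x = f t - f s.
  move=> as' st tb.
  rewrite -Rintegral_itv_obnd_cbnd; last exact: igS.
  rewrite RintegralB//; [|exact: igS|exact: igS].
  rewrite /Rintegral Hg1// Hg2//= !clamp_id//; [|lra|lra].
  by rewrite /W; ring.
exists g; split => //.
have locg : locally_integrable setT g by apply: open_integrable_locally => //; exact: openT.
(* Lebesgue differentiation of the indefinite integral, which equals [f - f a] near every interior
   point. *)
have := FTC1 (a := BLeft a) (fun y => igS _ g (measurable_itv _) ig) locg.
apply: filterS; first exact: (ae_filter_ringOfSetsType mu).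
move=> t /= H /andP[at' tb].
have [|dF DF] := H; first by rewrite lte_fin.
have : is_derive t 1 (fun x => \int[mu]_(t0 in `[a, x]) g t0 + f a) (g t + 0).
  apply: is_deriveD; rewrite -DF derive1E; exact: derivableP.
rewrite addr0; apply: near_eq_is_derive.
near=> u; rewrite Hg//; first by ring.
  by apply: ltW; near: u; exact: lt_nbhsr.
by apply: ltW; near: u; exact: lt_nbhsl.
Unshelve. all: by end_near. Qed.

End AbsolutelyContinuous.

(** * The isotropic Cauchy density in the plane *)

Section AffineSubstitution.
Context {R : realType}.
Local Notation mu := (@lebesgue_measure R).
Implicit Types (c d : R) (f : R -> \bar R).

Let affine_meas c d : measurable_fun setT (fun x : R => c * x + d).
Proof. exact: measurable_funD. Qed.

Section pos.
Variables (c d : R).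
Hypothesis c0 : 0 < c.
Let phi : measurableTypeR R -> measurableTypeR R := fun x => c * x + d.
Let mphi : measurable_fun setT phi. Proof. exact: affine_meas. Qed.
HB.instance Definition _ := isMeasurableFun.Build _ _ _ _ _ mphi.
Let c' : {nonneg R} := NngNum (ltW c0).

Lemma lebesgue_measure_affine (A : set R) : measurable A ->
  (c%:E * pushforward mu phi A = mu A)%E.
Proof.
move=> mA; apply/esym/(@lebesgue_measure_unique R (mscale c' (pushforward mu phi))) => //= _ [[u v]] _ <-.
rewrite /mscale/= (_ : pushforward mu phi `]u, v] = mu `](u - d) / c, (v - d) / c]); last first.
  rewrite /pushforward; congr (mu _).
  apply/seteqP; split => x /=; rewrite !in_itv/= /phi ltr_pdivrMr// ler_pdivlMr// !(mulrC x) => /andP[h1 h2]; apply/andP; split; lra.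
rewrite !lebesgue_measure_itv/= !lte_fin ltr_pM2r ?invr_gt0// ltrD2r.
case: ifPn => _; last by rewrite mule0.
by rewrite -!EFinB -EFinM; congr EFin; field; rewrite gt_eqF.
Qed.

Lemma ge0_integral_affine_pos (f : R -> \bar R) : measurable_fun setT f -> (forall x, (0 <= f x)%E) ->
  (c%:E * \int[mu]_x f (c * x + d)%R = \int[mu]_x f x)%E.
Proof.
move=> mf f0.
rewrite -[RHS](@eq_measure_integral _ _ _ _ _ (mscale c' (pushforward mu phi))).
  rewrite ge0_integral_mscale//=; congr (_ * _)%E.
  by rewrite ge0_integral_pushforward.
by move=> A mA _; exact: lebesgue_measure_affine.
Qed.

End pos.

Lemma ge0_integralN (f : R -> \bar R) : measurable_fun setT f -> (forall x, (0 <= f x)%E) ->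
  (\int[mu]_x f (- x)%R = \int[mu]_x f x)%E.
Proof.
move=> mf f0.
rewrite -[RHS](@eq_measure_integral _ _ _ _ _ (pushforward mu (-%R : _ -> measurableTypeR R))).
  by rewrite ge0_integral_pushforward.
by move=> A mA _; exact: lebesgue_measureN.
Qed.

Lemma ge0_integral_affine c d f : c != 0 -> measurable_fun setT f -> (forall x, (0 <= f x)%E) ->
  (`|c|%:E * \int[mu]_x f (c * x + d)%R = \int[mu]_x f x)%E.
Proof.
move=> c0 mf f0; have [cpos|cneg] := ltP 0 c; first by rewrite gtr0_norm// ge0_integral_affine_pos.
have {c0}cneg : c < 0 by rewrite lt_neqAle c0.
have cpos : 0 < - c by rewrite oppr_gt0.
rewrite ltr0_norm// -(ge0_integral_affine_pos d cpos mf f0).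
congr (_ * _)%E; rewrite -[RHS]ge0_integralN//.
  by apply: eq_integral => x _; rewrite mulrNN.
by apply: (measurableT_comp mf); exact: affine_meas.
Qed.

End AffineSubstitution.

Section PlanarCauchy.
Context {R : realType}.
Local Notation mu := (@lebesgue_measure R).

Lemma measurable_invr : measurable_fun setT (@GRing.inv R).
Proof.
rewrite -(setvU [set 0 : R]).
apply/measurable_funU => //; first exact: measurableC.
split; last exact: measurable_fun_set1.
apply: open_continuous_measurable_fun.
  by apply: closed_openC; exact: closed_eq.
by move=> x; rewrite inE/= => /eqP x0; exact: inv_continuous.
Qed.

Lemma measurable_funV d (T : measurableType d) (D : set T) (f : T -> R) :
  measurable_fun D f -> measurable_fun D (fun x => (f x)^-1).
Proof. exact: measurableT_comp measurable_invr. Qed.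

Lemma measurable_fun_sqrt d (T : measurableType d) (D : set T) (f : T -> R) :
  measurable_fun D f -> measurable_fun D (fun x => Num.sqrt (f x)).
Proof.
apply: measurableT_comp; apply: continuous_measurable_fun.
exact: sqrt_continuous.
Qed.

(** The power 3/2, written with a square root to avoid real exponents. *)
Definition pow32 (y : R) := y * Num.sqrt y.

Lemma pow32_gt0 y : 0 < y -> 0 < pow32 y.
Proof. by move=> y0; rewrite /pow32 mulr_gt0// sqrtr_gt0. Qed.

Lemma measurable_pow32 d (T : measurableType d) (D : set T) (f : T -> R) :
  measurable_fun D f -> measurable_fun D (fun x => pow32 (f x)).
Proof. by move=> mf; apply: measurable_funM => //; exact: measurable_fun_sqrt. Qed.

Lemma pow32M x y : 0 <= x -> pow32 (x * y) = pow32 x * pow32 y.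
Proof. by move=> x0; rewrite /pow32 sqrtrM//; ring. Qed.

Lemma integral_oneDsqr : (\int[mu]_x (1 + x ^+ 2)^-1%:E = pi%:E)%E.
Proof.
rewrite (_ : (fun x : R => _) = fun x : R => ((oneDsqr x)^-1)%:E)//.
rewrite ge0_symfun_integralT.
- rewrite (_ : [set x : R | 0 <= x] = `[0, +oo[%classic); last first.
    by apply/seteqP; split => x /=; rewrite in_itv/= andbT.
  rewrite integral0y_oneDsqr -EFinM; congr EFin; lra.
- by move=> x; rewrite invr_ge0 addr_ge0// sqr_ge0.
- exact: continuous_oneDsqrV.
- by move=> x; rewrite /= /oneDsqr sqrrN.
Qed.

Lemma sqrt_oneDsqr_gt0 (x : R) : 0 < Num.sqrt (1 + x ^+ 2).
Proof. by rewrite sqrtr_gt0 ltr_wpDr// sqr_ge0. Qed.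

Lemma continuous_sqrt_oneDsqr : continuous (fun x : R => Num.sqrt (1 + x ^+ 2)).
Proof. by move=> x; apply: continuous_comp; [exact: continuous_oneDsqr|exact: sqrt_continuous]. Qed.

Lemma is_derive_div_sqrt (x : R) : is_derive x 1 (fun x : R => x / Num.sqrt (1 + x ^+ 2)) (pow32 (1 + x ^+ 2))^-1.
Proof.
have h0 : 0 < 1 + x ^+ 2 by rewrite ltr_wpDr// sqr_ge0.
have s0 := sqrt_oneDsqr_gt0 x.
have s0' : Num.sqrt (1 + x ^+ 2) != 0 by rewrite gt_eqF.
have d1 : is_derive x 1 (fun x : R => 1 + x ^+ 2) (2 * x).
  by apply: is_derive_eq; rewrite /GRing.scale/=; ring.
have d2 : is_derive x 1 (fun x : R => Num.sqrt (1 + x ^+ 2)) (x / Num.sqrt (1 + x ^+ 2)).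
  have h := is_derive1_sqrt h0.
  have := @is_derive1_comp R Num.sqrt (fun x : R => 1 + x ^+ 2) x _ _ h d1.
  move=> /is_derive_eq; apply.
  by field.
have d3 := @is_deriveV R (fun x => Num.sqrt (1 + x ^+ 2)) x _ 1 s0' d2.
have := is_deriveM (is_derive_id x 1) d3.
move=> /is_derive_eq; apply.
rewrite /pow32 /GRing.scale/= -[X in _ = (X * _)^-1](sqr_sqrtr (ltW h0)).
have E : Num.sqrt (1 + x ^+ 2) ^+ 2 = 1 + x ^+ 2 by rewrite sqr_sqrtr// ltW.
have E' : x ^+ 2 = Num.sqrt (1 + x ^+ 2) ^+ 2 - 1 by rewrite E; ring.
transitivity ((Num.sqrt (1 + x ^+ 2) ^+ 2 - x ^+ 2) / Num.sqrt (1 + x ^+ 2) ^+ 3); first by field.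
by rewrite [X in _ - X]E'; field.
Qed.

Lemma cvgy_div_sqrt : (fun x : R => x / Num.sqrt (1 + x ^+ 2)) x @[x --> +oo] --> (1 : R).
Proof.
apply/cvgrPdist_lt => /= e e0; near=> x.
have x0 : 0 < x by near: x; exact: nbhs_pinfty_gt.
have s0 := sqrt_oneDsqr_gt0 x.
have xs : x <= Num.sqrt (1 + x ^+ 2).
  by rewrite -[leLHS](gtr0_norm x0) -sqrtr_sqr ler_wsqrtr// lerDr.
have sx : Num.sqrt (1 + x ^+ 2) <= x + 1.
  rewrite -[leRHS](@ger0_norm _ (x + 1)) -?sqrtr_sqr; last lra.
  by rewrite ler_wsqrtr// sqrrD; nra.
rewrite ger0_norm; last by rewrite subr_ge0 ler_pdivrMr// mul1r.
have ex : e^-1 < x by near: x; apply: nbhs_pinfty_gt; exact: num_real.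
apply: (@le_lt_trans _ _ x^-1); last by rewrite invf_plt.
rewrite lerBlDr -(ler_pM2r s0) mulrDl mulfVK ?gt_eqF// mul1r -lerBlDr.
by rewrite -(ler_pM2l x0) mulrA divff ?gt_eqF// mul1r; nra.
Unshelve. all: by end_near. Qed.

Lemma continuous_pow32V : continuous (fun x : R => (pow32 (1 + x ^+ 2))^-1).
Proof.
move=> x; apply: cvgV; first by rewrite gt_eqF// pow32_gt0// ltr_wpDr// sqr_ge0.
by apply: cvgM; [exact: continuous_oneDsqr|exact: continuous_sqrt_oneDsqr].
Qed.

Lemma integral_pow32 : (\int[mu]_x (pow32 (1 + x ^+ 2))^-1%:E = 2%:E)%E.
Proof.
have p0 (x : R) : 0 <= (pow32 (1 + x ^+ 2))^-1.
  by rewrite invr_ge0 ltW// pow32_gt0// ltr_wpDr// sqr_ge0.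
rewrite (ge0_symfun_integralT (f := fun x => (pow32 (1 + x ^+ 2))^-1))//; last 2 first.
- exact: continuous_pow32V.
- by move=> x; rewrite /= sqrrN.
rewrite (_ : [set x : R | 0 <= x] = `[0, +oo[%classic); last first.
  by apply/seteqP; split => x /=; rewrite in_itv/= andbT.
rewrite (ge0_continuous_FTC2y _ _ cvgy_div_sqrt)//=.
- by rewrite mul0r sube0 mule1.
- by apply: continuous_in_subspaceT => x _; exact: continuous_pow32V.
- by move=> x _; case: (is_derive_div_sqrt x).
- apply: cvg_at_right_filter.
  by case: (is_derive_div_sqrt 0) => /derivable1_diffP /differentiable_continuous.
- by move=> x _; rewrite derive1E; case: (is_derive_div_sqrt x).
Qed.

(** Completing the square: with [x = k * u + B / C] and [k ^+ 2 = K / C], the quadratic becomes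
    [K * (1 + u ^+ 2)]. *)
Lemma integral_quad (f : R -> R) (C B A : R) : 0 < C -> 0 < A * C - B ^+ 2 ->
  measurable_fun setT f -> (forall x, 0 <= f x) ->
  let K := (A * C - B ^+ 2) / C in
  (\int[mu]_x (f (C * x ^+ 2 - 2 * B * x + A))%:E =
   (Num.sqrt (K / C))%:E * \int[mu]_x (f (K * (1 + x ^+ 2)))%:E)%E.
Proof.
move=> C0 D0 mf f0 K.
have K0 : 0 < K by rewrite divr_gt0.
pose k := Num.sqrt (K / C).
have k0 : 0 < k by rewrite sqrtr_gt0 divr_gt0.
have k2 : k ^+ 2 = K / C by rewrite sqr_sqrtr// ltW// divr_gt0.
rewrite -(@ge0_integral_affine _ k (B / C) (fun x => (f (C * x ^+ 2 - 2 * B * x + A))%:E)) ?gt_eqF//; last first.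
- by move=> x; rewrite lee_fin.
- apply/measurable_EFinP; apply: (measurableT_comp mf).
  apply: measurable_funD => //; apply: measurable_funB => //; apply: measurable_funM => //.
- rewrite gtr0_norm//; congr (_ * _)%E; apply: eq_integral => x _; congr (f _)%:E.
  transitivity (C * k ^+ 2 * x ^+ 2 + (A - B ^+ 2 / C)); first by field; rewrite gt_eqF.
  by rewrite k2 /K; field; rewrite gt_eqF.
Qed.

Lemma quad_gt0 (C B A x : R) : 0 < C -> 0 < A * C - B ^+ 2 -> 0 < C * x ^+ 2 - 2 * B * x + A.
Proof.
move=> C0 D0; rewrite -(pmulr_rgt0 _ C0).
have -> : C * (C * x ^+ 2 - 2 * B * x + A) = (C * x - B) ^+ 2 + (A * C - B ^+ 2) by ring.
by rewrite ltr_wpDl// sqr_ge0.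
Qed.

Lemma pow32_ge0 (y : R) : 0 <= pow32 y.
Proof.
by have [y0|y0] := leP 0 y; rewrite /pow32; [rewrite mulr_ge0// sqrtr_ge0|rewrite ltr0_sqrtr// mulr0].
Qed.

Lemma integral_quad32 (C B A : R) : 0 < C -> 0 < A * C - B ^+ 2 ->
  (\int[mu]_x (pow32 (C * x ^+ 2 - 2 * B * x + A))^-1%:E = (2 * Num.sqrt C / (A * C - B ^+ 2))%:E)%E.
Proof.
move=> C0 D0.
have mf : measurable_fun setT (fun y : R => (pow32 y)^-1).
  by apply: measurable_funV; exact: measurable_pow32.
rewrite (integral_quad C0 D0 mf) => [|x]; last by rewrite invr_ge0 pow32_ge0.
set K := (A * C - B ^+ 2) / C.
have K0 : 0 < K by rewrite divr_gt0.
under eq_integral do rewrite pow32M ?(ltW K0)// invfM EFinM.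
rewrite ge0_integralZl_EFin//; first last.
- by rewrite invr_ge0 pow32_ge0.
- apply/measurable_EFinP; apply: measurable_funV; apply: measurable_pow32; exact: measurable_funD.
- by move=> x _; rewrite lee_fin invr_ge0 pow32_ge0.
rewrite integral_pow32 -!EFinM; congr EFin.
rewrite sqrtrM ?(ltW K0)// sqrtrV ?(ltW C0)// /pow32.
have sK : Num.sqrt K != 0 by rewrite gt_eqF// sqrtr_gt0.
have sC : Num.sqrt C != 0 by rewrite gt_eqF// sqrtr_gt0.
have D0' : A * C - B ^+ 2 != 0 by rewrite gt_eqF.
have KE : A * C - B ^+ 2 = K * Num.sqrt C ^+ 2 by rewrite sqr_sqrtr ?(ltW C0)// /K mulfVK// gt_eqF.
have K0' : K != 0 by rewrite gt_eqF.
by rewrite KE; clearbody K; field; rewrite ?K0' ?sK ?sC.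
Qed.

Lemma integral_quadV (C B A : R) : 0 < C -> 0 < A * C - B ^+ 2 ->
  (\int[mu]_x (C * x ^+ 2 - 2 * B * x + A)^-1%:E = (pi / Num.sqrt (A * C - B ^+ 2))%:E)%E.
Proof.
move=> C0 D0.
(* The absolute value makes the function nonnegative everywhere, as [integral_quad] demands; it has
   no effect on a positive quadratic. *)
have mf : measurable_fun setT (fun y : R => `|y|^-1).
  by apply: measurable_funV; exact: normr_measurable.
under eq_integral do rewrite -(gtr0_norm (quad_gt0 _ C0 D0)).
rewrite (integral_quad C0 D0 mf) => [|x]; last by rewrite invr_ge0.
set K := (A * C - B ^+ 2) / C.
have K0 : 0 < K by rewrite divr_gt0.
under eq_integral do rewrite normrM invfM EFinM.
rewrite ge0_integralZl_EFin//; first last.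
- apply/measurable_EFinP; apply: measurable_funV; apply: measurableT_comp; [exact: normr_measurable|exact: measurable_funD].
under eq_integral do rewrite ger0_norm ?addr_ge0 ?sqr_ge0//.
rewrite integral_oneDsqr -!EFinM; congr EFin.
rewrite gtr0_norm// sqrtrM ?(ltW K0)// sqrtrM ?(ltW D0)// sqrtrV ?(ltW C0)//.
have sD : Num.sqrt (A * C - B ^+ 2) != 0 by rewrite gt_eqF// sqrtr_gt0.
have sC : Num.sqrt C != 0 by rewrite gt_eqF// sqrtr_gt0.
have -> : K = Num.sqrt (A * C - B ^+ 2) ^+ 2 / Num.sqrt C ^+ 2 by rewrite !sqr_sqrtr ?(ltW C0) ?(ltW D0).
by field; rewrite ?sD ?sC.
Qed.

(** The isotropic Cauchy density, not normalized: its total mass is [2 * pi]. *)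
Definition cauchy2 (y : R * R) : R := (pow32 (1 + y.1 ^+ 2 + y.2 ^+ 2))^-1.

Lemma cauchy2_ge0 y : 0 <= cauchy2 y.
Proof. by rewrite invr_ge0 pow32_ge0. Qed.

Lemma measurable_cauchy2 d (T : measurableType d) (f : T -> R * R) : measurable_fun setT f ->
  measurable_fun setT (cauchy2 \o f).
Proof.
move=> mf; apply: (measurableT_comp (f := cauchy2)) => //.
apply: measurable_funV; apply: measurable_pow32.
apply: measurable_funD; first apply: measurable_funD => //.
  by apply: measurable_funX.
by apply: measurable_funX.
Qed.

Lemma integral_cauchy2_snd (u : R) : (\int[mu]_v (cauchy2 (u, v))%:E = (2 / (1 + u ^+ 2))%:E)%E.
Proof.
have h0 : 0 < 1 + u ^+ 2 by rewrite ltr_wpDr// sqr_ge0.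
have := @integral_quad32 1 0 (1 + u ^+ 2) ltr01.
rewrite mulr1 expr0n/= subr0 sqrtr1 mulr1 => /(_ h0) <-.
apply: eq_integral => v _; congr (pow32 _)^-1%:E; rewrite /=; ring.
Qed.

Lemma integral_cauchy2_fst (v : R) : (\int[mu]_u (cauchy2 (u, v))%:E = (2 / (1 + v ^+ 2))%:E)%E.
Proof.
rewrite -integral_cauchy2_snd; apply: eq_integral => u _; congr (pow32 _)^-1%:E; rewrite /=; ring.
Qed.

Local Notation mu2 := (mu \x mu)%E.

Lemma fubini_tonelli_plane (f : R * R -> \bar R) : measurable_fun setT f -> (forall y, (0 <= f y)%E) ->
  (\int[mu2]_y f y = \int[mu]_u \int[mu]_v f (u, v))%E.
Proof. by move=> mf f0; rewrite (fubini_tonelli1 (m1 := mu) (m2 := mu) f mf f0). Qed.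

Lemma fubini_tonelli_plane2 (f : R * R -> \bar R) : measurable_fun setT f -> (forall y, (0 <= f y)%E) ->
  (\int[mu2]_y f y = \int[mu]_v \int[mu]_u f (u, v))%E.
Proof. by move=> mf f0; rewrite (fubini_tonelli2 (m1 := mu) (m2 := mu) f mf f0). Qed.

Lemma measurable_cauchy2T : measurable_fun setT cauchy2.
Proof. exact: (@measurable_cauchy2 _ (R * R)%type id). Qed.

Lemma measurable_oneDsqrV : measurable_fun setT (fun u : R => 2 / (1 + u ^+ 2)).
Proof. by apply: measurable_funM => //; apply: measurable_funV; exact: measurable_funD. Qed.

Lemma integral_cauchy2 : (\int[mu2]_y (cauchy2 y)%:E = (2 * pi)%:E)%E.
Proof.
rewrite fubini_tonelli_plane; last first.
- by move=> y; rewrite lee_fin cauchy2_ge0.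
- by apply/measurable_EFinP; exact: measurable_cauchy2T.
under eq_integral do rewrite integral_cauchy2_snd EFinM.
rewrite ge0_integralZl_EFin//; first by rewrite integral_oneDsqr.
- by move=> x _; rewrite lee_fin invr_ge0 addr_ge0// sqr_ge0.
- by apply/measurable_EFinP; apply: measurable_funV; exact: measurable_funD.
Qed.

Lemma integral_tail_oneDsqr (L : R) : 0 < L ->
  (\int[mu]_(u in `[L, +oo[) (2 / (1 + u ^+ 2))%:E <= (2 / L)%:E)%E.
Proof.
move=> L0.
have dF u : L <= u -> is_derive u 1 (fun u => - (2 / u)) (2 / u ^+ 2).
  move=> Lu; have u0 : u != 0 by rewrite gt_eqF// (lt_le_trans L0).
  have h := @is_deriveV R id u _ 1 u0 (is_derive_id u 1).
  have := is_deriveN (is_deriveZ 2 h).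
  by move=> /is_derive_eq; apply; rewrite /GRing.scale/=; field.
have E : (\int[mu]_(u in `[L, +oo[) (2 / u ^+ 2)%:E = (2 / L)%:E)%E.
  rewrite (@ge0_continuous_FTC2y _ _ (fun u => - (2 / u)) _ 0).
  - by rewrite -EFinB sub0r opprK.
  - by move=> x Lx; rewrite divr_ge0// sqr_ge0.
  - apply: continuous_in_subspaceT => x; rewrite inE/= in_itv/= andbT => Lx.
    have x0 : x != 0 by rewrite gt_eqF// (lt_le_trans L0).
    apply: cvgM; first exact: cvg_cst.
    by apply: cvgV; [rewrite expf_neq0|exact: exprn_continuous].
  - apply/cvgrPdist_lt => /= e e0; near=> x; rewrite sub0r opprK.
    have x0 : 0 < x by near: x; exact: nbhs_pinfty_gt.
    rewrite gtr0_norm ?divr_gt0// ltr_pdivrMr// -ltr_pdivrMl// mulrC.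
    by near: x; apply: nbhs_pinfty_gt; exact: num_real.
  - by move=> x Lx; case: (dF _ (ltW Lx)).
  - by apply: cvg_at_right_filter; case: (dF _ (lexx L)) => /derivable1_diffP /differentiable_continuous.
  - by move=> x; rewrite in_itv/= andbT => Lx; rewrite derive1E; case: (dF _ (ltW Lx)).
rewrite -E; apply: ge0_le_integral => //.
- by move=> x _; rewrite lee_fin divr_ge0// addr_ge0// sqr_ge0.
- by apply/measurable_EFinP; apply: measurable_funTS; exact: measurable_oneDsqrV.
- apply/measurable_EFinP; apply: measurable_funTS; apply: measurable_funM => //; exact: measurable_funV.
- move=> x; rewrite /= in_itv/= andbT => Lx; have x0 := lt_le_trans L0 Lx.
  by rewrite lee_fin ler_pM2l// lef_pV2 ?posrE ?exprn_gt0// ?ltr_wpDr ?sqr_ge0// lerDr.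
Unshelve. all: by end_near. Qed.

Lemma measurable_indic_norm d (T : measurableType d) (L : R) (f : T -> R) :
  measurable_fun setT f -> measurable_fun setT (fun x => (L < `|f x|)%R%:R : R).
Proof.
move=> mf; rewrite (_ : (fun x => _) = fun x => if L < `|f x| then 1 else 0); last first.
  by apply/funext => x; case: ifP.
apply: measurable_fun_ifT => //; apply: measurable_fun_ltr => //.
by apply: measurableT_comp mf; exact: normr_measurable.
Qed.

(** A square rather than a disc, so that the mass outside is controlled by the two marginals. *)
Definition box (L : R) : set (R * R) := [set y | `|y.1| <= L /\ `|y.2| <= L].

Lemma measurable_box L : measurable (box L).
Proof.
have mf (f : R * R -> R) : measurable_fun setT f -> measurable [set y | `|f y| <= L].
  move=> mf; rewrite -[X in measurable X]setTI.
  have h : measurable_fun setT (fun y => `|f y|) by apply: measurableT_comp mf; exact: normr_measurable.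
  rewrite (_ : [set y | _] = (fun y => `|f y|) @^-1` `]-oo, L]); last first.
    by apply/seteqP; split => y /=; rewrite in_itv.
  by apply: h => //; exact: measurable_itv.
by apply: measurableI; [exact: (mf fst)|exact: (mf snd)].
Qed.

Lemma integral_tail_sym (L : R) : 0 < L ->
  (\int[mu]_u (2 / (1 + u ^+ 2) * (L < `|u|)%R%:R)%:E <= (4 / L)%:E)%E.
Proof.
move=> L0.
pose g : R -> \bar R := (fun u => (2 / (1 + u ^+ 2))%:E) \_ `[L, +oo[.
have p0 (u : R) : 0 <= 2 / (1 + u ^+ 2) by rewrite divr_ge0// addr_ge0// sqr_ge0.
have g0 u : (0 <= g u)%E by rewrite /g patchE; case: ifP => // _; rewrite lee_fin.
have mg : measurable_fun setT g.
  apply/(measurable_restrictT _ _).1 => //.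
  by apply: measurable_funTS; apply/measurable_EFinP; exact: measurable_oneDsqrV.
apply: (@le_trans _ _ (\int[mu]_u (g u + g (- u)%R))%E).
  apply: ge0_le_integral => //.
  - by move=> u _; rewrite lee_fin mulr_ge0.
  - by apply/measurable_EFinP; apply: measurable_funM; [exact: measurable_oneDsqrV|exact: measurable_indic_norm].
  - by apply: emeasurable_funD => //; exact: (measurableT_comp mg).
  - move=> u _; have [Lu|Lu] := ltP L `|u|; last by rewrite mulr0 adde_ge0.
    rewrite mulr1; have [u0|u0] := leP 0 u.
      rewrite -[leLHS]adde0 leeD// /g patchE mem_set//= in_itv/= andbT.
      by rewrite -(ger0_norm u0) ltW.
    rewrite -[leLHS]add0e leeD// /g patchE mem_set//= ?sqrrN// in_itv/= andbT.
    by rewrite -(ltr0_norm u0) ltW.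
rewrite ge0_integralD//; last by exact: (measurableT_comp mg).
rewrite ge0_integralN// -integral_mkcond.
have := leeD (integral_tail_oneDsqr L0) (integral_tail_oneDsqr L0).
by move=> /le_trans; apply; rewrite -EFinD lee_fin; lra.
Qed.

(** Outside the box one coordinate exceeds [L] in absolute value, and each marginal
    [2 / (1 + u ^+ 2)] has tails of mass at most [4 / L]. *)
Lemma box_mass_ge L : 0 < L -> ((2 * pi - 8 / L)%:E <= \int[mu2]_(y in box L) (cauchy2 y)%:E)%E.
Proof.
move=> L0.
have mi (f : R * R -> R) : measurable_fun setT f -> measurable_fun setT (fun y => (cauchy2 y * (L < `|f y|)%R%:R)%:E).
  move=> mf; apply/measurable_EFinP; apply: measurable_funM; [exact: measurable_cauchy2T|exact: measurable_indic_norm].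
have i0 (f : R * R -> R) y : (0 <= (cauchy2 y * (L < `|f y|)%R%:R)%:E)%E by rewrite lee_fin mulr_ge0// cauchy2_ge0.
have t1 : (\int[mu2]_y (cauchy2 y * (L < `|y.1|)%R%:R)%:E <= (4 / L)%:E)%E.
  rewrite fubini_tonelli_plane//; last exact: mi.
  apply: le_trans (integral_tail_sym L0); rewrite le_eqVlt; apply/orP; left; apply/eqP; apply: eq_integral => u _.
  under eq_integral do rewrite /= mulrC EFinM.
  rewrite ge0_integralZl_EFin//; first by rewrite integral_cauchy2_snd -EFinM mulrC.
  - by move=> v _; rewrite lee_fin cauchy2_ge0.
  - by apply/measurable_EFinP; apply: (measurable_fun_pair2 (f := cauchy2)); exact: measurable_cauchy2T.
have t2 : (\int[mu2]_y (cauchy2 y * (L < `|y.2|)%R%:R)%:E <= (4 / L)%:E)%E.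
  rewrite fubini_tonelli_plane2//; last exact: mi.
  apply: le_trans (integral_tail_sym L0); rewrite le_eqVlt; apply/orP; left; apply/eqP; apply: eq_integral => u _.
  under eq_integral do rewrite /= mulrC EFinM.
  rewrite ge0_integralZl_EFin//; first by rewrite integral_cauchy2_fst -EFinM mulrC.
  - by move=> v _; rewrite lee_fin cauchy2_ge0.
  - by apply/measurable_EFinP; apply: (measurable_fun_pair1 (f := cauchy2)); exact: measurable_cauchy2T.
have mb := measurable_box L.
have mc : measurable_fun setT (EFin \o cauchy2) by apply/measurable_EFinP; exact: measurable_cauchy2T.
set M := (X in (_ <= X)%E).
have ME : M = (\int[mu2]_y (((EFin \o cauchy2) \_ (box L)) y))%E by rewrite -integral_mkcond.
have r0 y : (0 <= ((EFin \o cauchy2) \_ (box L)) y)%E.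
  by rewrite patchE; case: ifP => // _; rewrite lee_fin cauchy2_ge0.
have mr : measurable_fun setT ((EFin \o cauchy2) \_ (box L)).
  by apply/(measurable_restrictT _ _).1 => //; exact: measurable_funTS.
have : ((2 * pi)%:E <= M + (\int[mu2]_y (cauchy2 y * (L < `|y.1|)%R%:R)%:E + \int[mu2]_y (cauchy2 y * (L < `|y.2|)%R%:R)%:E))%E.
  rewrite ME -ge0_integralD//; [|exact: mi|exact: mi].
  rewrite -ge0_integralD//; [|by move=> y _; rewrite adde_ge0|by apply: emeasurable_funD; exact: mi].
  rewrite -integral_cauchy2; apply: ge0_le_integral => //.
  - by move=> y _; rewrite lee_fin cauchy2_ge0.
  - by apply: emeasurable_funD => //; apply: emeasurable_funD; exact: mi.
  move=> y _; have c0 : (0 <= (cauchy2 y)%:E)%E by rewrite lee_fin cauchy2_ge0.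
  have [h1|h1] := ltP L `|y.1|; first by rewrite mulr1 addeCA leeDl// adde_ge0.
  have [h2|h2] := ltP L `|y.2|; first by rewrite mulr1 mulr0 add0e leeDr.
  by rewrite !mulr0 !adde0 patchE mem_set.
rewrite EFinB leeBlDr//; move=> /le_trans; apply; rewrite leeD2l//.
by apply: (le_trans (leeD t1 t2)); rewrite -EFinD lee_fin; lra.
Qed.

(* The isotropic Cauchy density is the balayage onto the plane of a unit mass at height 1: lines
   through [- q] are parametrized by their slope, which cancels the singularity of the kernel. *)
Lemma integral_cauchy2_potential (q1 q2 : R) :
  (\int[mu2]_y (cauchy2 y * (Num.sqrt ((q1 + y.1) ^+ 2 + (q2 + y.2) ^+ 2))^-1)%:E
   = (2 * pi / Num.sqrt (1 + q1 ^+ 2 + q2 ^+ 2))%:E)%E.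
Proof.
pose K (y : R * R) := cauchy2 y * (Num.sqrt ((q1 + y.1) ^+ 2 + (q2 + y.2) ^+ 2))^-1.
have K0 y : 0 <= K y by rewrite mulr_ge0 ?cauchy2_ge0// invr_ge0 sqrtr_ge0.
have mK : measurable_fun setT K.
  apply: measurable_funM; first exact: measurable_cauchy2T.
  apply: measurable_funV; apply: measurable_fun_sqrt; apply: measurable_funD.
    by apply: measurable_funX; exact: measurable_funD.
  by apply: measurable_funX; exact: measurable_funD.
rewrite fubini_tonelli_plane; [|exact/measurable_EFinP|by move=> y; rewrite lee_fin K0].
pose H (u : R) := (\int[mu]_v (K (u, v))%:E)%E.
have H0 u : (0 <= H u)%E by apply: integral_ge0 => v _; rewrite lee_fin K0.
have mH : measurable_fun setT H.
  apply: (@measurable_fun_fubini_tonelli_F _ _ _ _ _ mu (EFin \o K)).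
    exact/measurable_EFinP.
  by move=> y; rewrite lee_fin K0.
(* The translation [u = r - q1] puts the singular point at abscissa [r = 0]. *)
have := ge0_integral_affine (- q1) (oner_neq0 R) mH H0.
rewrite normr1 mul1e => <-.
pose A := 1 + q1 ^+ 2 + q2 ^+ 2.
pose B (s : R) := q1 + q2 * s.
pose C (s : R) := 1 + s ^+ 2.
have C0 s : 0 < C s by rewrite ltr_wpDr// sqr_ge0.
pose F (y : R * R) := (pow32 (C y.2 * y.1 ^+ 2 - 2 * B y.2 * y.1 + A))^-1 * (Num.sqrt (C y.2))^-1.
have F0 y : 0 <= F y by rewrite mulr_ge0// invr_ge0 ?pow32_ge0 ?sqrtr_ge0.
have mF : measurable_fun setT F.
  apply: measurable_funM.
    apply: measurable_funV; apply: measurable_pow32; apply: measurable_funD => //.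
    apply: measurable_funB; apply: measurable_funM => //.
    - by apply: measurable_funD => //; exact: measurable_funX.
    - exact: measurable_funX.
    - apply: measurable_funM => //; apply: measurable_funD => //; exact: measurable_funM.
  apply: measurable_funV; apply: measurable_fun_sqrt; apply: measurable_funD => //; exact: measurable_funX.
transitivity (\int[mu]_r \int[mu]_s (F (r, s))%:E)%E.
  apply: ge0_ae_eq_integral => //.
  - by apply: (measurableT_comp mH); exact: measurable_funD.
  - by apply: (@measurable_fun_fubini_tonelli_F _ _ _ _ _ mu (EFin \o F)) => //; exact/measurable_EFinP.
  - by move=> r _; apply: integral_ge0 => s _; rewrite lee_fin.
  exists [set 0]; split => //; first exact: lebesgue_measure_set1.
  move=> r /=; apply: contraPP => /= /eqP r0; apply; move=> _.
  rewrite /H mul1r.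
  (* The substitution [v = r * s - q2] has Jacobian [|r|], which cancels the factor [1 / |r|] of the
     kernel, because [(q1 + u) ^+ 2 + (q2 + v) ^+ 2 = r ^+ 2 * (1 + s ^+ 2)]. *)
  rewrite -(@ge0_integral_affine _ r (- q2) (fun v => (K (r - q1, v))%:E))//; first last.
  + by move=> v; rewrite lee_fin.
  + by apply/measurable_EFinP; exact: (measurable_fun_pair2 (f := K)).
  rewrite -ge0_integralZl_EFin//; first last.
  + apply/measurable_EFinP; apply: (measurableT_comp (f := fun v => K (r - q1, v))).
      exact: (measurable_fun_pair2 (f := K)).
    exact: measurable_funD.
  + by move=> s _; rewrite lee_fin.
  apply: eq_integral => s _; rewrite -EFinM; congr EFin.
  rewrite /K /F /cauchy2 /= mulrCA; congr (_ * _); first by congr (pow32 _)^-1; rewrite /A /B /C; ring.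
  rewrite (_ : _ + _ = r ^+ 2 * C s); last by rewrite /C; ring.
  rewrite sqrtrM ?sqr_ge0// sqrtr_sqr invfM mulrA divff ?mul1r// normr_eq0//.
(* Integrating in [r] first, the factor [Num.sqrt (C s)] cancels; what remains in [s] is the inverse
   of a quadratic whose determinant is [A]. *)
rewrite (fubini_tonelli (m1 := mu) (m2 := mu) (EFin \o F))//=; last exact/measurable_EFinP.
have D0 s : 0 < A * C s - B s ^+ 2.
  rewrite (_ : _ - _ = 1 + s ^+ 2 + (q1 * s - q2) ^+ 2); last by rewrite /A /B /C; ring.
  by rewrite ltr_wpDr ?sqr_ge0// C0.
transitivity (\int[mu]_s (2 * ((1 + q1 ^+ 2) * s ^+ 2 - 2 * (q1 * q2) * s + (1 + q2 ^+ 2))^-1)%:E)%E.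
  apply: eq_integral => s _; rewrite /F/=.
  under eq_integral do rewrite mulrC EFinM.
  rewrite ge0_integralZl_EFin//; first last.
  - apply/measurable_EFinP; apply: measurable_funV; apply: measurable_pow32.
    apply: measurable_funD => //; apply: measurable_funB; exact: measurable_funM.
  - by move=> r _; rewrite lee_fin invr_ge0 pow32_ge0.
  rewrite integral_quad32// -EFinM; congr EFin.
  rewrite (_ : (1 + q1 ^+ 2) * s ^+ 2 - 2 * (q1 * q2) * s + (1 + q2 ^+ 2) = A * C s - B s ^+ 2); last by rewrite /A /B /C; ring.
  by field; rewrite !gt_eqF// sqrtr_gt0.
have A0 : 0 < A by rewrite /A !ltr_wpDr ?sqr_ge0.
have DD : 0 < (1 + q2 ^+ 2) * (1 + q1 ^+ 2) - (q1 * q2) ^+ 2.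
  by rewrite (_ : _ - _ = A)//; rewrite /A; ring.
have h1 : 0 < 1 + q1 ^+ 2 by rewrite ltr_wpDr// sqr_ge0.
under eq_integral do rewrite EFinM.
rewrite ge0_integralZl_EFin//; first last.
- apply/measurable_EFinP; apply: measurable_funV; apply: measurable_funD => //.
  apply: measurable_funB; exact: measurable_funM.
- by move=> s _; rewrite lee_fin invr_ge0 ltW// quad_gt0.
rewrite integral_quadV// -EFinM mulrA; congr (_ / Num.sqrt _)%:E; ring.
Qed.

(* The inverse with the value [+oo] at [0], where the field inverse is [0]. *)
Definition einv (r : R) : \bar R := if r == 0 then +oo%E else (r^-1)%:E.

Lemma measurable_einv d (T : measurableType d) (f : T -> R) : measurable_fun setT f ->
  measurable_fun setT (fun x => einv (f x)).
Proof.
move=> mf; apply: measurable_fun_ifT => //.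
- by apply: measurable_fun_eqr.
- by apply/measurable_EFinP; exact: measurable_funV.
Qed.

Lemma einv_ge0 r : 0 <= r -> (0 <= einv r)%E.
Proof. by move=> r0; rewrite /einv; case: ifP => // _; rewrite lee_fin invr_ge0. Qed.

(** As a function of [w = 1 / Num.sqrt s], the left-hand side is [w / Num.sqrt (1 + Z * w ^+ 2)],
    which is concave; the right-hand side is its tangent at [s = A]. *)
Lemma sqrt_concavity (A Z s : R) : 0 < A -> 0 <= Z -> 0 < s ->
  (Num.sqrt (s + Z))^-1 <= (pow32 A * (Num.sqrt s)^-1 + Z) / pow32 (A + Z).
Proof.
move=> A0 Z0 s0.
have AZ0 : 0 < A + Z by rewrite ltr_wpDr.
have sZ0 : 0 < s + Z by rewrite ltr_wpDr.
have ss : 0 < Num.sqrt s by rewrite sqrtr_gt0.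
have sA : 0 < Num.sqrt A by rewrite sqrtr_gt0.
have sAZ : 0 < Num.sqrt (A + Z) by rewrite sqrtr_gt0.
have ssZ : 0 < Num.sqrt (s + Z) by rewrite sqrtr_gt0.
rewrite ler_pdivlMr ?pow32_gt0// mulrC ler_pdivrMr//.
rewrite -ler_sqr ?nnegrE; first last.
- by rewrite mulr_ge0 ?(ltW ssZ)// addr_ge0// divr_ge0 ?pow32_ge0 ?(ltW ss).
- exact: pow32_ge0.
(* In terms of [c], [s] and [Z] the squared inequality is polynomial, and the difference of its
   sides carries the factor [(c - 1) ^+ 2] of a tangency. *)
pose c := Num.sqrt A / Num.sqrt s.
have c0 : 0 < c by rewrite divr_gt0.
have cs : c ^+ 2 * s = A by rewrite /c expr_div_n !sqr_sqrtr ?(ltW A0) ?(ltW s0)// mulfVK// gt_eqF.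
have E1 : pow32 A / Num.sqrt s = c ^+ 3 * s.
  rewrite (_ : c ^+ 3 * s = c * (c ^+ 2 * s)); last by ring.
  by rewrite cs /pow32 /c; ring.
have E2 : pow32 (A + Z) ^+ 2 = (A + Z) ^+ 3 by rewrite /pow32 exprMn sqr_sqrtr ?(ltW AZ0)//; ring.
rewrite E1 E2 exprMn sqr_sqrtr ?(ltW sZ0)// -cs -subr_ge0.
rewrite (_ : _ - _ = s ^+ 2 * Z * (c ^+ 3 * (c - 1) ^+ 2 * (c + 2)) + s * Z ^+ 2 * ((c - 1) ^+ 2 * (2 * c + 1))); last by ring.
have c0' := ltW c0; have s0' := ltW s0.
move: (sqr_ge0 (c - 1)); set w := (c - 1) ^+ 2 => w0.
by apply: addr_ge0; repeat apply: mulr_ge0 => //; lra.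
Qed.

(** [Z] stands for the squared distance in the directions orthogonal to the plane. This is Jensen's
    inequality: the planar average of [1 / Num.sqrt s] is exactly [1 / Num.sqrt A], so averaging the
    tangent at [s = A] returns the value at the point of tangency. *)
Lemma cauchy2_smoothing (q1 q2 Z sigma : R) : 0 <= Z -> sigma != 0 ->
  (\int[mu2]_y ((cauchy2 y)%:E * einv (Num.sqrt ((q1 + sigma * y.1) ^+ 2 + (q2 + sigma * y.2) ^+ 2 + Z)))
   <= (2 * pi / Num.sqrt (q1 ^+ 2 + q2 ^+ 2 + Z + sigma ^+ 2))%:E)%E.
Proof.
move=> Z0 s0.
pose p1 := q1 / sigma; pose p2 := q2 / sigma.
pose A := q1 ^+ 2 + q2 ^+ 2 + sigma ^+ 2.
have A0 : 0 < A by rewrite ltr_wpDl ?addr_ge0 ?sqr_ge0// lt_neqAle sqr_ge0 eq_sym expf_neq0.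
have AZ0 : 0 < A + Z by rewrite ltr_wpDr.
pose t (y : R * R) := (p1 + y.1) ^+ 2 + (p2 + y.2) ^+ 2.
have E (y : R * R) : (q1 + sigma * y.1) ^+ 2 + (q2 + sigma * y.2) ^+ 2 = sigma ^+ 2 * t y.
  by rewrite /t /p1 /p2; field.
pose c1 := pow32 A * `|sigma|^-1 / pow32 (A + Z).
pose c2 := Z / pow32 (A + Z).
have c10 : 0 <= c1 by rewrite /c1 divr_ge0 ?pow32_ge0// divr_ge0 ?pow32_ge0.
have c20 : 0 <= c2 by rewrite /c2 divr_ge0 ?pow32_ge0.
have mt : measurable_fun setT t.
  by apply: measurable_funD; apply: measurable_funX; exact: measurable_funD.
pose G (y : R * R) : \bar R := (c1%:E * (cauchy2 y * (Num.sqrt (t y))^-1)%:E + c2%:E * (cauchy2 y)%:E)%E.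
have mc : measurable_fun setT (EFin \o cauchy2) by apply/measurable_EFinP; exact: measurable_cauchy2T.
have mG1 : measurable_fun setT (fun y => (cauchy2 y * (Num.sqrt (t y))^-1)%:E).
  apply/measurable_EFinP; apply: measurable_funM; first exact: measurable_cauchy2T.
  by apply: measurable_funV; exact: measurable_fun_sqrt.
have G10 y : (0 <= (cauchy2 y * (Num.sqrt (t y))^-1)%:E)%E.
  by rewrite lee_fin mulr_ge0 ?cauchy2_ge0// invr_ge0 sqrtr_ge0.
have G20 y : (0 <= (cauchy2 y)%:E)%E by rewrite lee_fin cauchy2_ge0.
apply: (@le_trans _ _ (\int[mu2]_y G y)%E).
  apply: ae_ge0_le_integral => //.
  - by move=> y _; rewrite mule_ge0// einv_ge0// sqrtr_ge0.
  - apply: emeasurable_funM => //; apply: measurable_einv; apply: measurable_fun_sqrt.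
    by apply: measurable_funD => //; apply: measurable_funD; apply: measurable_funX; apply: measurable_funD => //; exact: measurable_funM.
  - by move=> y _; rewrite adde_ge0// mule_ge0.
  - by apply: emeasurable_funD; exact: measurable_funeM.
  exists ([set - p1] `*` setT); split.
  - exact: measurableX.
  - transitivity (mu [set (- p1)%R] * mu setT)%E; first exact: product_measure1E.
    by rewrite lebesgue_measure_set1 mul0e.
  move=> y /=; apply: contra_notP => /not_andP[|//] y1 _.
  have t0 : 0 < t y.
    rewrite ltr_wpDr ?sqr_ge0// lt_neqAle sqr_ge0 eq_sym expf_neq0// addrC addr_eq0.
    exact/eqP.
  have st0 : 0 < sigma ^+ 2 * t y by rewrite mulr_gt0// lt_neqAle sqr_ge0 eq_sym expf_neq0.
  have stZ : 0 < sigma ^+ 2 * t y + Z by rewrite ltr_wpDr.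
  rewrite E /einv gt_eqF ?sqrtr_gt0// /G -!EFinM -EFinD lee_fin.
  apply: (le_trans (ler_wpM2l (cauchy2_ge0 y) (sqrt_concavity A0 Z0 st0))).
  rewrite sqrtrM ?sqr_ge0// sqrtr_sqr invfM /c1 /c2 le_eqVlt; apply/orP; left; apply/eqP; ring.
rewrite /G ge0_integralD//; first last.
- exact: measurable_funeM.
- by move=> y _; rewrite mule_ge0.
- exact: measurable_funeM.
- by move=> y _; rewrite mule_ge0.
rewrite !ge0_integralZl_EFin// integral_cauchy2 integral_cauchy2_potential -!EFinM -EFinD lee_fin.
have -> : 1 + p1 ^+ 2 + p2 ^+ 2 = A / sigma ^+ 2 by rewrite /p1 /p2 /A; field.
rewrite sqrtrM ?(ltW A0)// sqrtrV ?sqr_ge0// sqrtr_sqr.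
have -> : q1 ^+ 2 + q2 ^+ 2 + Z + sigma ^+ 2 = A + Z by rewrite /A; ring.
rewrite /c1 /c2.
have sA : Num.sqrt A != 0 by rewrite gt_eqF// sqrtr_gt0.
have sAZ : Num.sqrt (A + Z) != 0 by rewrite gt_eqF// sqrtr_gt0.
have AZ0' : A + Z != 0 by rewrite gt_eqF.
have sg : `|sigma| != 0 by rewrite normr_eq0.
rewrite /pow32 le_eqVlt; apply/orP; left; apply/eqP; field.
by rewrite sg sA sAZ AZ0'.
Qed.

End PlanarCauchy.

(** * The action of a curve *)

Section IntegralNullSet.
Context d (T : measurableType d) (R : realType) (mu : {measure set T -> \bar R}).
Import HBNNSimple.

(** Even without measurability the integral is a supremum over simple functions lying below, and
    such a function can be cut off on a measurable null set without changing its integral. *)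
Lemma le_integral_null_set (N : set T) (f g : T -> \bar R) : measurable N -> mu N = 0 ->
  (forall x, (0 <= f x)%E) -> (forall x, (0 <= g x)%E) ->
  (forall x, ~ N x -> (f x <= g x)%E) -> (\int[mu]_x f x <= \int[mu]_x g x)%E.
Proof.
move=> mN N0 f0 g0 fg; rewrite !ge0_integralTE//.
apply: ge_ereal_sup => _ [h hf <-].
pose h1 := proj_nnsfun h (measurableC mN).
have h1E : h1 = h \_ (~` N) :> (T -> R) by apply/esym; exact: mrestrict.
rewrite -integralT_nnsfun.
have -> : (\int[mu]_x (h x)%:E = \int[mu]_x (h1 x)%:E)%E.
  apply: ge0_ae_eq_integral => //.
  - by apply/measurable_EFinP.
  - by apply/measurable_EFinP.
  - by move=> x _; rewrite lee_fin.
  - by move=> x _; rewrite lee_fin.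
  exists N; split => // x /=; apply: contra_notP => Nx _.
  by rewrite mindicE mem_set//= mulr1.
rewrite integralT_nnsfun; apply: ereal_sup_ubound; exists h1 => //= x.
have := congr1 (fun F => F x) h1E; rewrite /h1/= => ->; rewrite patchE; case: ifPn => // /set_mem Nx.
exact: le_trans (hf x) (fg _ Nx).
Qed.

(* Measurability is not available in the application: the default value of [derive1] is not under control. *)
Lemma eq_integral_null_set (D N : set T) (f g : T -> \bar R) : measurable N -> mu N = 0 ->
  (forall x, D x -> (0 <= f x)%E) -> (forall x, D x -> (0 <= g x)%E) ->
  (forall x, D x -> ~ N x -> f x = g x) -> (\int[mu]_(x in D) f x = \int[mu]_(x in D) g x)%E.
Proof.
move=> mN N0 f0 g0 fg; rewrite integral_mkcond [RHS]integral_mkcond.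
have p0 (F : T -> \bar R) : (forall x, D x -> (0 <= F x)%E) -> forall x, (0 <= (F \_ D) x)%E.
  by move=> F0 x; rewrite patchE; case: ifPn => // /set_mem; exact: F0.
have pe x : ~ N x -> (f \_ D) x = (g \_ D) x.
  by move=> Nx; rewrite !patchE; case: ifPn => // /set_mem Dx; exact: fg.
apply/eqP; rewrite eq_le; apply/andP; split.
  by apply: (le_integral_null_set mN N0) => // [||x /pe->]; [exact: p0|exact: p0|].
by apply: (le_integral_null_set mN N0) => // [||x /pe->]; [exact: p0|exact: p0|].
Qed.

End IntegralNullSet.

(** * Stability of absolute continuity *)

Section Lipschitz.
Context {R : realType} {V : normedModType R}.

Lemma abs_continuousD (a b : R) (f g : R -> V) :
  abs_continuous a b f -> abs_continuous a b g -> abs_continuous a b (fun t => f t + g t).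
Proof.
move=> hf hg e e0; have e20 : 0 < e / 2 by lra.
have [d1 d10 h1] := hf _ e20; have [d2 d20 h2] := hg _ e20.
exists (Num.min d1 d2); first by rewrite lt_min d10.
move=> n s t st tr; rewrite lt_min => /andP[l3 l4].
rewrite (splitr e); apply: le_lt_trans (ltrD (h1 _ _ _ st tr l3) (h2 _ _ _ st tr l4)).
rewrite -big_split/=; apply: ler_sum => k _.
by rewrite opprD addrACA; exact: ler_normD.
Qed.

Lemma lipschitz_abs_continuous (a b L : R) (f : R -> V) :
  (forall s t, a <= s -> s <= t -> t <= b -> `|f t - f s| <= L * (t - s)) ->
  abs_continuous a b f.
Proof.
move=> hf e e0; pose M := Num.max L 1.
have M0 : 0 < M by rewrite lt_max ltr01 orbT.
exists (e / M); first by rewrite divr_gt0.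
move=> n s t st _ ld.
apply: (@le_lt_trans _ _ (\sum_(k < n) M * (t k - s k))).
  apply: ler_sum => k _; have [h1 h2 h3] := st k.
  apply: le_trans (hf _ _ h1 h2 h3) _; rewrite ler_wpM2r ?subr_ge0//.
  by rewrite le_max lexx.
by rewrite -mulr_sumr mulrC -ltr_pdivlMr.
Qed.

Lemma abs_continuousS (a b c d : R) (f : R -> V) : a <= c -> d <= b ->
  abs_continuous a b f -> abs_continuous c d f.
Proof.
move=> ac db hf e e0; have [d1 d10 h1] := hf _ e0; exists d1 => // n s t st.
apply: h1 => k; have [h1 h2 h3] := st k; split => //; lra.
Qed.

End Lipschitz.

(** * Kinetic and potential parts of the action *)

Section Action.
Context {R : realType} {N d : nat} (m : 'I_N -> R) (h : R).
Hypothesis m0 : forall i, 0 < m i.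
Hypothesis h0 : 0 <= h.
Local Notation mu := (@lebesgue_measure R).
Local Notation conf := 'M[R]_(N, d).
Implicit Types (x y v : conf) (g w : R -> conf) (a b c : R).

Definition kin (v : conf) : R := \sum_(i < N) m i * \sum_(k < d) v i k ^+ 2.

Lemma kin_ge0 v : 0 <= kin v.
Proof. by apply: sumr_ge0 => i _; rewrite mulr_ge0 ?(ltW (m0 i))// sumr_ge0// => k _; exact: sqr_ge0. Qed.

Lemma enorm_sqr n (u : 'rV[R]_n) : enorm u ^+ 2 = \sum_(k < n) u 0 k ^+ 2.
Proof. by rewrite sqr_sqrtr// sumr_ge0// => k _; exact: sqr_ge0. Qed.

Lemma mass_norm_sqr v : mass_norm m v ^+ 2 = kin v.
Proof.
rewrite /mass_norm sqr_sqrtr; last first.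
  by apply: sumr_ge0 => i _; rewrite mulr_ge0 ?(ltW (m0 i))// sqr_ge0.
apply: eq_bigr => i _; rewrite enorm_sqr; congr (_ * _); apply: eq_bigr => k _.
by rewrite mxE.
Qed.

Lemma mutual_distE x (i j : 'I_N) : mutual_dist x i j = Num.sqrt (\sum_(k < d) (x i k - x j k) ^+ 2).
Proof. by congr Num.sqrt; apply: eq_bigr => k _; rewrite !mxE. Qed.

Lemma mutual_dist_ge0 x (i j : 'I_N) : 0 <= mutual_dist x i j.
Proof. exact: sqrtr_ge0. Qed.

Lemma mutual_dist_eq0 x (i j : 'I_N) : (mutual_dist x i j == 0) = (row i x == row j x).
Proof.
rewrite mutual_distE sqrtr_eq0 le_eqVlt ltNge sumr_ge0 ?orbF => [|k _]; last exact: sqr_ge0.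
rewrite psumr_eq0 => [|k _]; last exact: sqr_ge0.
apply/allP/eqP => [H|/rowP H k _].
  apply/rowP => k; rewrite !mxE; apply/eqP; rewrite -subr_eq0 -sqrf_eq0; exact: H (mem_index_enum k).
by have := H k; rewrite !mxE => ->; rewrite subrr expr0n /= eqxx.
Qed.

(** With [einv] a collision makes its own term infinite; the case distinction disappears and
    measurability can be checked term by term. *)
Lemma potentialE x : potential m x =
  (\sum_(i < N) \sum_(j < N | (i < j)%N) (m i * m j)%:E * einv (mutual_dist x i j))%E.
Proof.
rewrite /potential; case: ifPn => [/set_mem cf|/negP ncf].
  rewrite -sumEFin; apply: eq_bigr => i _; rewrite -sumEFin; apply: eq_bigr => j ij.
  rewrite /einv mutual_dist_eq0 (negPf (cf _ _ _)) ?EFinM//.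
  by apply: contraTN ij => /eqP->; rewrite ltnn.
have t0 (i j : 'I_N) : (0 <= (m i * m j)%:E * einv (mutual_dist x i j))%E.
  by rewrite mule_ge0 ?einv_ge0 ?mutual_dist_ge0// lee_fin mulr_ge0 ?(ltW (m0 _)).
have [i [j [ij xij]]] : exists i j : 'I_N, (i < j)%N /\ row i x = row j x.
  apply: contrapT => H; apply: ncf; rewrite inE => i j ij; apply/eqP => xij; apply: H.
  have [ltij|ltji|/val_inj eij] := ltngtP i j; [by exists i, j|by exists j, i|].
  by rewrite eij eqxx in ij.
apply/esym/eqP; rewrite -leye_eq (bigD1 i)//= (bigD1 j)//=.
rewrite {1}/einv mutual_dist_eq0 xij eqxx gt0_muley ?lte_fin ?mulr_gt0//.
rewrite -addeA leeDl// adde_ge0// ?sume_ge0// => k _; rewrite sume_ge0//.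
Qed.

Lemma potential_ge0 x : (0 <= potential m x)%E.
Proof.
rewrite potentialE sume_ge0// => i _; rewrite sume_ge0// => j _.
by rewrite mule_ge0 ?einv_ge0 ?mutual_dist_ge0// lee_fin mulr_ge0 ?(ltW (m0 _)).
Qed.

Lemma measurable_kin d' (T : measurableType d') (D : set T) (f : T -> conf) :
  (forall i k, measurable_fun D (fun t => f t i k)) -> measurable_fun D (fun t => kin (f t)).
Proof.
move=> mf; apply: measurable_sum => i; apply: measurable_funM => //.
by apply: measurable_sum => k; exact: measurable_funX.
Qed.

Lemma measurable_mutual_dist d' (T : measurableType d') (D : set T) (f : T -> conf) i j :
  (forall i k, measurable_fun D (fun t => f t i k)) -> measurable_fun D (fun t => mutual_dist (f t) i j).
Proof.
move=> mf; under eq_fun do rewrite mutual_distE.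
apply: measurable_fun_sqrt; apply: measurable_sum => k.
by apply: measurable_funX; exact: measurable_funB.
Qed.

Lemma measurable_potential d' (T : measurableType d') (f : T -> conf) :
  (forall i k, measurable_fun setT (fun t => f t i k)) -> measurable_fun setT (fun t => potential m (f t)).
Proof.
move=> mf.
rewrite (_ : (fun t => _) = fun t => (\sum_(i < N) \sum_(j < N)
    (if (i < j)%N then (m i * m j)%:E * einv (mutual_dist (f t) i j) else 0))%E); last first.
  by apply/funext => t; rewrite potentialE; apply: eq_bigr => i _; rewrite big_mkcond.
apply: emeasurable_sum => i; apply: emeasurable_sum => j; case: (i < j)%N => //.
by apply: measurable_funeM; apply: measurable_einv; exact: measurable_mutual_dist.
Qed.

(** A measurable representative of the derivative, to be used instead of [derive1], whose values at
    the exceptional times are uncontrolled. *)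
Definition velocity a b g w :=
  (forall i k, measurable_fun setT (fun t => w t i k)) /\
  {ae mu, forall t, a < t < b -> is_derive t 1 g (w t)}.

Definition Kin a b w : \bar R := (\int[mu]_(t in `[a, b]) (2^-1 * kin (w t))%:E)%E.
Definition Pot a b g : \bar R := (\int[mu]_(t in `[a, b]) potential m (g t))%E.

Lemma lagrangian_ge0 x v : (0 <= lagrangian m x v)%E.
Proof. by rewrite /lagrangian adde_ge0 ?potential_ge0// lee_fin mass_norm_sqr mulr_ge0// kin_ge0. Qed.

Lemma coord_le_norm (u : conf) i k : `|u i k| <= `|u|.
Proof.
rewrite [leRHS]/Num.Def.normr/= mx_normrE.
by apply: le_trans; last exact: (le_bigmax _ _ (i, k)).
Qed.

Lemma abs_continuous_coord a b g i k : abs_continuous a b g -> abs_continuous a b (fun t => g t i k).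
Proof.
move=> hg e e0; have [d1 d10 h1] := hg _ e0; exists d1 => // n s t st tr ld.
apply: le_lt_trans (h1 n s t st tr ld); apply: ler_sum => l _.
by have := coord_le_norm (g (t l) - g (s l)) i k; rewrite !mxE.
Qed.

Lemma coord_clamp_continuous a b g i k : a <= b -> abs_continuous a b g -> continuous (fun t => g (clamp a b t) i k).
Proof.
move=> ab hg; apply: (@seq_ac_continuous _ a b (fun t => g t i k)) => //.
by apply: abs_continuous_seq_ac; exact: abs_continuous_coord.
Qed.

Lemma measurable_potential_curve a b g : a <= b -> abs_continuous a b g ->
  measurable_fun `[a, b] (fun t => potential m (g t)).
Proof.
move=> ab hg.
apply: (eq_measurable_fun (fun t => potential m (g (clamp a b t)))).
  by move=> t; rewrite inE/= in_itv/= => /andP[at' tb]; rewrite clamp_id.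
apply: measurable_funTS; apply: measurable_potential => i k.
by apply: continuous_measurable_fun; exact: coord_clamp_continuous.
Qed.

Lemma actionE a b g w : a <= b -> abs_continuous a b g -> velocity a b g w ->
  action m h a b g = (Kin a b w + Pot a b g + (h * (b - a))%:E)%E.
Proof.
move=> ab hg [mw [N0 [mN0 N00 dw]]]; rewrite /action; congr (_ + _)%E.
rewrite /Kin /Pot -ge0_integralD//; first last.
- exact: measurable_potential_curve.
- by move=> t _; exact: potential_ge0.
- by apply/measurable_EFinP; apply: measurable_funTS; apply: measurable_funM => //; exact: measurable_kin.
- by move=> t _; rewrite lee_fin mulr_ge0// kin_ge0.
(* The end points join the null set, since [velocity] says nothing about the derivative there. *)
apply: (eq_integral_null_set (N := N0 `|` [set a; b])).
- by apply: measurableU => //; apply: measurableU; exact: measurable_set1.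
- apply/eqP; rewrite eq_le measure_ge0 andbT.
  apply: (le_trans (measureU2 _ _ _)) => //; first by apply: measurableU; exact: measurable_set1.
  rewrite [X in (X + _)%E]N00 add0e; apply: (le_trans (measureU2 _ _ _)); [exact: measurable_set1|exact: measurable_set1|].
  by rewrite [X in (X + _)%E]lebesgue_measure_set1 [X in (_ + X)%E]lebesgue_measure_set1 adde0.
- by move=> t _; exact: lagrangian_ge0.
- by move=> t _; rewrite adde_ge0 ?potential_ge0// lee_fin mulr_ge0// kin_ge0.
move=> t; rewrite /= in_itv/= => /andP[at' tb] /not_orP[nN /not_orP[/eqP ta /eqP tb']].
have tab : a < t < b by rewrite !lt_neqAle at' tb eq_sym ta tb'.
have : is_derive t 1 g (w t) by apply: contrapT => H; apply: nN; apply: dw => /= /(_ tab).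
move=> [_ E]; by rewrite /lagrangian mass_norm_sqr derive1E E.
Qed.

Lemma is_derive_mxP (g : R -> conf) (t : R) (v : conf) : is_derive t 1 g v <-> forall i k, is_derive t 1 (fun s => g s i k) (v i k).
Proof.
split=> [[dg Dg] i k|H].
  have dgik : derivable (fun s => g s i k) t 1 by exact: (derivable_mxP _ _ _).1.
  by apply: DeriveDef => //; rewrite -Dg derive_mx// mxE.
have dg : derivable g t 1 by apply/derivable_mxP => i k; case: (H i k).
by apply: DeriveDef => //; rewrite derive_mx//; apply/matrixP => i k; rewrite mxE; case: (H i k).
Qed.

(** The fundamental theorem is applied to each coordinate, and the finitely many null sets are
    merged. *)
Lemma curve_velocity a b g : a < b -> abs_continuous a b g -> exists w,
  [/\ velocity a b g w,
      forall i k, mu.-integrable setT (fun t => (w t i k)%:E) &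
      forall i k s t, a <= s -> s <= t -> t <= b -> \int[mu]_(u in `[s, t]) w u i k = g t i k - g s i k].
Proof.
move=> ab hg.
have H i k := abs_continuous_FTC ab (abs_continuous_coord i k hg).
pose f i k := sval (cid (H i k)).
have fP i k := svalP (cid (H i k)).
exists (fun t => \matrix_(i, k) f i k t); split.
- split.
    move=> i k; under eq_fun do rewrite mxE.
    by apply/measurable_EFinP; have [/measurable_int + _ _] := fP i k.
  have ae i k : {ae mu, forall t, a < t < b -> is_derive t 1 (fun t => g t i k) (f i k t)}.
    by have [_ _] := fP i k.
  have : {ae mu, forall t, forall ik : 'I_N * 'I_d, a < t < b -> is_derive t 1 (fun t => g t ik.1 ik.2) (f ik.1 ik.2 t)}.
    by apply: filter_forall => -[i k]; exact: ae.
  apply: filterS; first exact: (ae_filter_ringOfSetsType mu).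
  move=> t Ht tab.
  by apply/is_derive_mxP => i k; rewrite mxE; exact: (Ht (i, k)).
- by move=> i k; under eq_fun do rewrite mxE; have [] := fP i k.
- move=> i k s t as' st tb; have [_ + _] := fP i k; move=> /(_ _ _ as' st tb) <-.
  by apply: eq_Rintegral => u _; rewrite mxE.
Qed.

Lemma Kin_ge0 a b w : (0 <= Kin a b w)%E.
Proof. by apply: integral_ge0 => t _; rewrite lee_fin mulr_ge0// kin_ge0. Qed.

Lemma Pot_ge0 a b g : (0 <= Pot a b g)%E.
Proof. by apply: integral_ge0 => t _; exact: potential_ge0. Qed.

Lemma preimage_itv_affine a b c t : 0 < c ->
  (c * t + a \in `[a, b]) = (t \in `[0, (b - a) / c]).
Proof.
move=> c0; rewrite !in_itv/= lerDr pmulr_rge0// ler_pdivlMr// mulrC lerBrDr.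
by [].
Qed.

Lemma integral_itv_affine a b c (F : R -> \bar R) : 0 < c ->
  measurable_fun `[a, b] F -> (forall t, (0 <= F t)%E) ->
  (\int[mu]_(t in `[0%R, ((b - a) / c)%R]) F (c * t + a)%R = (c^-1)%:E * \int[mu]_(t in `[a, b]) F t)%E.
Proof.
move=> c0 mF F0; rewrite integral_mkcond [X in (_ * X)%E]integral_mkcond.
have mp : measurable_fun setT (F \_ `[a, b]) by apply/(measurable_restrictT _ _).1.
have p0 t : (0 <= (F \_ `[a, b]) t)%E by rewrite patchE; case: ifP.
rewrite -(ge0_integral_affine a (lt0r_neq0 c0) mp p0) gtr0_norm// muleA -EFinM mulVf ?gt_eqF// mul1e.
apply: eq_integral => t _; rewrite !patchE !mem_setE preimage_itv_affine//.
Qed.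

(** * Reparametrization at constant speed *)

Section Rescale.
Variables (a b c : R) (g w : R -> conf).
Hypothesis ab : a <= b.
Hypothesis c0 : 0 < c.
Let g' t := g (c * t + a).
Let w' t := c *: w (c * t + a).

Lemma abs_continuous_rescale : abs_continuous a b g -> abs_continuous 0 ((b - a) / c) g'.
Proof.
move=> hg e e0; have [d1 d10 h1] := hg _ e0; exists (d1 / c); first by rewrite divr_gt0.
move=> n s t st tr ld; apply: (h1 n (fun k => c * s k + a) (fun k => c * t k + a)).
- move=> k; have [hs1 hs2 hs3] := st k; split.
  + by rewrite lerDr mulr_ge0// ltW.
  + by rewrite lerD2r ler_pM2l.
  + by move: hs3; rewrite ler_pdivlMr// mulrC => hs3; lra.
- apply/trivIsetP => i j _ _ ij; apply/seteqP; split => // r [].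
  move/trivIsetP : tr => /(_ i j I I ij) /seteqP[+ _] => /(_ ((r - a) / c)) H.
  rewrite /= !in_itv/= => /andP[i1 i2] /andP[j1 j2]; apply: H.
  by split => /=; rewrite in_itv/= ltr_pdivlMr// ltr_pdivrMr// ![_ * c]mulrC; apply/andP; split; lra.
- have -> : \sum_(k < n) (c * t k + a - (c * s k + a)) = c * \sum_(k < n) (t k - s k).
    by rewrite mulr_sumr; apply: eq_bigr => k _; ring.
  by rewrite mulrC -ltr_pdivlMr.
Qed.

Lemma velocity_rescale : velocity a b g w -> velocity 0 ((b - a) / c) g' w'.
Proof.
move=> [mw [N0 [mN0 N00 dw]]]; split.
  move=> i k; under eq_fun do rewrite mxE.
  by apply: measurable_funM => //; apply: (measurableT_comp (mw i k)); exact: measurable_funD.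
pose phi (t : R) := c * t + a.
have mphi : measurable_fun setT phi by exact: measurable_funD.
have mN1 : measurable (phi @^-1` N0) by rewrite -[X in measurable X]setTI; exact: mphi.
exists (phi @^-1` N0); split => //.
  have := lebesgue_measure_affine a c0 mN0; rewrite [X in _ = X -> _]N00 => /eqP.
  by rewrite mule_eq0 gt_eqF ?lte_fin//= => /eqP.
move=> t /= Ht; apply: dw => /= H; apply: Ht => /andP[t0 tb].
have {}H : is_derive (phi t) 1 g (w (phi t)).
  apply: H; rewrite /phi ltrDr mulr_gt0//=.
  by move: tb; rewrite ltr_pdivlMr// mulrC => ?; lra.
apply/is_derive_mxP => i k; rewrite mxE.
have H1 := (is_derive_mxP _ _ _).1 H i k.
have H2 : is_derive t 1 phi c.
  have := is_deriveD (is_deriveZ c (is_derive_id t 1)) (is_derive_cst a t 1).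
  by move=> /is_derive_eq; apply; rewrite addr0 /GRing.scale/= mulr1.
have := is_derive1_comp H1 H2.
by move=> /is_derive_eq; apply; rewrite /GRing.scale/= mulrC.
Qed.

Lemma Kin_rescale : velocity a b g w -> Kin 0 ((b - a) / c) w' = (c%:E * Kin a b w)%E.
Proof.
move=> [mw _].
have mk : measurable_fun setT (fun t => 2^-1 * kin (w t)).
  by apply: measurable_funM => //; exact: measurable_kin.
rewrite /Kin.
transitivity (\int[mu]_(t in `[0%R, ((b - a) / c)%R]) ((c ^+ 2)%:E * (2^-1 * kin (w (c * t + a)))%:E))%E.
  apply: eq_integral => t _; rewrite -EFinM; congr EFin.
  rewrite mulrCA; congr (_ * _); rewrite /kin mulr_sumr; apply: eq_bigr => i _.
  rewrite mulrCA; congr (_ * _); rewrite mulr_sumr; apply: eq_bigr => k _.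
  by rewrite mxE exprMn.
rewrite ge0_integralZl_EFin//; first last.
- exact: sqr_ge0.
- apply/measurable_EFinP; apply: measurable_funTS.
  by apply: (measurableT_comp mk); exact: measurable_funD.
- by move=> t _; rewrite lee_fin mulr_ge0// kin_ge0.
rewrite (@integral_itv_affine a b c (fun t => (2^-1 * kin (w t))%:E))//.
- by rewrite muleA -EFinM; congr (_%:E * _)%E; field; rewrite gt_eqF.
- by apply/measurable_EFinP; exact: measurable_funTS.
- by move=> t; rewrite lee_fin mulr_ge0// kin_ge0.
Qed.

Lemma Pot_rescale : abs_continuous a b g -> Pot 0 ((b - a) / c) g' = ((c^-1)%:E * Pot a b g)%E.
Proof.
move=> hg; apply: (@integral_itv_affine a b c (fun t => potential m (g t))) => //.
- exact: measurable_potential_curve.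
- by move=> t; exact: potential_ge0.
Qed.

End Rescale.

Definition Upot (x : conf) : R := \sum_(i < N) \sum_(j < N | (i < j)%N) m i * m j / mutual_dist x i j.

Lemma potential_free (x : conf) : collision_free x -> potential m x = (Upot x)%:E.
Proof. by move=> cf; rewrite /potential mem_set. Qed.

Lemma mutual_dist_gt0 (x : conf) (i j : 'I_N) : collision_free x -> i != j -> 0 < mutual_dist x i j.
Proof. by move=> cf ij; rewrite lt_neqAle eq_sym mutual_dist_eq0 cf ?mutual_dist_ge0. Qed.

Lemma Upot_ge0 (x : conf) : 0 <= Upot x.
Proof.
apply: sumr_ge0 => i _; apply: sumr_ge0 => j _.
by rewrite divr_ge0 ?mutual_dist_ge0// mulr_ge0 ?(ltW (m0 _)).
Qed.

Lemma Upot_pair (x : conf) (i j : 'I_N) : (i < j)%N -> m i * m j / mutual_dist x i j <= Upot x.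
Proof.
have t0 k l : 0 <= m k * m l / mutual_dist x k l.
  by rewrite divr_ge0 ?mutual_dist_ge0// mulr_ge0 ?(ltW (m0 _)).
move=> ij; rewrite /Upot (bigD1 i)//= (bigD1 j)//= -addrA lerDl addr_ge0 ?sumr_ge0// => k _.
by rewrite sumr_ge0.
Qed.

Lemma continuous_sumr (I : Type) (r : seq I) (P : pred I) (F : I -> R -> R) :
  (forall i, P i -> continuous (F i)) -> continuous (fun t => \sum_(i <- r | P i) F i t).
Proof.
move=> cF; elim: r => [|i r IH].
  by under eq_fun do rewrite big_nil; exact: cst_continuous.
under eq_fun do rewrite big_cons; have := cF i.
case: (P i) => [/(_ isT) cFi|_] t; last exact: IH.
by apply: cvgD; [exact: cFi|exact: IH].
Qed.

Lemma continuous_mutual_dist (g : R -> conf) i j : (forall i k, continuous (fun t => g t i k)) ->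
  continuous (fun t => mutual_dist (g t) i j).
Proof.
move=> cg; under eq_fun do rewrite mutual_distE.
have cs : continuous (fun t => \sum_(k < d) (g t i k - g t j k) ^+ 2).
  apply: (@continuous_sumr _ (index_enum 'I_d) xpredT (fun k t => (g t i k - g t j k) ^+ 2)) => k _ u.
  apply: (@continuous_comp _ _ _ (fun t => g t i k - g t j k) (fun r => r ^+ 2)).
    by apply: cvgB; exact: cg.
  exact: exprn_continuous.
by move=> t; apply: continuous_comp; [exact: cs|exact: sqrt_continuous].
Qed.

Lemma continuous_Upot (g : R -> conf) : (forall i k, continuous (fun t => g t i k)) ->
  (forall t, collision_free (g t)) -> continuous (fun t => Upot (g t)).
Proof.
move=> cg fg.
apply: (@continuous_sumr _ (index_enum 'I_N) xpredT (fun i t => \sum_(j < N | (i < j)%N) m i * m j / mutual_dist (g t) i j)) => i _.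
apply: (@continuous_sumr _ (index_enum 'I_N) (fun j => (i < j)%N) (fun j t => m i * m j / mutual_dist (g t) i j)) => j ij t; apply: cvgM; first exact: cvg_cst.
apply: cvgV; last exact: continuous_mutual_dist.
by rewrite gt_eqF// mutual_dist_gt0//; apply: contraTN ij => /eqP ->; rewrite ltnn.
Qed.

Lemma Upot_bounded a b (g : R -> conf) : a <= b -> abs_continuous a b g ->
  (forall t, a <= t <= b -> collision_free (g t)) ->
  exists2 B, 0 < B & forall t, a <= t <= b -> Upot (g t) <= B.
Proof.
move=> ab hg fg.
pose G t := Upot (g (clamp a b t)).
have cG : continuous G.
  apply: (@continuous_Upot (fun t => g (clamp a b t))) => [i k|t]; first exact: coord_clamp_continuous.
  by apply: fg; exact: clamp_itv.
have [c _ H] := EVT_max ab (continuous_subspaceT cG).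
exists (G c + 1); first by rewrite ltr_wpDl// Upot_ge0.
move=> t tab; have /H : t \in `[a, b] by rewrite in_itv.
by case/andP: tab => at' tb; rewrite /G clamp_id// => h'; rewrite (le_trans h')// lerDl.
Qed.

Lemma PotE a b (g : R -> conf) : (forall t, a <= t <= b -> collision_free (g t)) ->
  Pot a b g = (\int[mu]_(t in `[a, b]) (Upot (g t))%:E)%E.
Proof.
by move=> fg; apply: eq_integral => t; rewrite inE/= in_itv/= => tab; rewrite potential_free//; exact: fg.
Qed.

Lemma lebesgue_measure_itvcc a b : a <= b -> mu `[a, b] = (b - a)%:E.
Proof.
rewrite le_eqVlt => /predU1P[->|ab]; first by rewrite set_itv1 lebesgue_measure_set1 subrr.
by rewrite [LHS]lebesgue_measure_itv/= lte_fin ab EFinB.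
Qed.

Lemma Pot_lty a b (g : R -> conf) : a <= b -> abs_continuous a b g ->
  (forall t, a <= t <= b -> collision_free (g t)) -> (Pot a b g < +oo)%E.
Proof.
move=> ab hg fg; have [B B0 HB] := Upot_bounded ab hg fg.
apply: (@le_lt_trans _ _ (\int[mu]_(t in `[a, b]) (cst B%:E) t)%E).
  apply: ge0_le_integral => //.
  - by move=> t _; exact: potential_ge0.
  - exact: measurable_potential_curve.
  - move=> t; rewrite /= in_itv/= => tab; rewrite potential_free; last exact: fg.
    by rewrite lee_fin HB.
by rewrite integral_cst//= [X in (_ * X)%E]lebesgue_measure_itvcc// -EFinM ltry.
Qed.

Lemma ge0_integral_itv_split a c b (F : R -> \bar R) : a <= c -> c <= b ->
  measurable_fun `[a, b] F -> (forall t, (0 <= F t)%E) ->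
  (\int[mu]_(t in `[a, b]) F t = \int[mu]_(t in `[a, c]) F t + \int[mu]_(t in `[c, b]) F t)%E.
Proof.
move=> ac cb mF F0.
rewrite -(@integral_itv_obnd_cbnd _ c (BRight b)); last first.
  by apply: measurable_funS mF => //; apply: subset_itv; rewrite ?bnd_simp.
have E : `[a, b]%classic = `[a, c] `|` `]c, b].
  by rewrite -itv_bndbnd_setU// bnd_simp.
rewrite E ge0_integral_setU//; first by rewrite -E.
by apply/disj_setPRL => t /=; rewrite !in_itv/= => /andP[ct _]; apply/negP; rewrite negb_and -!ltNge ct orbT.
Qed.

Lemma velocityS a b s t (g w : R -> conf) : a <= s -> t <= b -> velocity a b g w -> velocity s t g w.
Proof.
move=> as' tb [mw dw]; split => //; move: dw.
apply: filterS; first exact: (ae_filter_ringOfSetsType mu).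
move=> u H /andP[su ut]; apply: H; lra.
Qed.

Lemma measurable_half_kin d' (T : measurableType d') (D : set T) (f : T -> conf) :
  (forall i k, measurable_fun D (fun t => f t i k)) -> measurable_fun D (fun t => (2^-1 * kin (f t))%:E).
Proof. by move=> mf; apply/measurable_EFinP; apply: measurable_funM => //; exact: measurable_kin. Qed.

Lemma half_kin_ge0 v : (0 <= (2^-1 * kin v)%:E)%E.
Proof. by rewrite lee_fin mulr_ge0// kin_ge0. Qed.

Lemma Kin_split a c b (w : R -> conf) : a <= c -> c <= b -> (forall i k, measurable_fun setT (fun t => w t i k)) ->
  (Kin a b w = Kin a c w + Kin c b w)%E.
Proof.
move=> ac cb mw; apply: ge0_integral_itv_split => //.
  by apply: measurable_funTS; exact: measurable_half_kin.
by move=> t; exact: half_kin_ge0.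
Qed.

Lemma Kin_cst a b v : a <= b -> Kin a b (fun=> v) = (2^-1 * kin v * (b - a))%:E.
Proof. by move=> ab; rewrite /Kin integral_cst//= [X in (_ * X)%E]lebesgue_measure_itvcc. Qed.

Lemma Pot_split a c b (g : R -> conf) : a <= c -> c <= b -> abs_continuous a b g ->
  (Pot a b g = Pot a c g + Pot c b g)%E.
Proof.
move=> ac cb hg; apply: ge0_integral_itv_split => //.
  by apply: measurable_potential_curve => //; exact: le_trans cb.
by move=> t; exact: potential_ge0.
Qed.

(** * A priori estimates for a minimizer *)

Section Minimizer.
Variable x : R -> conf.
Hypothesis hx : free_time_minimizer m h x.

Let xac a b : 0 <= a -> a < b -> abs_continuous a b x.
Proof. by case: hx => _ + _; exact. Qed.

(* The competitor [g] on [[a, b]] is run at speed [c]. *)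
Lemma minimizer_le a b c (v g w : R -> conf) : 0 <= a -> a < b -> 0 < c -> velocity a b x v ->
  abs_continuous a b g -> velocity a b g w -> g a = x a -> g b = x b ->
  (Kin a b v + Pot a b x + (h * (b - a))%:E <=
   c%:E * Kin a b w + (c^-1)%:E * Pot a b g + (h * ((b - a) / c))%:E)%E.
Proof.
move=> a0 ab c0 vx hg wg ga gb.
have ab' := ltW ab.
have T0 : 0 < (b - a) / c by rewrite divr_gt0// subr_gt0.
rewrite -(actionE ab' (xac a0 ab) vx).
have [_ _ ->] := hx => //.
rewrite -(Kin_rescale c0 wg) -(Pot_rescale ab' c0 hg).
have := actionE (ltW T0) (abs_continuous_rescale c0 hg) (velocity_rescale c0 wg).
rewrite subr0 => <-.
apply: ereal_inf_lbound; exists ((b - a) / c); eexists; split; last by [].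
- exact: T0.
- exact: abs_continuous_rescale.
- by rewrite /= mulr0 add0r.
- by rewrite /= mulrC divfK ?gt_eqF// subrK.
Qed.

Let xfree t : 0 <= t -> collision_free (x t).
Proof. by case: hx => + _ _; exact. Qed.

Let xfreeS a b t : 0 <= a -> a <= t <= b -> collision_free (x t).
Proof. by move=> a0 /andP[at' _]; apply: xfree; exact: le_trans at'. Qed.

Lemma minimizer_Pot_fin a b : 0 <= a -> a < b -> Pot a b x \is a fin_num.
Proof.
move=> a0 ab; rewrite ge0_fin_numE ?Pot_ge0//; apply: Pot_lty; [exact: ltW|exact: xac|].
by move=> t; exact: xfreeS.
Qed.

(** A bound [B] on [Upot] bounds each of its terms, and [M] dominates all the inverses
    [(m i * m j)^-1]. *)
Lemma minimizer_dist_ge a b : 0 <= a -> a < b -> exists2 c, 0 < c &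
  forall t (i j : 'I_N), a <= t <= b -> i != j -> c <= mutual_dist (x t) i j.
Proof.
move=> a0 ab.
have [B B0 HB] := Upot_bounded (ltW ab) (xac a0 ab) (fun t => @xfreeS a b t a0).
pose M := \sum_(i < N) \sum_(j < N) (m i * m j)^-1 + 1.
have M1 (i j : 'I_N) : (m i * m j)^-1 <= M.
  have p0 k l : 0 <= (m k * m l)^-1 by rewrite invr_ge0 mulr_ge0 ?(ltW (m0 _)).
  rewrite /M (bigD1 i)//= (bigD1 j)//= -!addrA lerDl !addr_ge0 ?sumr_ge0// => k _.
  by rewrite sumr_ge0.
have M0 : 0 < M by rewrite ltr_wpDl// sumr_ge0// => i _; rewrite sumr_ge0// => j _; rewrite invr_ge0 mulr_ge0 ?(ltW (m0 _)).
exists (M * B)^-1; first by rewrite invr_gt0 mulr_gt0.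
move=> t i j tab ij; have xf := xfreeS a0 tab.
wlog ltij : i j ij / (i < j)%N.
  move=> H; have [ltij|ltji|/val_inj e] := ltngtP i j; [exact: H| |by rewrite e eqxx in ij].
  have := H j i; rewrite eq_sym => /(_ ij ltji).
  by rewrite !mutual_distE; under eq_bigr do rewrite -opprB sqrrN.
have r0 := mutual_dist_gt0 xf ij.
have := le_trans (Upot_pair (x t) ltij) (HB _ tab).
rewrite ler_pdivrMr// => H.
have := M1 i j; rewrite -div1r ler_pdivrMr ?mulr_gt0// => H1.
rewrite -div1r ler_pdivrMr ?mulr_gt0//.
apply: (le_trans H1); apply: (le_trans (ler_wpM2l (ltW M0) H)).
by rewrite le_eqVlt; apply/orP; left; apply/eqP; ring.
Qed.

(* A straight segment joining close configurations of the curve avoids collisions, hence has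
   finite action. *)
Lemma minimizer_Kin_lty_local a b : 0 <= a -> a < b -> exists2 delta, 0 < delta &
  forall s t (v : R -> conf), a <= s -> s < t -> t <= b -> t - s < delta -> velocity s t x v -> (Kin s t v < +oo)%E.
Proof.
move=> a0 ab.
have [c c0 rc] := minimizer_dist_ge a0 ab.
(* Two displacements below [e] in the sup norm change each relative coordinate by less than
   [2 * e = c / (d + 1)], and a vector with [d] coordinates of at most that size has Euclidean norm
   below [c]. *)
pose e := c / (2 * (d%:R + 1)).
have d1 : 0 < 2 * (d%:R + 1) :> R by rewrite mulr_gt0// ltr_wpDl.
have e0 : 0 < e by rewrite divr_gt0.
have [delta d0 H] := abs_continuous_seq (xac a0 ab) e0.
exists delta => // s t v as' st tb sd vx.
have s0 : 0 <= s by exact: le_trans as'.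
have st' := ltW st.
have ts0 : 0 < t - s by rewrite subr_gt0.
have close : `|x t - x s| < e.
  have := H [:: (s, t)]; rewrite !big_seq1/=; apply => //.
  by rewrite /inside/= as' st' tb.
pose D := x t - x s.
pose g u := x s + ((u - s) / (t - s)) *: D.
pose w (u : R) := (t - s)^-1 *: D.
have gac : abs_continuous s t g.
  apply: (@lipschitz_abs_continuous _ _ _ _ (`|D| / (t - s))) => u1 u2 _ u12 _.
  rewrite /g opprD addrACA subrr add0r -scalerBl -mulrBl normrZ normrM.
  rewrite [`|(t - s)^-1|]gtr0_norm ?invr_gt0// ger0_norm; last by lra.
  by rewrite le_eqVlt; apply/orP; left; apply/eqP; ring.
have gw : velocity s t g w.
  split; first by move=> i k; exact: measurable_cst.
  apply: aeW => u _; apply/is_derive_mxP => i k; rewrite mxE.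
  rewrite (_ : (fun u => _) = fun u => (t - s)^-1 * D i k * u + (x s i k - s * ((t - s)^-1 * D i k))); last first.
    by apply/funext => r; rewrite !mxE; ring.
  have := is_deriveD (is_deriveZ ((t - s)^-1 * D i k) (is_derive_id u 1)) (is_derive_cst (x s i k - s * ((t - s)^-1 * D i k)) u 1).
  by move=> /is_derive_eq; apply; rewrite addr0 /GRing.scale/= mulr1.
have gfree u : s <= u <= t -> collision_free (g u).
  (* At a collision on the segment, each coordinate of [x s i - x s j] would be [th], a number in
     [[0, 1]], times a difference of displacements, hence too small. *)
  move=> /andP[su ut] i j ij; apply/eqP => gij.
  have := rc s i j; rewrite as' (le_trans st' tb) => /(_ isT ij); apply/negP; rewrite -ltNge.
  pose q := x s; pose th := (u - s) / (t - s).
  have th0 : 0 <= th by rewrite /th divr_ge0 ?(ltW ts0)// subr_ge0.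
  have th1 : th <= 1 by rewrite ler_pdivrMr// mul1r; lra.
  have qk k : `|x s i k - x s j k| <= 2 * e.
    have := congr1 (fun r : 'rV_d => r 0 k) gij; rewrite !mxE.
    have h1 := le_lt_trans (coord_le_norm D i k) close.
    have h2 := le_lt_trans (coord_le_norm D j k) close.
    move: h1 h2; rewrite !mxE -/th; set Di := x t i k + _; set Dj := x t j k + _.
    rewrite !ltr_norml => /andP[h1 h2] /andP[h3 h4] E.
    have -> : x s i k - x s j k = th * (Dj - Di) by lra.
    rewrite normrM ger0_norm//.
    apply: (@le_trans _ _ (1 * `|Dj - Di|)); first by rewrite ler_wpM2r.
    by rewrite mul1r ler_norml; apply/andP; split; lra.
  rewrite mutual_distE -[ltRHS]ger0_norm ?(ltW c0)// -sqrtr_sqr ltr_sqrt ?exprn_gt0//.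
  apply: (@le_lt_trans _ _ (\sum_(k < d) (2 * e) ^+ 2)).
    apply: ler_sum => k _; rewrite -[leLHS]real_normK ?num_real//.
    by rewrite ler_sqr ?nnegrE// mulr_ge0// ltW.
  rewrite sumr_const card_ord -[ltLHS]mulr_natl.
  have -> : 2 * e = c / (d%:R + 1) by rewrite /e; field; rewrite gt_eqF// ltr_wpDl.
  rewrite expr_div_n mulrCA gtr_pMr ?exprn_gt0// ltr_pdivrMr ?exprn_gt0 ?ltr_wpDl//.
  have : 0 <= d%:R :> R by []. nra.
have := minimizer_le s0 st ltr01 vx gac gw.
rewrite /g subrr mul0r scale0r addr0 divff ?gt_eqF// scale1r subrKC => /(_ erefl erefl).
move=> H1; apply: (@le_lt_trans _ _ (Kin s t v + Pot s t x + (h * (t - s))%:E)%E).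
  by rewrite -addeA leeDl// adde_ge0 ?Pot_ge0// lee_fin mulr_ge0// ltW.
apply: (le_lt_trans H1).
rewrite -/g invr1 !mul1e lte_add_pinfty ?ltry// lte_add_pinfty//.
  by rewrite Kin_cst// ltry.
exact: Pot_lty.
Qed.

(** Finitely many pieces are short enough for the local statement. *)
Lemma minimizer_Kin_lty a b (v : R -> conf) : 0 <= a -> a < b -> velocity a b x v -> (Kin a b v < +oo)%E.
Proof.
move=> a0 ab vx.
have [delta d0 H] := minimizer_Kin_lty_local a0 ab.
pose n := Num.truncn ((b - a) / delta).
pose eta := (b - a) / n.+1%:R.
have n0 : 0 < n.+1%:R :> R by rewrite ltr0n.
have eta0 : 0 < eta by rewrite divr_gt0// subr_gt0.
have etad : eta < delta.
  by rewrite /eta ltr_pdivrMr// mulrC -ltr_pdivrMr// truncnS_gt.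
have nE : n.+1%:R * eta = b - a by rewrite /eta mulrC mulfVK// gt_eqF.
have key i : (i <= n.+1)%N -> (Kin a (a + i%:R * eta) v < +oo)%E.
  elim: i => [|i IH] ile.
    by rewrite mul0r addr0 /Kin set_itv1 integral_set1.
  have ie : i.+1%:R * eta <= b - a by rewrite -nE ler_wpM2r ?ler_nat// ltW.
  have i0 : 0 <= i%:R * eta by rewrite mulr_ge0// ltW.
  move: ie; rewrite -natr1 mulrDl mul1r => ie.
  rewrite (@Kin_split _ (a + i%:R * eta)); [|lra|lra|by case: vx].
  apply: lte_add_pinfty; first by apply: IH; exact: ltnW.
  apply: H; [lra|lra|lra|lra|].
  by apply: velocityS vx; lra.
have := key n.+1 (leqnn _); rewrite nE (_ : a + (b - a) = b)//; by ring.
Qed.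

(** With [H = h * (b - a)], half speed gives [K + P + H <= K / 2 + 2 * P + 2 * H]; solving for [K]
    uses that it is finite. *)
Lemma minimizer_Kin_le a b (v : R -> conf) : 0 <= a -> a < b -> velocity a b x v ->
  (Kin a b v <= 2%:E * (Pot a b x + (h * (b - a))%:E))%E.
Proof.
move=> a0 ab vx.
have Kf : Kin a b v \is a fin_num by rewrite ge0_fin_numE ?Kin_ge0// minimizer_Kin_lty.
have Pf := minimizer_Pot_fin a0 ab.
have h20 : 0 < 2^-1 :> R by [].
have := minimizer_le a0 ab h20 vx (xac a0 ab) vx erefl erefl.
rewrite invrK -(fineK Kf) -(fineK Pf) -!(EFinM, EFinD) !lee_fin; lra.
Qed.

(* Slowing down gives [Kin <= 2 (Pot + h (b - a))], and displacements are bounded by [|v| <= 1 + v ^ 2]. *)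
Lemma minimizer_displacement a b s t i k : 0 <= a -> a < b -> a <= s -> s <= t -> t <= b ->
  `|x t i k - x s i k| <= (b - a) + 4 / m i * (fine (Pot a b x) + h * (b - a)).
Proof.
move=> a0 ab as' st tb.
have [v [vx vi vftc]] := curve_velocity ab (xac a0 ab).
have KP := minimizer_Kin_le a0 ab vx.
have Pf := minimizer_Pot_fin a0 ab.
have mv := vx.1.
have iv : mu.-integrable `[s, t] (fun u => (v u i k)%:E) by apply: integrableS (vi i k).
rewrite -vftc// -lee_fin.
have vfin : (\int[mu]_(u in `[s, t]) (v u i k)%:E)%E \is a fin_num by exact: integrable_fin_num.
rewrite /Rintegral -fine_abse// fineK ?abse_fin_num//.
apply: (le_trans (le_abse_integral _ _ _)) => //; first by case/integrableP: iv.
have mab : measurable_fun `[a, b] (fun u => `|(v u i k)%:E|%E).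
  by apply/measurable_EFinP; apply: measurableT_comp => //; exact: measurable_funTS.
apply: (@le_trans _ _ (\int[mu]_(u in `[a, b]) ((cst 1%:E) u + (2 / m i)%:E * (2^-1 * kin (v u))%:E))%E).
  apply: (@le_trans _ _ (\int[mu]_(u in `[a, b]) `|(v u i k)%:E|)%E).
    by apply: ge0_subset_integral => //; apply: subset_itv; rewrite bnd_simp.
  apply: ge0_le_integral => //.
  - apply: emeasurable_funD; first exact: measurable_cst.
    by apply: measurable_funeM; apply: measurable_funTS; exact: measurable_half_kin.
  move=> u _; rewrite /= -EFinM -EFinD lee_fin.
  apply: (@le_trans _ _ (1 + v u i k ^+ 2)).
    by rewrite -[v u i k ^+ 2]real_normK ?num_real//; have := normr_ge0 (v u i k); nra.
  rewrite lerD2l.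
  have -> : 2 / m i * (2^-1 * kin (v u)) = kin (v u) / m i by field; rewrite gt_eqF.
  rewrite ler_pdivlMr// mulrC /kin (bigD1 i)//= -[leLHS]addr0 lerD//.
    rewrite ler_pM2l// (bigD1 k)//= lerDl sumr_ge0// => l _; exact: sqr_ge0.
  by apply: sumr_ge0 => l _; rewrite mulr_ge0 ?(ltW (m0 _))// sumr_ge0// => p _; exact: sqr_ge0.
rewrite ge0_integralD//; first last.
- by apply: measurable_funeM; apply: measurable_funTS; exact: measurable_half_kin.
- by move=> u _; rewrite mule_ge0 ?half_kin_ge0// lee_fin divr_ge0// ltW.
rewrite integral_cst//= mul1e [X in (X + _)%E]lebesgue_measure_itvcc ?(ltW ab)//.
rewrite ge0_integralZl_EFin//; first last.
- by rewrite divr_ge0// ltW.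
- by apply: measurable_funTS; exact: measurable_half_kin.
- by move=> u _; exact: half_kin_ge0.
rewrite [leRHS]EFinD; apply: leeD => //.
apply: (@le_trans _ _ ((2 / m i)%:E * (2%:E * (Pot a b x + (h * (b - a))%:E)))%E).
  by apply: lee_wpmul2l => //; rewrite lee_fin divr_ge0// ltW.
rewrite -(fineK Pf) -!(EFinM, EFinD) /= lee_fin le_eqVlt; apply/orP; left; apply/eqP; field.
by rewrite gt_eqF.
Qed.

End Minimizer.

End Action.

(** * Two opposite variations of a minimizer *)

Section Variation.
Context {R : realType} {N d : nat} (m : 'I_N -> R) (h : R).
Hypothesis m0 : forall i, 0 < m i.
Hypothesis h0 : 0 <= h.
Local Notation mu := (@lebesgue_measure R).
Local Notation conf := 'M[R]_(N, d).

Lemma abs_continuousZr (a b : R) (rho : R -> R) (V : conf) : abs_continuous a b rho ->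
  abs_continuous a b (fun t => rho t *: V).
Proof.
move=> hr e e0.
have V0 : 0 < `|V| + 1 by rewrite ltr_wpDl.
have [d1 d10 h1] := hr _ (divr_gt0 e0 V0); exists d1 => // n s t st tr ld.
have {h1} := h1 n s t st tr ld; rewrite ltr_pdivlMr//; apply: le_lt_trans.
rewrite mulr_suml; apply: ler_sum => k _.
by rewrite -scalerBl normrZ ler_wpM2l// lerDl.
Qed.

Lemma velocity_variation (a b : R) (g w : R -> conf) (rho sigma : R -> R) (V : conf) :
  velocity a b g w -> measurable_fun setT sigma ->
  {ae mu, forall t, a < t < b -> is_derive t 1 rho (sigma t)} ->
  velocity a b (fun t => g t + rho t *: V) (fun t => w t + sigma t *: V).
Proof.
move=> [mw dw] ms dr; split.
  move=> i k; under eq_fun do rewrite !mxE.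
  by apply: measurable_funD => //; exact: measurable_funM.
move: dw dr; apply: filterS2; first exact: (ae_filter_ringOfSetsType mu).
move=> t dw dr tab; have {}dw := dw tab; have {}dr := dr tab.
apply/is_derive_mxP => i k; rewrite !mxE.
rewrite (_ : (fun s => _) = (fun s => g s i k) + V i k \*: rho); last first.
  by apply/funext => s; rewrite !mxE [RHS]/= fctE/= /GRing.scale/= mulrC.
have H := (is_derive_mxP _ _ _).1 dw i k.
have := is_deriveD H (is_deriveZ (V i k) dr).
by move=> /is_derive_eq; apply; rewrite /GRing.scale/= [V i k * _]mulrC.
Qed.

Lemma kin_parallelogram (v V : conf) (s : R) :
  kin m (v + s *: V) + kin m (v + (- s) *: V) = 2 * kin m v + 2 * (s ^+ 2 * kin m V).
Proof.
rewrite /kin -big_split/= !mulr_sumr -big_split/=; apply: eq_bigr => i _.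
rewrite -mulrDr -big_split/= !mulr_sumr -big_split/=; apply: eq_bigr => k _.
by rewrite !mxE; ring.
Qed.

Variable x : R -> conf.
Hypothesis hx : free_time_minimizer m h x.

Let xac a b : 0 <= a -> a < b -> abs_continuous a b x.
Proof. by case: hx => _ + _; exact. Qed.

(* The terms linear in [V] cancel between the two opposite variations. *)
Lemma minimizer_variation (a b S : R) (rho sigma : R -> R) (V : conf) : 0 <= a -> a < b ->
  abs_continuous a b rho -> measurable_fun setT sigma ->
  {ae mu, forall t, a < t < b -> is_derive t 1 rho (sigma t)} ->
  rho a = 0 -> rho b = 0 -> (\int[mu]_(t in `[a, b]) (sigma t ^+ 2)%:E <= S%:E)%E ->
  (2%:E * Pot m a b x <= (S * kin m V)%:E + Pot m a b (fun t => x t + rho t *: V)%R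
      + Pot m a b (fun t => x t + (- rho t) *: V)%R)%E.
Proof.
move=> a0 ab hr ms dr ra rb hS.
have [v [vx _ _]] := curve_velocity ab (xac a0 ab).
have Kf : Kin m a b v \is a fin_num.
  by rewrite ge0_fin_numE ?Kin_ge0//; apply: (minimizer_Kin_lty m0 h0 hx).
have Pf := minimizer_Pot_fin m0 hx a0 ab.
have hr' : abs_continuous a b (fun t => - rho t).
  move=> e e0; have [d1 d10 h1] := hr _ e0; exists d1 => // n s t st tr ld.
  by under eq_bigr do rewrite -opprD normrN; exact: h1.
have dr' : {ae mu, forall t, a < t < b -> is_derive t 1 (fun t => - rho t) (- sigma t)}.
  move: dr; apply: filterS; first exact: (ae_filter_ringOfSetsType mu).
  by move=> t H /H {}H; exact: is_deriveN.
have ms' : measurable_fun setT (fun t => - sigma t) by exact: measurableT_comp.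
have H1 := minimizer_le m0 hx a0 ab ltr01 vx (abs_continuousD (xac a0 ab) (abs_continuousZr V hr))
  (velocity_variation V vx ms dr).
have H2 := minimizer_le m0 hx a0 ab ltr01 vx (abs_continuousD (xac a0 ab) (abs_continuousZr V hr'))
  (velocity_variation V vx ms' dr').
have e0 r c : r = 0 -> x c + r *: V = x c by move=> ->; rewrite scale0r addr0.
have en r c : r = 0 -> x c + (- r) *: V = x c by move=> ->; rewrite oppr0 scale0r addr0.
move: (H1 (e0 _ _ ra) (e0 _ _ rb)) (H2 (en _ _ ra) (en _ _ rb)) => {}H1 {}H2.
have E1 (A B : \bar R) (r : R) : (1%:E * A + (1^-1)%:E * B + (h * (r / 1))%:E = A + B + (h * r)%:E)%E.
  by rewrite invr1 mulr1 !mul1e.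
rewrite E1 in H1; rewrite E1 in H2.
have KE : (Kin m a b (fun t => v t + sigma t *: V)%R + Kin m a b (fun t => v t + (- sigma t) *: V)%R
   <= 2%:E * Kin m a b v + (S * kin m V)%:E)%E.
  have mv1 : forall i k, measurable_fun setT (fun t => v t i k) by case: vx.
  have mvs : measurable_fun `[a, b] (fun t => (2^-1 * kin m (v t + sigma t *: V))%:E).
    by apply: measurable_funTS; apply: measurable_half_kin; case: (velocity_variation V vx ms dr).
  have mvs' : measurable_fun `[a, b] (fun t => (2^-1 * kin m (v t + (- sigma t) *: V))%:E).
    by apply: measurable_funTS; apply: measurable_half_kin; case: (velocity_variation V vx ms' dr').
  have mvv : measurable_fun `[a, b] (fun t => (2^-1 * kin m (v t))%:E).
    by apply: measurable_funTS; apply: measurable_half_kin.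
  have msq : measurable_fun `[a, b] (fun t => (sigma t ^+ 2)%:E).
    by apply/measurable_EFinP; apply: measurable_funTS; exact: measurable_funX.
  rewrite /Kin -ge0_integralD//; [|by move=> *; exact: half_kin_ge0|by move=> *; exact: half_kin_ge0].
  apply: (@le_trans _ _ (\int[mu]_(t in `[a, b]) (2%:E * (2^-1 * kin m (v t))%:E + (kin m V)%:E * (sigma t ^+ 2)%:E))%E).
    rewrite le_eqVlt; apply/orP; left; apply/eqP; apply: eq_integral => t _.
    rewrite -!EFinM -!EFinD; congr EFin.
    by rewrite -mulrDr kin_parallelogram; field.
  rewrite ge0_integralD//; first last.
  - exact: measurable_funeM.
  - by move=> t _; rewrite -EFinM lee_fin mulr_ge0 ?kin_ge0// sqr_ge0.
  - exact: measurable_funeM.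
  - by move=> t _; rewrite mule_ge0 ?half_kin_ge0.
  rewrite ge0_integralZl_EFin//; last by move=> *; exact: half_kin_ge0.
  rewrite ge0_integralZl_EFin ?kin_ge0//; last by move=> t _; rewrite lee_fin sqr_ge0.
  apply: leeD => //; rewrite mulrC EFinM; apply: lee_wpmul2l => //; by rewrite lee_fin kin_ge0.
have Kp := Kin_ge0 m0 a b (fun t => v t + sigma t *: V).
have Kn := Kin_ge0 m0 a b (fun t => v t + (- sigma t) *: V).
have Pp := Pot_ge0 m0 a b (fun t => x t + rho t *: V).
have Pn := Pot_ge0 m0 a b (fun t => x t + (- rho t) *: V).
move: H1 H2 KE Kp Kn Pp Pn.
(* The finite kinetic term of the minimizer is cancelled; when a varied potential is infinite the
   claim is trivial. *)
rewrite -(fineK Kf) -(fineK Pf).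
case: (Kin m a b (fun t => v t + sigma t *: V)) => [k1| |] //;
case: (Kin m a b (fun t => v t + (- sigma t) *: V)) => [k2| |] //;
case: (Pot m a b (fun t => x t + rho t *: V)) => [p1| |] //;
case: (Pot m a b (fun t => x t + (- rho t) *: V)) => [p2| |] //;
by rewrite -?EFinM -?EFinD ?lee_fin ?leey// => H1 H2 H3 _ _ _ _; lra.
Qed.

End Variation.

(** * Cauchy averages of the varied potential *)

Section PlaneMeasure.
Context {R : realType}.
Local Notation mu := (@lebesgue_measure R).

Lemma sigma_finite_lebesgue2 : sigma_finite setT (mu \x mu)%E.
Proof.
exists (fun k => `[- k%:R, k%:R] `*` `[- k%:R, k%:R]) => [|k].
  apply/esym/seteqP; split => // -[u v] _.
  exists (Num.truncn (`|u| + `|v|)).+1 => //.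
  have := truncnS_gt (`|u| + `|v|) => H.
  have u0 := normr_ge0 u; have v0 := normr_ge0 v.
  by split; rewrite /= in_itv/= -ler_norml; lra.
split; first exact: measurableX.
have kE : mu `[- k%:R, k%:R] = (k%:R - - k%:R)%:E by apply: lebesgue_measure_itvcc; have := ler0n R k; lra.
by rewrite [ltLHS]product_measure1E// [X in (X * _)%E]kE [X in (_ * X)%E]kE -EFinM ltry.
Qed.

(** A name for the product measure, to carry the sigma-finiteness that Tonelli's theorem between the
    line and the plane requires. *)
Definition lebesgue2 := (mu \x mu)%E.
HB.instance Definition _ := Measure.on lebesgue2.
HB.instance Definition _ := Measure_isSigmaFinite.Build _ _ _ lebesgue2 sigma_finite_lebesgue2.

Lemma fubini_tonelli_line_plane (f : R * (R * R) -> \bar R) : measurable_fun setT f -> (forall p, (0 <= f p)%E) ->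
  (\int[mu]_t \int[(mu \x mu)%E]_y f (t, y) = \int[(mu \x mu)%E]_y \int[mu]_t f (t, y))%E.
Proof.
move=> mf f0; pose m2 : SigmaFiniteMeasure.type _ _ := lebesgue2.
exact: (@fubini_tonelli _ _ _ _ _ mu m2 f mf f0).
Qed.

Lemma measurable_integral_plane (f : R * (R * R) -> \bar R) : measurable_fun setT f -> (forall p, (0 <= f p)%E) ->
  measurable_fun setT (fun t => \int[(mu \x mu)%E]_y f (t, y))%E.
Proof.
move=> mf f0; pose m2 : SigmaFiniteMeasure.type _ _ := lebesgue2.
exact: (@measurable_fun_fubini_tonelli_F _ _ _ _ _ m2 f mf f0).
Qed.

End PlaneMeasure.

(** * Averaging over the directions of a plane *)

Section Smoothing.
Context {R : realType} {N n : nat} (m : 'I_N -> R).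
Hypothesis m0 : forall i, 0 < m i.
Local Notation mu := (@lebesgue_measure R).
Local Notation mu2 := (mu \x mu)%E.
Local Notation conf := 'M[R]_(N, n.+2).

(* The factors are distinct integers, so any two bodies separate at least at the rate [|y|]. *)
Definition spread (y : R * R) : conf := \matrix_(i < N, k < n.+2) (i%:R * nth 0 [:: y.1; y.2] k).

Lemma measurable_spread d (T : measurableType d) (D : set T) (f : T -> R * R) i k : measurable_fun D f ->
  measurable_fun D (fun t => spread (f t) i k).
Proof.
move=> mf; under eq_fun do rewrite mxE; apply: measurable_funM => //.
case: (k : nat) => [|[|l]] /=.
- exact: measurableT_comp.
- exact: measurableT_comp.
- by rewrite nth_nil; exact: measurable_cst.
Qed.

Lemma kin_spread y : kin m (spread y) = (y.1 ^+ 2 + y.2 ^+ 2) * \sum_(i < N) m i * i%:R ^+ 2.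
Proof.
rewrite /kin mulr_sumr; apply: eq_bigr => i _.
rewrite !big_ord_recl big1 ?addr0 => [|k _]; last by rewrite mxE/= nth_nil mulr0 expr0n.
by rewrite !mxE /=; ring.
Qed.

Lemma mutual_dist_spread (x : conf) (r : R) y i j :
  mutual_dist (x + r *: spread y) i j =
  Num.sqrt ((x i ord0 - x j ord0 + r * (i%:R - j%:R) * y.1) ^+ 2
    + (x i (lift ord0 ord0) - x j (lift ord0 ord0) + r * (i%:R - j%:R) * y.2) ^+ 2
    + \sum_(k < n) (x i (lift ord0 (lift ord0 k)) - x j (lift ord0 (lift ord0 k))) ^+ 2).
Proof.
rewrite mutual_distE !big_ord_recl addrA; congr Num.sqrt; congr (_ + _ + _).
- by rewrite !mxE/=; congr (_ ^+ 2); ring.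
- by rewrite !mxE/=; congr (_ ^+ 2); ring.
- by apply: eq_bigr => k _; rewrite !mxE/= nth_nil !mulr0 !addr0.
Qed.

(** The Plummer potential with softening length [r]. *)
Definition softened (x : conf) (r : R) : R :=
  \sum_(i < N) \sum_(j < N | (i < j)%N) m i * m j / Num.sqrt (mutual_dist x i j ^+ 2 + r ^+ 2).

Lemma softened_ge0 x r : 0 <= softened x r.
Proof.
apply: sumr_ge0 => i _; apply: sumr_ge0 => j _.
by rewrite divr_ge0 ?sqrtr_ge0// mulr_ge0 ?(ltW (m0 _)).
Qed.

Lemma measurable_softened d (T : measurableType d) (f : T -> conf) (g : T -> R) :
  (forall i k, measurable_fun setT (fun t => f t i k)) -> measurable_fun setT g ->
  measurable_fun setT (fun t => softened (f t) (g t)).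
Proof.
move=> mf mg; apply: measurable_sum => i.
under eq_fun do rewrite big_mkcond/=.
apply: measurable_sum => j; case: (i < j)%N => //.
apply: measurable_funM => //; apply: measurable_funV; apply: measurable_fun_sqrt.
apply: measurable_funD; apply: measurable_funX => //; exact: measurable_mutual_dist.
Qed.

Lemma mutual_dist_sqr (x : conf) i j : mutual_dist x i j ^+ 2 =
  (x i ord0 - x j ord0) ^+ 2 + (x i (lift ord0 ord0) - x j (lift ord0 ord0)) ^+ 2
  + \sum_(k < n) (x i (lift ord0 (lift ord0 k)) - x j (lift ord0 (lift ord0 k))) ^+ 2.
Proof.
rewrite mutual_distE sqr_sqrtr; last by apply: sumr_ge0 => k _; exact: sqr_ge0.
by rewrite !big_ord_recl addrA.
Qed.

Lemma pair_smoothing (x : conf) (r : R) (i j : 'I_N) : (i < j)%N -> row i x != row j x ->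
  (\int[mu2]_y ((cauchy2 y)%:E * einv (mutual_dist (x + r *: spread y) i j))
   <= (2 * pi / Num.sqrt (mutual_dist x i j ^+ 2 + r ^+ 2))%:E)%E.
Proof.
move=> ij xij; have d0 : 0 < mutual_dist x i j by rewrite lt_neqAle eq_sym mutual_dist_eq0 xij mutual_dist_ge0.
(* For [r = 0] nothing is varied and both sides agree; [cauchy2_smoothing] needs a nonzero scale. *)
have [->|r0] := eqVneq r 0.
  rewrite expr0n addr0 sqrtr_sqr ger0_norm ?(ltW d0)//.
  under eq_integral do rewrite scale0r addr0 /einv (gt_eqF d0) muleC.
  rewrite ge0_integralZl_EFin//.
  - by rewrite integral_cauchy2 -EFinM mulrC.
  - by move=> y _; rewrite lee_fin cauchy2_ge0.
  - by apply/measurable_EFinP; exact: measurable_cauchy2T.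
  - by rewrite invr_ge0 ltW.
under eq_integral do rewrite mutual_dist_spread.
(* Distinct integers differ by at least 1, so the softening length of each pair is at least
   [|r|]. *)
have ij1 : 1 <= (i%:R - j%:R) ^+ 2 :> R.
  have : i%:R + 1 <= j%:R :> R by rewrite natr1 ler_nat.
  by move=> H; nra.
have s0 : r * (i%:R - j%:R) != 0.
  by rewrite mulf_neq0// -sqrf_eq0 gt_eqF// (lt_le_trans ltr01).
have Z0 : 0 <= \sum_(k < n) (x i (lift ord0 (lift ord0 k)) - x j (lift ord0 (lift ord0 k))) ^+ 2.
  by apply: sumr_ge0 => k _; exact: sqr_ge0.
apply: (le_trans (cauchy2_smoothing _ _ Z0 s0)).
rewrite -mutual_dist_sqr lee_fin ler_wpM2l ?mulr_ge0 ?pi_ge0//.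
have p0 : 0 < mutual_dist x i j ^+ 2 + r ^+ 2 by rewrite ltr_wpDr ?sqr_ge0// exprn_gt0.
have p1 : mutual_dist x i j ^+ 2 + r ^+ 2 <= mutual_dist x i j ^+ 2 + (r * (i%:R - j%:R)) ^+ 2.
  by rewrite lerD2l exprMn ler_peMr ?sqr_ge0.
have p2 := lt_le_trans p0 p1.
by rewrite lef_pV2 ?posrE ?sqrtr_gt0// ler_sqrt// ltW.
Qed.

Lemma measurable_cauchy2_potential d (T : measurableType d) (f : T -> conf) (g : T -> R * R) :
  (forall i k, measurable_fun setT (fun t => f t i k)) -> measurable_fun setT g ->
  measurable_fun setT (fun t => (cauchy2 (g t))%:E * potential m (f t))%E.
Proof.
move=> mf mg; apply: emeasurable_funM; last exact: measurable_potential.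
by apply/measurable_EFinP; exact: measurable_cauchy2.
Qed.

Lemma measurable_shift (x : conf) r i k : measurable_fun setT (fun y => (x + r *: spread y) i k).
Proof.
under eq_fun do rewrite mxE [X in _ + X]mxE.
by apply: measurable_funD => //; apply: measurable_funM => //; exact: measurable_spread.
Qed.

Lemma potential_smoothing (x : conf) (r : R) : collision_free x ->
  (\int[mu2]_y ((cauchy2 y)%:E * potential m (x + r *: spread y)) <= (2 * pi * softened x r)%:E)%E.
Proof.
move=> xf.
have c0 y : (0 <= (@cauchy2 R y)%:E)%E by rewrite lee_fin cauchy2_ge0.
have mm (i j : 'I_N) : 0 <= m i * m j by rewrite mulr_ge0 ?(ltW (m0 _)).
have t0 (i j : 'I_N) y : (0 <= (m i * m j)%:E * ((cauchy2 y)%:E * einv (mutual_dist (x + r *: spread y) i j)))%E.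
  by rewrite !mule_ge0 ?einv_ge0 ?mutual_dist_ge0// lee_fin.
have mt0 (i j : 'I_N) : measurable_fun setT (fun y => ((cauchy2 y)%:E * einv (mutual_dist (x + r *: spread y) i j))%E).
  apply: emeasurable_funM; first by apply/measurable_EFinP; exact: measurable_cauchy2T.
  by apply: measurable_einv; apply: measurable_mutual_dist => *; exact: measurable_shift.
have mt (i j : 'I_N) : measurable_fun setT (fun y => ((m i * m j)%:E * ((cauchy2 y)%:E * einv (mutual_dist (x + r *: spread y) i j)))%E).
  exact: measurable_funeM.
apply: (@le_trans _ _ (\sum_(i < N) \sum_(j < N | (i < j)%N)
   (m i * m j)%:E * \int[mu2]_y ((cauchy2 y)%:E * einv (mutual_dist (x + r *: spread y) i j)))%E).
  rewrite le_eqVlt; apply/orP; left; apply/eqP.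
  pose G (i j : 'I_N) (y : R * R) : \bar R := if (i < j)%N then ((m i * m j)%:E * ((cauchy2 y)%:E * einv (mutual_dist (x + r *: spread y) i j)))%E else 0%E.
  have G0 i j y : (0 <= G i j y)%E by rewrite /G; case: ifP.
  have mG i j : measurable_fun setT (G i j) by rewrite /G; case: (i < j)%N.
  have mS i : measurable_fun setT (fun y => \sum_(j < N) G i j y)%E.
    by apply: emeasurable_sum => j; exact: mG.
  transitivity (\int[mu2]_y (\sum_(i < N) \sum_(j < N) G i j y))%E.
    apply: eq_integral => y _; rewrite potentialE//.
    rewrite ge0_sume_distrr => [|i _]; last by rewrite sume_ge0// => j _; rewrite mule_ge0 ?einv_ge0 ?mutual_dist_ge0// lee_fin.
    apply: eq_bigr => i _; rewrite ge0_sume_distrr => [|j _]; last by rewrite mule_ge0 ?einv_ge0 ?mutual_dist_ge0// lee_fin.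
    by rewrite big_mkcond; apply: eq_bigr => j _; rewrite /G muleCA.
  rewrite ge0_integral_sum//; last by move=> i y _; rewrite sume_ge0.
  apply: eq_bigr => i _; rewrite ge0_integral_sum//; last exact: mG.
  rewrite [RHS]big_mkcond/=; apply: eq_bigr => j _; rewrite /G.
  case: (i < j)%N; last by rewrite integral0.
  apply: ge0_integralZl_EFin => //; last exact: mt0.
  by move=> y Dy; rewrite mule_ge0 ?einv_ge0 ?mutual_dist_ge0.
rewrite /softened mulr_sumr -sumEFin; apply: lee_sum => i _.
rewrite mulr_sumr -sumEFin; apply: lee_sum => j ij.
rewrite [leRHS](_ : _ = (m i * m j)%:E * (2 * pi / Num.sqrt (mutual_dist x i j ^+ 2 + r ^+ 2))%:E)%E; last first.
  by rewrite -EFinM; congr EFin; ring.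
apply: lee_wpmul2l; first by rewrite lee_fin.
apply: pair_smoothing => //; apply: xf.
by apply: contraTN ij => /eqP->; rewrite ltnn.
Qed.

Variable h : R.
Hypothesis h0 : 0 <= h.
Variable x : R -> conf.
Hypothesis hx : free_time_minimizer m h x.

Let xac a b : 0 <= a -> a < b -> abs_continuous a b x.
Proof. by case: hx => _ + _; exact. Qed.

Let xfree t : 0 <= t -> collision_free (x t).
Proof. by case: hx => + _ _; exact. Qed.

Lemma measurable_coord_clamp a b i k : a <= b -> abs_continuous a b x ->
  measurable_fun setT (fun t => x (clamp a b t) i k).
Proof. by move=> ab hg; apply: continuous_measurable_fun; exact: coord_clamp_continuous. Qed.

Lemma Pot_smoothing (a b : R) (rho : R -> R) : 0 <= a -> a < b -> measurable_fun setT rho ->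
  measurable_fun setT (fun y => (cauchy2 y)%:E * Pot m a b (fun t => x t + rho t *: spread y)%R)%E /\
  (\int[mu2]_y ((cauchy2 y)%:E * Pot m a b (fun t => x t + rho t *: spread y)%R)
   <= (2 * pi)%:E * \int[mu]_(t in `[a, b]) (softened (x t) (rho t))%:E)%E.
Proof.
move=> a0 ab mr; have ab' := ltW ab.
have mc i k := measurable_coord_clamp i k ab' (xac a0 ab).
pose G (t : R) (y : R * R) : conf := x (clamp a b t) + rho t *: spread y.
(* A jointly measurable integrand on line times plane: the indicator restricts time, and the clamp
   in [G] makes the curve measurable at all times. *)
pose F (p : R * (R * R)) : \bar R :=
  ((\1_(`[a, b]%classic) p.1)%:E * ((cauchy2 p.2)%:E * potential m (G p.1 p.2)))%E.
have c0 y : (0 <= (@cauchy2 R y)%:E)%E by rewrite lee_fin cauchy2_ge0.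
have F0 p : (0 <= F p)%E by rewrite /F !mule_ge0 ?potential_ge0// lee_fin.
have mF : measurable_fun setT F.
  apply: emeasurable_funM.
    by apply/measurable_EFinP; apply: measurableT_comp.
  apply: measurable_cauchy2_potential => // i k; rewrite /G.
  under eq_fun do rewrite mxE [X in _ + X]mxE.
  apply: measurable_funD; first exact: (measurableT_comp (mc i k)).
  apply: measurable_funM; first exact: measurableT_comp.
  exact: measurable_spread.
have FE y : (\int[mu]_t F (t, y) = (cauchy2 y)%:E * Pot m a b (fun t => x t + rho t *: spread y)%R)%E.
  rewrite /Pot -ge0_integralZl_EFin ?cauchy2_ge0//; last 2 first.
  - by move=> t _; exact: potential_ge0.
  - apply: (eq_measurable_fun (fun t => potential m (G t y))).
      by move=> t; rewrite inE/= in_itv/= => /andP[at' tb]; rewrite /G clamp_id.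
    apply: measurable_funTS; apply: measurable_potential => // i k; rewrite /G.
    under eq_fun do rewrite mxE [X in _ + X]mxE.
    by apply: measurable_funD => //; exact: measurable_funM.
  rewrite [RHS]integral_mkcond; apply: eq_integral => t _.
  rewrite /F patchE /= indicE; case: ifPn => tab; last by rewrite mul0e.
  rewrite mul1e /G clamp_id//; move: tab; rewrite inE/= in_itv/=; first by case/andP.
  by case/andP.
pose S t := 2 * pi * softened (x (clamp a b t)) (rho t).
have mS : measurable_fun setT S.
  apply: measurable_funM => //; apply: measurable_softened => //.
have S0 t : 0 <= S t by rewrite /S mulr_ge0 ?softened_ge0// mulr_ge0 ?pi_ge0.
have FE2 t : (\int[mu2]_y F (t, y) <= (((EFin \o S) \_ `[a, b]) t))%E.
  rewrite /F/= indicE patchE; have [tab|tab] := boolP (t \in `[a, b]%classic); last first.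
    by under eq_integral do rewrite mul0e; rewrite integral0.
  under eq_integral do rewrite mul1e.
  move: tab; rewrite inE/= in_itv/= => /andP[at' tb].
  rewrite /G /S clamp_id//; apply: potential_smoothing; apply: xfree; exact: le_trans at'.
split.
  under eq_fun do rewrite -FE.
  exact: (@measurable_fun_fubini_tonelli_G _ _ _ _ _ mu F mF F0).
under eq_integral do rewrite -FE.
rewrite -(fubini_tonelli_line_plane mF F0).
apply: (@le_trans _ _ (\int[mu]_(t in `[a, b]) (S t)%:E)%E).
  rewrite [leRHS]integral_mkcond; apply: ge0_le_integral => //.
  - by move=> t _; apply: integral_ge0 => y _.
  - exact: measurable_integral_plane.
  - apply/(measurable_restrictT _ _).1 => //.
    by apply: measurable_funTS; exact/measurable_EFinP.
have pi2 : 0 <= 2 * pi :> R by rewrite mulr_ge0 ?pi_ge0.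
have ms : measurable_fun `[a, b] (fun t => (softened (x t) (rho t))%:E).
  apply/measurable_EFinP; apply: (eq_measurable_fun (fun t => softened (x (clamp a b t)) (rho t))).
    by move=> t; rewrite inE/= in_itv/= => /andP[at' tb]; rewrite clamp_id.
  by apply: measurable_funTS; exact: measurable_softened.
have s0 t : `[a, b]%classic t -> (0 <= (softened (x t) (rho t))%:E)%E by rewrite lee_fin softened_ge0.
rewrite -(ge0_integralZl_EFin mu (measurable_itv `[a, b]) s0 ms pi2).
rewrite le_eqVlt; apply/orP; left; apply/eqP; apply: eq_integral => t.
rewrite inE/= in_itv/= => /andP[at' tb]; by rewrite /S clamp_id// -EFinM.
Qed.

(** The value of [kin] on [spread y] per unit of the squared length of [y]. *)
Definition inertia : R := \sum_(i < N) m i * i%:R ^+ 2.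

Lemma inertia_ge0 : 0 <= inertia.
Proof. by apply: sumr_ge0 => i _; rewrite mulr_ge0 ?(ltW (m0 _))// sqr_ge0. Qed.

Lemma lee_scale_sum (w S K p : R) (A B : \bar R) : 0 <= w -> 0 <= S -> S <= K -> (0 <= A)%E -> (0 <= B)%E ->
  (p%:E <= S%:E + A + B)%E -> (p%:E * w%:E <= K%:E * w%:E + w%:E * A + w%:E * B)%E.
Proof.
move=> w0 S0 SK A0 B0 H; rewrite muleC.
apply: (le_trans (lee_wpmul2l _ H)); rewrite ?lee_fin//.
rewrite ge0_muleDr ?adde_ge0 ?lee_fin// ge0_muleDr ?lee_fin//.
by apply: leeD => //; apply: leeD => //; rewrite muleC; apply: lee_wpmul2r; rewrite lee_fin.
Qed.

(** The pointwise bound is integrated over the box; only then are the terms on the right, being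
    nonnegative, enlarged to the whole plane. *)
Lemma integral_box_le (L P p K : R) (f g : R * R -> \bar R) : 0 <= p -> 0 <= K ->
  measurable_fun setT f -> measurable_fun setT g -> (forall y, (0 <= f y)%E) -> (forall y, (0 <= g y)%E) ->
  (forall y, `|y.1| <= L -> `|y.2| <= L -> (p%:E * (cauchy2 y)%:E <= K%:E * (cauchy2 y)%:E + f y + g y)%E) ->
  (P%:E <= \int[mu2]_(y in box L) (cauchy2 y)%:E)%E ->
  (p%:E * P%:E <= (2 * pi * K)%:E + \int[mu2]_y f y + \int[mu2]_y g y)%E.
Proof.
move=> p0 K0 mf mg f0 g0 H hP.
have mb := @measurable_box R L.
have mcT : measurable_fun setT (fun y => (@cauchy2 R y)%:E).
  by apply/measurable_EFinP; exact: measurable_cauchy2T.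
have mc : measurable_fun (box L) (fun y => (@cauchy2 R y)%:E) by exact: measurable_funTS.
have c0 y : (0 <= (@cauchy2 R y)%:E)%E by rewrite lee_fin cauchy2_ge0.
have Kc0 y : (0 <= K%:E * (@cauchy2 R y)%:E)%E by rewrite mule_ge0.
have mK : measurable_fun setT (fun y => K%:E * (@cauchy2 R y)%:E)%E by exact: measurable_funeM.
have mKf := emeasurable_funD mK mf.
have mKg := emeasurable_funD mKf mg.
apply: (@le_trans _ _ (\int[mu2]_(y in box L) (p%:E * (cauchy2 y)%:E))%E).
  by rewrite ge0_integralZl_EFin//; apply: lee_wpmul2l.
apply: (@le_trans _ _ (\int[mu2]_(y in box L) (K%:E * (cauchy2 y)%:E + f y + g y))%E).
  apply: ge0_le_integral => //.
  - by move=> y _; rewrite mule_ge0.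
  - exact: measurable_funeM.
  - exact: (measurable_funTS mKg).
  by move=> y [y1 y2]; exact: H.
apply: (@le_trans _ _ (\int[mu2]_y (K%:E * (cauchy2 y)%:E + f y + g y))%E).
  apply: ge0_subset_integral => //.
  by move=> y _; rewrite !adde_ge0.
rewrite ge0_integralD//; last by move=> y _; rewrite adde_ge0.
rewrite ge0_integralD//; apply: leeD => //; apply: leeD => //.
by rewrite ge0_integralZl_EFin// integral_cauchy2 -EFinM mulrC.
Qed.

(** The squared length of [y] is at most [2 * L ^+ 2] on the box, which bounds the kinetic cost.
    Since [rho] and [- rho] give the same softened potential, a factor 2 drops out. *)
Lemma smoothed_variation (a b L S P : R) (rho sigma : R -> R) : 0 <= a -> a < b -> 0 < L ->
  abs_continuous a b rho -> measurable_fun setT rho -> measurable_fun setT sigma ->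
  {ae mu, forall t, a < t < b -> is_derive t 1 rho (sigma t)} ->
  rho a = 0 -> rho b = 0 -> (\int[mu]_(t in `[a, b]) (sigma t ^+ 2)%:E <= S%:E)%E ->
  (P%:E <= \int[mu2]_(y in box L) (cauchy2 y)%:E)%E ->
  (P%:E * Pot m a b x <= (2 * pi * L ^+ 2 * inertia * S)%:E
     + (2 * pi)%:E * \int[mu]_(t in `[a, b]) (softened (x t) (rho t))%:E)%E.
Proof.
move=> a0 ab L0 hr mr ms dr ra rb hS hP.
have S0 : 0 <= S.
  by rewrite -lee_fin; apply: le_trans hS; apply: integral_ge0 => t _; rewrite lee_fin sqr_ge0.
have Pf := minimizer_Pot_fin m0 hx a0 ab.
have p0 := Pot_ge0 m0 a b x.
have [mp hp] := Pot_smoothing a0 ab mr.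
have mr' : measurable_fun setT (fun t => - rho t) by exact: measurableT_comp.
have [mn hn] := Pot_smoothing a0 ab mr'.
pose K := S * (2 * L ^+ 2 * inertia).
have L20 := sqr_ge0 L.
have K0 : 0 <= K.
  by apply: mulr_ge0 => //; apply: mulr_ge0; [exact: mulr_ge0|exact: inertia_ge0].
set I := (\int[mu]_(t in `[a, b]) (softened (x t) (rho t))%:E)%E.
have nE : (\int[mu]_(t in `[a, b]) (softened (x t) (- rho t))%:E)%E = I.
  by apply: eq_integral => t _; rewrite /softened; under eq_bigr do under eq_bigr do rewrite sqrrN.
rewrite nE in hn.
pose Wp y := ((cauchy2 y)%:E * Pot m a b (fun t => x t + rho t *: spread y)%R)%E.
pose Wn y := ((cauchy2 y)%:E * Pot m a b (fun t => x t + (- rho t) *: spread y)%R)%E.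
have Wp0 y : (0 <= Wp y)%E by rewrite mule_ge0 ?Pot_ge0// lee_fin cauchy2_ge0.
have Wn0 y : (0 <= Wn y)%E by rewrite mule_ge0 ?Pot_ge0// lee_fin cauchy2_ge0.
have c0 y : (0 <= (@cauchy2 R y)%:E)%E by rewrite lee_fin cauchy2_ge0.
have fp0 : 0 <= 2 * fine (Pot m a b x) by rewrite mulr_ge0// fine_ge0.
have pw y : `|y.1| <= L -> `|y.2| <= L ->
    ((2 * fine (Pot m a b x))%:E * (cauchy2 y)%:E <= K%:E * (cauchy2 y)%:E + Wp y + Wn y)%E.
  move=> y1 y2.
  rewrite /Wp /Wn; apply: (@lee_scale_sum _ (S * kin m (spread y))); rewrite ?cauchy2_ge0 ?Pot_ge0 ?mulr_ge0 ?kin_ge0//; last first.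
    have := minimizer_variation m0 h0 hx (spread y) a0 ab hr ms dr ra rb hS.
    by rewrite -{1}(fineK Pf) -EFinM.
  rewrite ler_wpM2l// kin_spread ler_wpM2r ?inertia_ge0//.
  have : `|y.1| ^+ 2 <= L ^+ 2 by rewrite ler_sqr ?nnegrE// ltW.
  have : `|y.2| ^+ 2 <= L ^+ 2 by rewrite ler_sqr ?nnegrE// ltW.
  by rewrite !real_normK ?num_real//; lra.
have := integral_box_le fp0 K0 mp mn Wp0 Wn0 pw hP.
move=> /le_trans /(_ (leeD (leeD (lexx _) hp) hn)) key.
have I0 : (0 <= I)%E by apply: integral_ge0 => t _; rewrite lee_fin softened_ge0.
rewrite -/I in key; clear -key I0 Pf; clearbody I.
move: key; rewrite -(fineK Pf) /K; case: I I0 => [r| |]//= _.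
  by rewrite -!(EFinM, EFinD) !lee_fin /K; lra.
by move=> _; rewrite gt0_muley ?lte_fin ?mulr_gt0 ?pi_gt0// addey// leey.
Qed.

End Smoothing.

(** * Profiles on a window *)

Section QuarterPower.
Context {R : realType}.
Local Notation mu := (@lebesgue_measure R).
Implicit Types (y z : R).

(** The power 1/4; its cube yields the power 3/4 of the profiles. *)
Definition root4 y : R := Num.sqrt (Num.sqrt y).

Lemma root4_ge0 y : 0 <= root4 y. Proof. exact: sqrtr_ge0. Qed.

Lemma root4_gt0 y : 0 < y -> 0 < root4 y.
Proof. by move=> y0; rewrite !sqrtr_gt0. Qed.

Lemma exp_root4 z : 0 <= z -> root4 (z ^+ 4) = z.
Proof. by move=> z0; rewrite /root4 -[4%N]/(2 * 2)%N exprM sqrtr_sqr ger0_norm ?sqr_ge0// sqrtr_sqr ger0_norm. Qed.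

Lemma ler_root4 y z : y <= z -> root4 y <= root4 z.
Proof.
move=> yz; have [z0|z0] := leP 0 z; first by apply: ler_wsqrtr; exact: ler_wsqrtr.
by rewrite /root4 [Num.sqrt y]ler0_sqrtr ?sqrtr0 ?sqrtr_ge0// (le_trans yz)// ltW.
Qed.

Lemma root4_le2 y : y <= 16 -> root4 y <= 2.
Proof. by move=> y16; rewrite -(@exp_root4 2)//; apply: ler_root4; rewrite (le_trans y16)// -natrX. Qed.

Lemma measurable_root4 d (T : measurableType d) (D : set T) (f : T -> R) :
  measurable_fun D f -> measurable_fun D (fun t => root4 (f t)).
Proof. by move=> mf; do 2 apply: measurable_fun_sqrt. Qed.

Lemma continuous_root4 : continuous root4.
Proof. by move=> y; apply: continuous_comp; exact: sqrt_continuous. Qed.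

Lemma is_derive_root4 y : 0 < y -> is_derive y 1 root4 (4 * root4 y ^+ 3)^-1.
Proof.
move=> y0; have sy0 : 0 < Num.sqrt y by rewrite sqrtr_gt0.
have r0 := root4_gt0 y0.
have := @is_derive1_comp R Num.sqrt Num.sqrt y _ _ (is_derive1_sqrt sy0) (is_derive1_sqrt y0).
move=> /is_derive_eq; apply; rewrite -/(root4 y).
have -> : Num.sqrt y = root4 y ^+ 2 by rewrite /root4 sqr_sqrtr ?sqrtr_ge0.
by field; rewrite gt_eqF.
Qed.

Lemma is_derive_affine (al be t : R) : is_derive t 1 (fun t => al * t + be) al.
Proof. by apply: is_derive_eq; rewrite /GRing.scale/= mulr1 addr0. Qed.

Lemma is_derive_root4_affine (al be t : R) : 0 < al * t + be ->
  is_derive t 1 (fun t => root4 (al * t + be)) (al / (4 * root4 (al * t + be) ^+ 3)).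
Proof.
move=> H; have := @is_derive1_comp R root4 (fun t => al * t + be) t _ _ (is_derive_root4 H) (is_derive_affine al be t).
by move=> /is_derive_eq; apply; rewrite mulrC.
Qed.

Lemma integral_root4_affine (a b al be : R) : a < b -> al != 0 ->
  (forall t, a <= t <= b -> 0 < al * t + be) ->
  (\int[mu]_(t in `[a, b]) ((root4 (al * t + be) ^+ 3)^-1)%:E
   = (4 / al * (root4 (al * b + be) - root4 (al * a + be)))%:E)%E.
Proof.
move=> ab al0 H.
pose F t := 4 / al * root4 (al * t + be).
have caff : continuous (fun t => root4 (al * t + be)).
  move=> t; apply: (@continuous_comp _ _ _ (fun t => al * t + be) root4); last exact: continuous_root4.
  by case: (is_derive_affine al be t) => /derivable1_diffP/differentiable_continuous.
have cF : continuous F by move=> t; apply: cvgM; [exact: cvg_cst|exact: caff].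
have dF t : a <= t <= b -> is_derive t 1 F ((root4 (al * t + be) ^+ 3)^-1).
  move=> tab; have h0 := root4_gt0 (H t tab).
  have := is_deriveZ (4 / al) (is_derive_root4_affine (H t tab)).
  move=> /is_derive_eq; apply; rewrite /GRing.scale/=; field.
  by rewrite gt_eqF.
have oc t : t \in `]a, b[ -> a <= t <= b by rewrite in_itv/= => /andP[]; lra.
rewrite (@continuous_FTC2 _ (fun t => (root4 (al * t + be) ^+ 3)^-1) F)//.
- by rewrite /F -EFinB mulrBr.
- apply: continuous_in_subspaceT => t; rewrite inE/= in_itv/= => tab.
  apply: cvgV; first by rewrite expf_neq0// gt_eqF// root4_gt0// H.
  apply: (@continuous_comp _ _ _ (fun t => root4 (al * t + be)) (fun r => r ^+ 3)); first exact: caff.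
  exact: exprn_continuous.
- split => [t /oc tab||].
  + by case: (dF t tab).
  + by apply: cvg_at_right_filter; exact: cF.
  + by apply: cvg_at_left_filter; exact: cF.
- by move=> t /oc tab; rewrite derive1E; case: (dF t tab).
Qed.

Lemma bounded_derive_lipschitz (a b B : R) (f g : R -> R) :
  (forall t, a <= t <= b -> is_derive t 1 f (g t)) -> (forall t, a <= t <= b -> `|g t| <= B) ->
  forall s t, a <= s -> s <= t -> t <= b -> `|f t - f s| <= B * (t - s).
Proof.
move=> df gB s t as' st tb.
have sub r : r \in `]s, t[ -> a <= r <= b by rewrite in_itv/= => /andP[]; lra.
have cf : {within `[s, t], continuous f}.
  apply: continuous_in_subspaceT => r; rewrite inE/= in_itv/= => rst.
  have rab : a <= r <= b by lra.
  by have [+ _] := df r rab; move=> /derivable1_diffP/differentiable_continuous.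
have [c cst ->] := MVT_segment st (fun r rst => df r (sub r rst)) cf.
have ts : 0 <= t - s by rewrite subr_ge0.
rewrite normrM (ger0_norm ts) ler_wpM2r//; apply: gB.
by move: cst; rewrite in_itv/=; lra.
Qed.

(** Parabolic bump on [[a, a + 2 * T]], of height 1 at the middle [a + T]. *)
Definition arch (a T t : R) : R := (t - a) * (a + 2 * T - t) / T ^+ 2.
Definition arch' (a T t : R) : R := 2 * (a + T - t) / T ^+ 2.

Lemma is_derive_arch (a T t : R) : is_derive t 1 (arch a T) (arch' a T t).
Proof.
have h1 := is_deriveM (is_derive_affine 1 (- a) t) (is_derive_affine (-1) (a + 2 * T) t).
have := is_deriveZ (T ^- 2) h1.
rewrite (_ : _ \*: _ = arch a T); last first.
  by apply/funext => r; rewrite /arch /GRing.scale /= fctE /GRing.scale/=; ring.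
by move=> /is_derive_eq; apply; rewrite /arch' /GRing.scale/=; ring.
Qed.

Section Arch.
Variables (a T : R).
Hypothesis T0 : 0 < T.

Lemma archE t : arch a T t = ((t - a) / T) * ((a + 2 * T - t) / T).
Proof. by rewrite /arch; field; rewrite gt_eqF. Qed.

Lemma arch_ge0 t : a <= t <= a + 2 * T -> 0 <= arch a T t.
Proof. by move=> /andP[at' tb]; rewrite archE mulr_ge0// divr_ge0 ?(ltW T0)// subr_ge0. Qed.

Lemma arch_le1 t : arch a T t <= 1.
Proof.
rewrite -subr_ge0 (_ : _ - _ = ((a + T - t) / T) ^+ 2) ?sqr_ge0//.
by rewrite /arch; field; rewrite gt_eqF.
Qed.

Lemma arch'_le t : a <= t <= a + 2 * T -> `|arch' a T t| <= 2 / T.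
Proof.
move=> /andP[at' tb].
rewrite /arch' !normrM [`|T ^- 2|]gtr0_norm ?invr_gt0 ?exprn_gt0// ger0_norm//.
apply: (@le_trans _ _ (2 * T / T ^+ 2)).
  rewrite ler_wpM2r ?invr_ge0 ?sqr_ge0// ler_wpM2l// ler_norml; apply/andP; split; lra.
by rewrite le_eqVlt; apply/orP; left; apply/eqP; field; rewrite gt_eqF.
Qed.

(** In the product [archE] the factor belonging to the farther end is at least 1. *)
Lemma arch_ge t : a <= t <= a + 2 * T ->
  ((t - a) / T <= arch a T t) \/ ((a + 2 * T - t) / T <= arch a T t).
Proof.
move=> /andP[at' tb]; rewrite archE; have [tT|tT] := leP t (a + T).
  left; rewrite ler_peMr ?divr_ge0 ?(ltW T0) ?subr_ge0// ler_pdivlMr// mul1r; lra.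
right; rewrite ler_peMl ?divr_ge0 ?(ltW T0) ?subr_ge0// ler_pdivlMr// mul1r; lra.
Qed.

Lemma measurable_arch : measurable_fun setT (arch a T).
Proof.
apply: measurable_funM => //; apply: measurable_funM; first exact: measurable_funB.
exact: measurable_funB.
Qed.

Lemma measurable_arch' : measurable_fun setT (arch' a T).
Proof. by apply: measurable_funM => //; apply: measurable_funM => //; exact: measurable_funB. Qed.

Lemma arch_start : arch a T a = 0. Proof. by rewrite /arch subrr !mul0r. Qed.
Lemma arch_end : arch a T (a + 2 * T) = 0. Proof. by rewrite /arch subrr mulr0 mul0r. Qed.

Variable eta : R.
Hypothesis eta0 : 0 < eta.
Hypothesis eta1 : eta <= 1.

(** The power -3/4 of the regularized bump. Up to constants it dominates both the squared derivative
    of the profile and the softened potential. *)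
Definition arch_weight (t : R) : R := (root4 (arch a T t + eta) ^+ 3)^-1.

Lemma measurable_arch_weight : measurable_fun setT arch_weight.
Proof.
apply: measurable_funV; apply: measurable_funX; apply: measurable_root4.
by apply: measurable_funD => //; exact: measurable_arch.
Qed.

Lemma arch_weight_ge0 t : 0 <= arch_weight t.
Proof. by rewrite invr_ge0 exprn_ge0// root4_ge0. Qed.

(** By [arch_ge] the weight is at most the sum of two weights of affine functions, one for each end,
    and each integrates to [4 * T * (root4 (2 + eta) - root4 eta) <= 8 * T]. *)
Lemma integral_arch_weight :
  (\int[mu]_(t in `[a, (a + 2 * T)%R]) (arch_weight t)%:E <= (16 * T)%:E)%E.
Proof.
have ab : a < a + 2 * T by rewrite ltrDl mulr_gt0.
pose f1 t := (root4 (T^-1 * t + (eta - a / T)) ^+ 3)^-1.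
pose f2 t := (root4 (- T^-1 * t + (eta + (a + 2 * T) / T)) ^+ 3)^-1.
have e1 t : T^-1 * t + (eta - a / T) = (t - a) / T + eta by ring.
have e2 t : - T^-1 * t + (eta + (a + 2 * T) / T) = (a + 2 * T - t) / T + eta by ring.
have p1 t : a <= t <= a + 2 * T -> 0 < (t - a) / T + eta.
  by move=> /andP[at' _]; rewrite ltr_wpDl// divr_ge0 ?(ltW T0)// subr_ge0.
have p2 t : a <= t <= a + 2 * T -> 0 < (a + 2 * T - t) / T + eta.
  by move=> /andP[_ tb]; rewrite ltr_wpDl// divr_ge0 ?(ltW T0)// subr_ge0.
have mono y z : 0 < y -> y <= z -> (root4 z ^+ 3)^-1 <= (root4 y ^+ 3)^-1.
  move=> y0 yz; rewrite lef_pV2 ?posrE ?exprn_gt0 ?root4_gt0//; last exact: lt_le_trans yz.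
  by rewrite lerXn2r ?nnegrE ?root4_ge0//; exact: ler_root4.
have m1 : measurable_fun `[a, a + 2 * T] (fun t => (f1 t)%:E).
  apply/measurable_EFinP; apply: measurable_funTS; apply: measurable_funV; apply: measurable_funX.
  by apply: measurable_root4; apply: measurable_funD => //; exact: measurable_funM.
have m2 : measurable_fun `[a, a + 2 * T] (fun t => (f2 t)%:E).
  apply/measurable_EFinP; apply: measurable_funTS; apply: measurable_funV; apply: measurable_funX.
  by apply: measurable_root4; apply: measurable_funD => //; exact: measurable_funM.
have f10 t : 0 <= f1 t by rewrite invr_ge0 exprn_ge0// root4_ge0.
have f20 t : 0 <= f2 t by rewrite invr_ge0 exprn_ge0// root4_ge0.
apply: (@le_trans _ _ (\int[mu]_(t in `[a, (a + 2 * T)%R]) ((f1 t)%:E + (f2 t)%:E))%E).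
  apply: ge0_le_integral => //.
  - by move=> t _; rewrite lee_fin arch_weight_ge0.
  - by apply/measurable_EFinP; apply: measurable_funTS; exact: measurable_arch_weight.
  - exact: emeasurable_funD.
  move=> t; rewrite /= in_itv/= => tab; rewrite -EFinD lee_fin.
  have [H|H] := arch_ge tab.
    apply: (@le_trans _ _ (f1 t)); last by rewrite lerDl.
    by rewrite /f1 e1; apply: mono; [exact: p1|rewrite lerD2r].
  apply: (@le_trans _ _ (f2 t)); last by rewrite lerDr.
  by rewrite /f2 e2; apply: mono; [exact: p2|rewrite lerD2r].
rewrite ge0_integralD//; [|by move=> t _; rewrite lee_fin|by move=> t _; rewrite lee_fin].
have T1 : T^-1 != 0 by rewrite invr_eq0 gt_eqF.
have T2 : - T^-1 != 0 by rewrite oppr_eq0.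
rewrite integral_root4_affine//; last by move=> t tab; rewrite e1; exact: p1.
rewrite integral_root4_affine//; last by move=> t tab; rewrite e2; exact: p2.
rewrite !e1 !e2 !subrr !mul0r !add0r -EFinD lee_fin.
have -> : (a + 2 * T - a) / T = 2 by field; rewrite gt_eqF.
have -> : 4 / T^-1 = 4 * T by rewrite invrK.
have -> : 4 / - T^-1 = - (4 * T) by rewrite invrN invrK mulrN.
have r1 : root4 (2 + eta) <= 2 by apply: root4_le2; have := eta1; lra.
have r0 := root4_ge0 eta.
have : T * root4 (2 + eta) <= T * 2 by rewrite ler_wpM2l// ltW.
have : 0 <= T * root4 eta by rewrite mulr_ge0// ltW.
by lra.
Qed.

(* [lam * arch `^ (3 / 4)] regularized at the ends: the square of its derivative and its inverse
   are both integrable, uniformly in [eta]. *)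
Definition profile (lam t : R) : R := lam * (root4 (arch a T t + eta) ^+ 3 - root4 eta ^+ 3).
Definition profile' (lam t : R) : R := lam * (3 / 4) * arch' a T t / root4 (arch a T t + eta).

Lemma is_derive_profile lam t : a <= t <= a + 2 * T -> is_derive t 1 (profile lam) (profile' lam t).
Proof.
move=> tab; have p0 : 0 < arch a T t + eta by rewrite ltr_wpDl// arch_ge0.
have r0 := root4_gt0 p0.
have d1 : is_derive t 1 (fun t => arch a T t + eta) (arch' a T t).
  have := is_deriveD (is_derive_arch a T t) (is_derive_cst eta t 1).
  by move=> /is_derive_eq; apply; rewrite addr0.
have d2 := @is_derive1_comp R root4 (fun t => arch a T t + eta) t _ _ (is_derive_root4 p0) d1.
have d3 := is_deriveX 3 d2.
have d4 := is_deriveZ lam (is_deriveD d3 (is_derive_cst (- root4 eta ^+ 3) t 1)).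
apply: (is_derive_eq (f := profile lam) d4); rewrite /profile' addr0 /GRing.scale/=; field.
by rewrite gt_eqF.
Qed.

Lemma measurable_profile lam : measurable_fun setT (profile lam).
Proof.
apply: measurable_funM => //; apply: measurable_funB => //; apply: measurable_funX.
by apply: measurable_root4; apply: measurable_funD => //; exact: measurable_arch.
Qed.

Lemma measurable_profile' lam : measurable_fun setT (profile' lam).
Proof.
apply: measurable_funM; first by apply: measurable_funM => //; exact: measurable_arch'.
apply: measurable_funV; apply: measurable_root4; apply: measurable_funD => //; exact: measurable_arch.
Qed.

Lemma profile_start lam : profile lam a = 0.
Proof. by rewrite /profile arch_start add0r subrr mulr0. Qed.

Lemma profile_end lam : profile lam (a + 2 * T) = 0.
Proof. by rewrite /profile arch_end add0r subrr mulr0. Qed.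

(** This is what [eta] is for: the power 3/4 alone has unbounded derivative at the ends, whereas
    here [root4 (arch a T t + eta)] stays above [root4 eta]. *)
Lemma profile_lipschitz lam : 0 < lam -> forall s t, a <= s -> s <= t -> t <= a + 2 * T ->
  `|profile lam t - profile lam s| <= lam * (3 / 4) * (2 / T) / root4 eta * (t - s).
Proof.
move=> l0; have e0 := root4_gt0 eta0.
apply: bounded_derive_lipschitz => t tab; first exact: is_derive_profile.
have re : root4 eta <= root4 (arch a T t + eta) by apply: ler_root4; rewrite lerDr arch_ge0.
have lam0 : 0 <= lam * (3 / 4) by rewrite mulr_ge0 ?(ltW l0).
move: (arch'_le tab); rewrite /profile'; set A := arch' a T t; move: A => A hA.
rewrite !normrM (ger0_norm (ltW l0)) [`|3|]ger0_norm// [`|4^-1|]ger0_norm//.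
rewrite [`|(root4 (arch a T t + eta))^-1|]ger0_norm ?invr_ge0 ?root4_ge0//.
have lm : 0 <= lam * (3 / 4) * `|A| by rewrite mulr_ge0.
apply: ler_pM; rewrite ?invr_ge0 ?root4_ge0//.
  by rewrite ler_wpM2l.
by rewrite lef_pV2 ?posrE// (lt_le_trans e0).
Qed.

(** With [r = root4 (arch a T t + eta)], the square contains
    [1 / r ^+ 2 = r / r ^+ 3 <= 2 / r ^+ 3]. *)
Lemma profile'_sqr_le lam t : a <= t <= a + 2 * T ->
  profile' lam t ^+ 2 <= 9 / 2 * lam ^+ 2 / T ^+ 2 * arch_weight t.
Proof.
move=> tab; have p0 : 0 < arch a T t + eta by rewrite ltr_wpDl// arch_ge0.
have r0 := root4_gt0 p0; rewrite /arch_weight /profile'; set r := root4 _ in r0 *.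
have r2 : r <= 2.
  by apply: root4_le2; have := arch_le1 t; have := eta1; lra.
have A2 : arch' a T t ^+ 2 <= 4 / T ^+ 2.
  rewrite -[leLHS]real_normK ?num_real// (_ : 4 / T ^+ 2 = (2 / T) ^+ 2); last by rewrite expr_div_n; congr (_ / _); ring.
  by rewrite ler_sqr ?nnegrE ?divr_ge0 ?(ltW T0)//; exact: arch'_le.
have -> : (lam * (3 / 4) * arch' a T t / r) ^+ 2 = 9 / 16 * lam ^+ 2 * (arch' a T t ^+ 2 * (r * (r ^+ 3)^-1)).
  by field; rewrite gt_eqF.
have -> : 9 / 2 * lam ^+ 2 / T ^+ 2 * (r ^+ 3)^-1 = 9 / 16 * lam ^+ 2 * (4 / T ^+ 2 * (2 * (r ^+ 3)^-1)).
  by field; rewrite !gt_eqF.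
have l20 : 0 <= 9 / 16 * lam ^+ 2 by rewrite mulr_ge0 ?sqr_ge0.
rewrite ler_wpM2l//.
have w0 : 0 <= (r ^+ 3)^-1 by rewrite invr_ge0 exprn_ge0// ltW.
have rw0 : 0 <= r * (r ^+ 3)^-1 by rewrite mulr_ge0// ltW.
by apply: ler_pM; rewrite ?sqr_ge0// ler_wpM2r.
Qed.

Lemma profile_ge0 lam t : 0 <= lam -> a <= t <= a + 2 * T -> 0 <= profile lam t.
Proof.
move=> l0 tab; rewrite /profile mulr_ge0// subr_ge0 lerXn2r ?nnegrE ?root4_ge0//.
by apply: ler_root4; rewrite lerDr arch_ge0.
Qed.

End Arch.

End QuarterPower.

(** * Variation of the distances over unit windows *)

Section UnitWindows.
Context {R : realType} {N d : nat} (m : 'I_N -> R) (h : R).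
Hypothesis m0 : forall i, 0 < m i.
Hypothesis h0 : 0 <= h.
Local Notation mu := (@lebesgue_measure R).
Local Notation conf := 'M[R]_(N, d).
Variable x : R -> conf.
Hypothesis hx : free_time_minimizer m h x.

Lemma coord_le_mutual_dist (z : conf) i j k : `|z i k - z j k| <= mutual_dist z i j.
Proof.
rewrite mutual_distE -sqrtr_sqr; apply: ler_wsqrtr.
by rewrite (bigD1 k)//= lerDl sumr_ge0// => l _; exact: sqr_ge0.
Qed.

Lemma mutual_dist_le (z : conf) i j (A : R) : 0 <= A -> (forall k, `|z i k - z j k| <= A) ->
  mutual_dist z i j <= d%:R * A.
Proof.
move=> A0 H; have dA : 0 <= d%:R * A by rewrite mulr_ge0.
rewrite mutual_distE -[leRHS]ger0_norm// -sqrtr_sqr; apply: ler_wsqrtr.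
apply: (@le_trans _ _ (\sum_(k < d) A ^+ 2)).
  by apply: ler_sum => k _; rewrite -[leLHS]real_normK ?num_real// ler_sqr ?nnegrE.
rewrite sumr_const card_ord -[leLHS]mulr_natl exprMn ler_wpM2r ?sqr_ge0//.
by rewrite -natrX ler_nat; case: (d) => // e; rewrite expnS expn1 leq_pmulr.
Qed.

(** [minimizer_displacement] bounds the coordinates of all displacements; passing from coordinates
    to the Euclidean distance costs the factor [d]. *)
Lemma minimizer_dist_unit (t1 C : R) : 0 <= t1 -> (forall t, t1 <= t -> (Pot m t (t + 1) x <= C%:E)%E) ->
  forall i j, exists2 D, 0 <= D & forall t s, t1 <= t -> t <= s -> s <= t + 1 ->
    mutual_dist (x s) i j <= d%:R * (mutual_dist (x t) i j + D).
Proof.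
move=> t10 hC i j; pose D1 l := 1 + 4 / m l * (C + h).
have C0 : 0 <= C by rewrite -lee_fin; apply: le_trans (hC t1 _) => //; exact: Pot_ge0.
have D0 l : 0 <= D1 l by rewrite addr_ge0// mulr_ge0 ?divr_ge0 ?addr_ge0// ltW.
have disp t s l k : t1 <= t -> t <= s -> s <= t + 1 -> `|x s l k - x t l k| <= D1 l.
  move=> t1t ts st; have tt : t < t + 1 by rewrite ltrDl.
  have t0 := le_trans t10 t1t.
  apply: le_trans (minimizer_displacement m0 h0 hx l k t0 tt (lexx t) ts st) _.
  rewrite (_ : t + 1 - t = 1); last by ring.
  rewrite mulr1 lerD2l ler_wpM2l ?divr_ge0 ?(ltW (m0 l))// lerD2r -lee_fin fineK ?hC//.
  exact: (minimizer_Pot_fin m0 hx).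
exists (D1 i + D1 j); first by rewrite addr_ge0.
move=> t s t0 ts st; apply: mutual_dist_le => [|k].
  by apply: addr_ge0; [exact: mutual_dist_ge0|exact: addr_ge0].
have := disp t s i k t0 ts st; have := disp t s j k t0 ts st.
have := coord_le_mutual_dist (x t) i j k.
by rewrite !ler_norml => /andP[a1 a2] /andP[b1 b2] /andP[c1 c2]; apply/andP; split; lra.
Qed.

End UnitWindows.

Lemma not_cvgryP {R : realType} (f : R -> R) : ~ (f t @[t --> +oo] --> +oo) ->
  exists K, forall A, exists2 t, A <= t & f t <= K.
Proof.
move=> nf; apply: contrapT => H; apply: nf; apply/cvgryPge => K.
apply: contrapT => H2; apply: H; exists K => A; apply: contrapT => H3; apply: H2.
near=> t; rewrite leNgt; apply/negP => tK; apply: H3; exists t; last exact: ltW.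
by near: t; apply: nbhs_pinfty_ge; rewrite num_real.
Unshelve. all: by end_near. Qed.

(** For the smallest [rho], namely 1/2, [q0 ^+ 2 - r ^+ 2 = 1 / 4] turns the difference of inverses
    into [1 / (4 * r * q0 * (q0 + r))], where [r] and [q0] are at most [K + 1]. *)
Lemma inv_sub_inv_sqrt_ge {R : realType} (K r rho : R) : 0 < r -> r <= K -> 2^-1 <= rho ->
  (8 * (K + 1) ^+ 3)^-1 <= r^-1 - (Num.sqrt (r ^+ 2 + rho ^+ 2))^-1.
Proof.
move=> r0 rK rho2; set q0 := Num.sqrt (r ^+ 2 + 2^-1 ^+ 2).
have q20 : q0 ^+ 2 = r ^+ 2 + 2^-1 ^+ 2 by rewrite sqr_sqrtr// addr_ge0 ?sqr_ge0.
have q0p : 0 < q0 by rewrite sqrtr_gt0 ltr_wpDr ?sqr_ge0// exprn_gt0.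
have q0r : q0 <= r + 1.
  rewrite -[leRHS]ger0_norm ?addr_ge0 ?(ltW r0)// -sqrtr_sqr; apply: ler_wsqrtr; nra.
have q0q : q0 <= Num.sqrt (r ^+ 2 + rho ^+ 2).
  by apply: ler_wsqrtr; rewrite lerD2l lerXn2r ?nnegrE//; lra.
apply: (@le_trans _ _ (r^-1 - q0^-1)); last first.
  by rewrite lerD2l lerN2 lef_pV2 ?posrE// (lt_le_trans q0p).
have -> : r^-1 - q0^-1 = (4 * (r * q0 * (q0 + r)))^-1.
  have E : (q0 - r) * (q0 + r) = 4^-1 by rewrite -subr_sqr q20; field.
  have s0 : q0 + r != 0 by rewrite gt_eqF// addr_gt0.
  have D : q0 - r = (4 * (q0 + r))^-1.
    by apply: (mulIf s0); rewrite E; field.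
  have -> : r^-1 - q0^-1 = (q0 - r) / (r * q0) by field; rewrite !gt_eqF.
  by rewrite D; field; rewrite s0 !gt_eqF.
have K0 : 0 < K by apply: lt_le_trans rK.
rewrite lef_pV2 ?posrE ?mulr_gt0 ?exprn_gt0 ?addr_gt0//.
rewrite (_ : 8 * (K + 1) ^+ 3 = 4 * ((K + 1) * (K + 1) * (2 * (K + 1)))); last by ring.
rewrite ler_pM2l//.
by apply: ler_pM; rewrite ?mulr_ge0 ?addr_ge0 ?(ltW r0) ?(ltW q0p)//; [apply: ler_pM; rewrite ?(ltW r0) ?(ltW q0p)//|]; lra.
Qed.

(** * Dimension at least two *)

Section Window.
Context {R : realType} {N n : nat} (m : 'I_N -> R) (h : R).
Hypothesis m0 : forall i, 0 < m i.
Hypothesis h0 : 0 <= h.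
Local Notation mu := (@lebesgue_measure R).
Local Notation mu2 := (mu \x mu)%E.
Local Notation conf := 'M[R]_(N, n.+2).
Variable x : R -> conf.
Hypothesis hx : free_time_minimizer m h x.

Let xac a b : 0 <= a -> a < b -> abs_continuous a b x.
Proof. by case: hx => _ + _; exact. Qed.

Let xfree t : 0 <= t -> collision_free (x t).
Proof. by case: hx => + _ _; exact. Qed.

Definition masses : R := \sum_(i < N) \sum_(j < N | (i < j)%N) m i * m j.

Lemma masses_ge0 : 0 <= masses.
Proof. by apply: sumr_ge0 => i _; apply: sumr_ge0 => j _; rewrite mulr_ge0 ?(ltW (m0 _)). Qed.

Lemma softened_le (z : conf) (c r : R) : 0 < c ->
  (forall i j, i != j -> c <= Num.sqrt (mutual_dist z i j ^+ 2 + r ^+ 2)) ->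
  softened m z r <= masses / c.
Proof.
move=> c0 H; rewrite /softened /masses mulr_suml; apply: ler_sum => i _.
rewrite mulr_suml; apply: ler_sum => j ij.
have ij' : i != j by apply: contraTN ij => /eqP->; rewrite ltnn.
rewrite ler_wpM2l ?mulr_ge0 ?(ltW (m0 _))// lef_pV2 ?posrE//; first exact: H.
exact: lt_le_trans (H _ _ ij').
Qed.

Lemma softened_le_Upot (z : conf) (r : R) : collision_free z -> softened m z r <= Upot m z.
Proof.
move=> zf; apply: ler_sum => i _; apply: ler_sum => j ij.
have ij' : i != j by apply: contraTN ij => /eqP->; rewrite ltnn.
have d0 := mutual_dist_gt0 zf ij'.
rewrite ler_wpM2l ?mulr_ge0 ?(ltW (m0 _))// lef_pV2 ?posrE//.
  by rewrite -[leLHS]ger0_norm ?(ltW d0)// -sqrtr_sqr ler_wsqrtr// lerDl sqr_ge0.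
by rewrite sqrtr_gt0 ltr_wpDr ?sqr_ge0// exprn_gt0.
Qed.

Lemma measurable_softened_curve (a b : R) (rho : R -> R) : 0 <= a -> a < b -> measurable_fun setT rho ->
  measurable_fun `[a, b] (fun t => (softened m (x t) (rho t))%:E).
Proof.
move=> a0 ab mr; have ab' := ltW ab.
apply/measurable_EFinP; apply: (eq_measurable_fun (fun t => softened m (x (clamp a b t)) (rho t))).
  by move=> t; rewrite inE/= in_itv/= => /andP[at' tb]; rewrite clamp_id.
apply: measurable_funTS; apply: measurable_softened => // i k.
by apply: measurable_coord_clamp => //; exact: xac.
Qed.

Lemma minimizer_Pot_window : exists2 C : R, 0 <= C & forall a T lam : R, 0 <= a -> 0 < T -> 0 < lam ->
  (Pot m a (a + 2 * T) x <= (C * (lam ^+ 2 / T + T / lam))%:E)%E.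
Proof.
have pi0 := pi_gt0 R.
(* The box then has mass at least [2 * pi - 8 / L = pi]. *)
pose L := 8 / pi : R.
have L0 : 0 < L by rewrite divr_gt0.
have I0 := @inertia_ge0 R N m m0.
(* The constants are twice 72 and twice 32, from [hS] and [hU] below; the factor 2 is the ratio of
   [2 * pi] to the lower bound [pi] for the mass of the box. *)
pose C := 144 * L ^+ 2 * inertia m + 64 * masses.
have C0 : 0 <= C.
  by apply: addr_ge0; apply: mulr_ge0 => //; [apply: mulr_ge0 => //; exact: sqr_ge0|exact: masses_ge0].
exists C => // a T lam a0 T0 lam0.
have ab : a < a + 2 * T by rewrite ltrDl mulr_gt0.
have [c c0 rc] := minimizer_dist_ge m0 hx a0 ab.
(* With [eta = z ^+ 4], the amount [lam * z ^+ 3] subtracted in the profile is at most the lower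
   bound [c] for the mutual distances on the window. *)
pose z := Num.min 1 (c / lam).
have z0 : 0 < z by rewrite lt_min ltr01 divr_gt0.
have z1 : z <= 1 by rewrite ge_min lexx.
have zc : lam * z <= c by rewrite mulrC -ler_pdivlMr// ge_min lexx orbT.
pose eta := z ^+ 4.
have eta0 : 0 < eta by rewrite exprn_gt0.
have eta1 : eta <= 1 by rewrite exprn_ile1// ltW.
have rz : root4 eta = z by rewrite exp_root4// ltW.
have oc t : a < t < a + 2 * T -> a <= t <= a + 2 * T by move=> /andP[/ltW-> /ltW->].
have dr : {ae mu, forall t, a < t < a + 2 * T -> is_derive t 1 (profile a T eta lam) (profile' a T eta lam t)}.
  by apply: aeW => t /oc tab; exact: is_derive_profile.
have hr : abs_continuous a (a + 2 * T) (profile a T eta lam).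
  by apply: lipschitz_abs_continuous; exact: profile_lipschitz.
have w0 t : (0 <= (arch_weight a T eta t)%:E)%E by rewrite lee_fin arch_weight_ge0.
have mw : measurable_fun `[a, (a + 2 * T)%R] (fun t => (arch_weight a T eta t)%:E).
  by apply/measurable_EFinP; apply: measurable_funTS; exact: measurable_arch_weight.
have hS : (\int[mu]_(t in `[a, (a + 2 * T)%R]) (profile' a T eta lam t ^+ 2)%:E <= (72 * lam ^+ 2 / T)%:E)%E.
  have k0 : 0 <= 9 / 2 * lam ^+ 2 / T ^+ 2 by rewrite divr_ge0 ?sqr_ge0// mulr_ge0// sqr_ge0.
  apply: (@le_trans _ _ (\int[mu]_(t in `[a, (a + 2 * T)%R]) ((9 / 2 * lam ^+ 2 / T ^+ 2)%:E * (arch_weight a T eta t)%:E))%E).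
    apply: ge0_le_integral => //.
    - by move=> t _; rewrite lee_fin sqr_ge0.
    - by apply/measurable_EFinP; apply: measurable_funX; apply: measurable_funTS; exact: measurable_profile'.
    - exact: measurable_funeM.
    by move=> t; rewrite /= in_itv/= => tab; rewrite -EFinM lee_fin; exact: profile'_sqr_le.
  rewrite ge0_integralZl_EFin//; apply: (le_trans (lee_wpmul2l _ (integral_arch_weight a T0 eta0 eta1))); first by rewrite lee_fin.
  rewrite -EFinM lee_fin le_eqVlt; apply/orP; left; apply/eqP; field.
  by rewrite gt_eqF.
have hU : (\int[mu]_(t in `[a, (a + 2 * T)%R]) (softened m (x t) (profile a T eta lam t))%:E <= (32 * masses * T / lam)%:E)%E.
  have k0 : 0 <= 2 * masses / lam by rewrite divr_ge0 ?(ltW lam0)// mulr_ge0// masses_ge0.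
  apply: (@le_trans _ _ (\int[mu]_(t in `[a, (a + 2 * T)%R]) ((2 * masses / lam)%:E * (arch_weight a T eta t)%:E))%E).
    apply: ge0_le_integral => //.
    - by move=> t _; rewrite lee_fin softened_ge0.
    - apply: measurable_softened_curve => //; exact: measurable_profile.
    - exact: measurable_funeM.
    move=> t; rewrite /= in_itv/= => tab; rewrite -EFinM lee_fin.
    have p0 : 0 < arch a T t + eta by rewrite ltr_wpDl// arch_ge0.
    have r0 := root4_gt0 p0; rewrite /arch_weight.
    have pr0 := profile_ge0 T0 eta (ltW lam0) tab.
    have prE : profile a T eta lam t = lam * root4 (arch a T t + eta) ^+ 3 - lam * z ^+ 3.
      by rewrite /profile rz mulrBr.
    move: pr0 prE; set r := root4 _ in r0 *; set p := profile _ _ _ _ _ => pr0 prE.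
    have q0 : 0 < lam * r ^+ 3 / 2 by rewrite divr_gt0// mulr_gt0// exprn_gt0.
    have -> : 2 * masses / lam * (r ^+ 3)^-1 = masses / (lam * r ^+ 3 / 2).
      by field; rewrite !gt_eqF.
    apply: softened_le => // i j ij; have := rc t i j tab ij; set dij := mutual_dist _ _ _ => dc.
    rewrite -[leLHS]ger0_norm ?(ltW q0)// -sqrtr_sqr; apply: ler_wsqrtr.
    have z3 : lam * z ^+ 3 <= dij.
      apply: le_trans dc; apply: le_trans zc; rewrite ler_pM2l// exprS ler_piMr ?(ltW z0)//.
      by rewrite exprn_ile1// ltW.
    have -> : lam * r ^+ 3 = p + lam * z ^+ 3 by rewrite prE subrK.
    have z30 : 0 <= lam * z ^+ 3 by rewrite mulr_ge0 ?exprn_ge0 ?ltW.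
    (* The distance makes up for what the profile lacks: the softened distance is at least
       [(p + dij) / 2], and [p + dij] is at least [lam * r ^+ 3]. *)
    apply: (@le_trans _ _ ((p + dij) ^+ 2 / 4)).
      rewrite expr_div_n -natrX ler_wpM2r ?invr_ge0//.
      by rewrite lerXn2r ?nnegrE ?addr_ge0// ?lerD2l// (le_trans z30).
    by have := sqr_ge0 (p - dij); have := sqr_ge0 (p + dij); lra.
  rewrite ge0_integralZl_EFin//; apply: (le_trans (lee_wpmul2l _ (integral_arch_weight a T0 eta0 eta1))); first by rewrite lee_fin.
  rewrite -EFinM lee_fin le_eqVlt; apply/orP; left; apply/eqP; field.
  by rewrite gt_eqF.
have hP : (pi%:E <= \int[mu2]_(y in box L) (cauchy2 y)%:E)%E.
  apply: le_trans (box_mass_ge L0); rewrite lee_fin /L invf_div mulrCA divff// mulr1.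
  by lra.
have := smoothed_variation m0 h0 hx a0 ab L0 hr (measurable_profile a T eta lam) (measurable_profile' a T eta lam) dr
  (profile_start a T eta lam) (profile_end a T eta lam) hS hP.
have pi2 : (0 <= (2 * pi : R)%:E)%E by rewrite lee_fin mulr_ge0// ltW.
move=> /le_trans /(_ (leeD (lexx _) (lee_wpmul2l pi2 hU))).
rewrite -EFinM -EFinD -lee_pdivlMl//; move=> /le_trans; apply.
rewrite -EFinM lee_fin.
have X0 : 0 <= lam ^+ 2 / T by rewrite divr_ge0 ?sqr_ge0// ltW.
have Y0 : 0 <= T / lam by rewrite divr_ge0 ?ltW.
rewrite [leLHS](_ : _ = 144 * L ^+ 2 * inertia m * (lam ^+ 2 / T) + 64 * masses * (T / lam)); last first.
  clearbody L; move: pi0; move: (@pi R) => p p0; field.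
  by rewrite !gt_eqF.
have A0 : 0 <= 144 * L ^+ 2 * inertia m by apply: mulr_ge0 => //; apply: mulr_ge0 => //; exact: sqr_ge0.
have B0 : 0 <= 64 * masses by rewrite mulr_ge0// masses_ge0.
have := mulr_ge0 A0 Y0; have := mulr_ge0 B0 X0; rewrite /C.
move: (144 * L ^+ 2 * inertia m) (64 * masses) (lam ^+ 2 / T) (T / lam) => A B X Y.
by lra.
Qed.

Let xfin a b : 0 <= a -> a < b -> Pot m a b x \is a fin_num.
Proof. exact: (minimizer_Pot_fin m0 hx). Qed.

Lemma measurable_softening_defect (a b : R) (rho : R -> R) : 0 <= a -> a < b -> measurable_fun setT rho ->
  measurable_fun `[a, b] (fun t => (Upot m (x t) - softened m (x t) (rho t))%:E).
Proof.
move=> a0 ab mr.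
have mU : measurable_fun `[a, b] (fun t => (Upot m (x t))%:E).
  apply: (eq_measurable_fun (fun t => potential m (x t))).
    by move=> t; rewrite inE/= in_itv/= => /andP[at' _]; rewrite potential_free//; apply: xfree; exact: le_trans at'.
  by apply: measurable_potential_curve; [exact: m0|exact: ltW|exact: xac].
apply/measurable_EFinP; apply: measurable_funB; first exact/measurable_EFinP.
by apply/measurable_EFinP; exact: measurable_softened_curve.
Qed.

(** The softened integral is finite and is subtracted from both sides of [smoothed_variation]. The
    truncation error is [8 / L * P0] divided by [2 * pi], hence at most [2 * (P0 / L)]. *)
Lemma softening_defect (a T L P0 : R) : 0 <= a -> 0 < T -> 0 < L -> (Pot m a (a + 2 * T) x <= P0%:E)%E ->
  (\int[mu]_(t in `[a, (a + 2 * T)%R]) (Upot m (x t) - softened m (x t) (arch a T t))%:E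
   <= (8 * inertia m * (L ^+ 2 / T) + 2 * (P0 / L))%:E)%E.
Proof.
move=> a0 T0 L0 hP0; set b := a + 2 * T in hP0 *.
have ab : a < b by rewrite /b ltrDl mulr_gt0.
have T2 : 0 < 2 / T by rewrite divr_gt0.
have hr : abs_continuous a b (arch a T).
  apply: (@lipschitz_abs_continuous _ _ _ _ (2 / T)).
  apply: (@bounded_derive_lipschitz _ a b _ (arch a T) (arch' a T)) => t tab; first exact: is_derive_arch.
  exact: arch'_le.
have dr : {ae mu, forall t, a < t < b -> is_derive t 1 (arch a T) (arch' a T t)}.
  by apply: aeW => t _; exact: is_derive_arch.
have hS : (\int[mu]_(t in `[a, b]) (arch' a T t ^+ 2)%:E <= (8 / T)%:E)%E.
  apply: (@le_trans _ _ (\int[mu]_(t in `[a, b]) (cst ((2 / T) ^+ 2)%:E) t)%E).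
    apply: ge0_le_integral => //.
    - by move=> t _; rewrite lee_fin sqr_ge0.
    - by apply/measurable_EFinP; apply: measurable_funX; apply: measurable_funTS; exact: measurable_arch'.
    move=> t; rewrite /= in_itv/= => tab; rewrite lee_fin -[leLHS]real_normK ?num_real//.
    by rewrite ler_sqr ?nnegrE ?(ltW T2)//; exact: arch'_le.
  rewrite integral_cst//= [X in (_ * X)%E]lebesgue_measure_itvcc ?(ltW ab)// -EFinM lee_fin.
  rewrite le_eqVlt; apply/orP; left; apply/eqP; rewrite /b; field.
  by rewrite gt_eqF.
have := smoothed_variation m0 h0 hx a0 ab L0 hr (measurable_arch a T) (measurable_arch' a T) dr
  (arch_start a T) (arch_end a T) hS (box_mass_ge L0).
have mso := measurable_softened_curve a0 ab (measurable_arch a T).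
have fU t : a <= t <= b -> collision_free (x t) by move=> /andP[at' _]; apply: xfree; exact: le_trans at'.
have df0 t : `[a, b]%classic t -> 0 <= Upot m (x t) - softened m (x t) (arch a T t).
  by rewrite /= in_itv/= => tab; rewrite subr_ge0; apply: softened_le_Upot; exact: fU.
have mD := measurable_softening_defect a0 ab (measurable_arch a T).
set S := (\int[mu]_(t in `[a, b]) (softened m (x t) (arch a T t))%:E)%E.
set D := (\int[mu]_(t in `[a, b]) (Upot m (x t) - softened m (x t) (arch a T t))%:E)%E.
have PE : (Pot m a b x = D + S)%E.
  rewrite PotE// /D /S -ge0_integralD//; last by move=> t _; rewrite lee_fin softened_ge0.
  by apply: eq_integral => t _; rewrite -EFinD subrK.
have D0 : (0 <= D)%E by apply: integral_ge0 => t tab; rewrite lee_fin; exact: df0.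
have S0 : (0 <= S)%E by apply: integral_ge0 => t _; rewrite lee_fin softened_ge0.
have Pfin := xfin a0 ab.
have [p pE] : exists p, Pot m a b x = p%:E by exists (fine (Pot m a b x)); rewrite fineK.
move: PE hP0; rewrite pE; clearbody D S; move: D0 S0.
case: D => [D| |]//; case: S => [S| |]//; rewrite -EFinD !lee_fin => D0 S0 [PE] hP0.
move=> H.
have pi2 := pi_ge2 R; have pi0 : 0 < pi :> R by lra.
have pP : p / L <= P0 / L by rewrite ler_pM2r ?invr_gt0.
have p0 : 0 <= p / L by rewrite divr_ge0 ?(ltW L0)//; lra.
move: H; have -> : 2 * pi * L ^+ 2 * inertia m * (8 / T) = 2 * pi * (8 * inertia m * (L ^+ 2 / T)) by ring.
move: (8 * inertia m * (L ^+ 2 / T)) => A.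
have -> : (2 * pi - 8 / L) * p = 2 * pi * p - 8 * (p / L) by ring.
move: (P0 / L) (p / L) p0 pP => B q q0 qB H.
move: pi2 H; clear -PE q0 qB; move: (@pi R) => w w2 H.
have w0 : 0 < w by lra.
rewrite -(@ler_pM2l _ w)//.
have := ler_wpM2l (ltW w0) qB; have : 2 * q <= w * q by rewrite ler_wpM2r.
by move: H; rewrite PE; lra.
Qed.

(** Every pair contributes a nonnegative difference, and one of them is kept. *)
Lemma Upot_sub_softened_ge (z : conf) (r : R) (i j : 'I_N) : collision_free z -> (i < j)%N ->
  m i * m j * ((mutual_dist z i j)^-1 - (Num.sqrt (mutual_dist z i j ^+ 2 + r ^+ 2))^-1) <=
  Upot m z - softened m z r.
Proof.
move=> zf ij; rewrite /Upot /softened -sumrB (bigD1 i)//= -[leLHS]addr0; apply: lerD; last first.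
  apply: sumr_ge0 => k _; rewrite -sumrB; apply: sumr_ge0 => l kl.
  have kl' : k != l by apply: contraTN kl => /eqP->; rewrite ltnn.
  have d0 := mutual_dist_gt0 zf kl'.
  rewrite subr_ge0 ler_wpM2l ?mulr_ge0 ?(ltW (m0 _))// lef_pV2 ?posrE//.
    by rewrite -[leLHS]ger0_norm ?(ltW d0)// -sqrtr_sqr ler_wsqrtr// lerDl sqr_ge0.
  by rewrite sqrtr_gt0 ltr_wpDr ?sqr_ge0// exprn_gt0.
rewrite -sumrB (bigD1 j)//= mulrBr lerDl; apply: sumr_ge0 => l /andP[kl _].
have kl' : i != l by apply: contraTN kl => /eqP->; rewrite ltnn.
have d0 := mutual_dist_gt0 zf kl'.
rewrite subr_ge0 ler_wpM2l ?mulr_ge0 ?(ltW (m0 _))// lef_pV2 ?posrE//.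
  by rewrite -[leLHS]ger0_norm ?(ltW d0)// -sqrtr_sqr ler_wsqrtr// lerDl sqr_ge0.
by rewrite sqrtr_gt0 ltr_wpDr ?sqr_ge0// exprn_gt0.
Qed.

Lemma minimizer_dist_diverges_ge2 (i j : 'I_N) : (i < j)%N ->
  mutual_dist (x t) i j @[t --> +oo] --> +oo.
Proof.
move=> ij; apply: contrapT => /not_cvgryP[K hK].
have ij' : i != j by apply: contraTN ij => /eqP->; rewrite ltnn.
have [C C0 hC] := minimizer_Pot_window.
(* The window estimate with half-length 1/2 and height 1. *)
have unit t : 0 <= t -> (Pot m t (t + 1) x <= (C * (2 + 2^-1))%:E)%E.
  move=> t0; have h2 : 0 < 2^-1 :> R by [].
  have := hC t 2^-1 1 t0 h2 ltr01; rewrite mulfV ?pnatr_eq0//.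
  by rewrite expr1n invrK mul1r divr1.
have [D D0 hD] := minimizer_dist_unit m0 h0 hx (lexx 0) unit i j.
pose K1 := n.+2%:R * (K + D).
pose kappa := m i * m j * (8 * (K1 + 1) ^+ 3)^-1.
have mm : 0 < m i * m j by rewrite mulr_gt0.
have rK1 t s : 0 <= t -> mutual_dist (x t) i j <= K -> t <= s -> s <= t + 1 -> mutual_dist (x s) i j <= K1.
  move=> t0 tK ts st; apply: (le_trans (hD t s t0 ts st)).
  by rewrite /K1 ler_wpM2l// lerD2r.
have K10 : 0 < K1.
  have [t t0 tK] := hK 0.
  apply: lt_le_trans (rK1 t t t0 tK (lexx t) _); last by rewrite lerDl.
  by apply: mutual_dist_gt0 => //; exact: xfree.
have kappa0 : 0 < kappa by rewrite mulr_gt0// invr_gt0 mulr_gt0// exprn_gt0// addr_gt0.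
have I0 := @inertia_ge0 R N m m0.
have key (q : R) : 2 <= q -> kappa <= (8 * inertia m + 4 * C) / q.
  move=> q2; have q0 : 0 < q by lra.
  have q1 : 1 <= q by lra.
  (* These give [lam ^+ 2 / T = q ^+ 4] and [T / lam = q ^+ 8]. The truncation parameter must be
     large against [q ^+ 8] and small against [Num.sqrt T = q ^+ 10]. *)
  pose T := q ^+ 20; pose L := q ^+ 9; pose lam := q ^+ 12.
  have T0 : 0 < T by rewrite exprn_gt0.
  have L0 : 0 < L by rewrite exprn_gt0.
  have lam0 : 0 < lam by rewrite exprn_gt0.
  have T2 : 2 <= T by apply: (le_trans q2); rewrite /T -[leLHS]expr1; exact: ler_weXn2l.
  have [c Tc cK] := hK T.
  pose a := c - T; have a0 : 0 <= a by rewrite subr_ge0.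
  have cE : c = a + T by rewrite subrK.
  have P0 : (Pot m a (a + 2 * T) x <= (2 * C * q ^+ 8)%:E)%E.
    apply: (le_trans (hC a T lam a0 T0 lam0)); rewrite lee_fin.
    have -> : lam ^+ 2 / T = q ^+ 4 by rewrite /lam /T; field; rewrite gt_eqF.
    have -> : T / lam = q ^+ 8 by rewrite /lam /T; field; rewrite gt_eqF.
    rewrite [2 * C]mulrC -mulrA ler_wpM2l// mulr_natl mulr2n lerD2r.
    by apply: ler_weXn2l.
  have := softening_defect a0 T0 L0 P0.
  have -> : L ^+ 2 / T = (q ^+ 2)^-1 by rewrite /L /T; field; rewrite gt_eqF.
  have -> : 2 * C * q ^+ 8 / L = 2 * C / q by rewrite /L; field; rewrite gt_eqF.
  set D' := (\int[mu]_(t in _) _)%E => hD'.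
  have : (kappa%:E <= D')%E.
    have ca t : c <= t <= c + 1 -> a <= t <= a + 2 * T by move=> /andP[ct tc]; apply/andP; split; rewrite cE in ct tc; lra.
    have c0 : 0 <= c by rewrite cE addr_ge0// ltW.
    have ab : a < a + 2 * T by rewrite ltrDl mulr_gt0.
    have df t : a <= t <= a + 2 * T -> 0 <= Upot m (x t) - softened m (x t) (arch a T t).
      by move=> /andP[at' _]; rewrite subr_ge0; apply: softened_le_Upot; apply: xfree; exact: le_trans at'.
    have mD := measurable_softening_defect a0 ab (measurable_arch a T).
    have sub : `[c, c + 1] `<=` `[a, a + 2 * T] by move=> t; rewrite /= !in_itv/=; exact: ca.
    apply: (@le_trans _ _ (\int[mu]_(t in `[c, (c + 1)%R]) (Upot m (x t) - softened m (x t) (arch a T t))%:E)%E); last first.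
      by apply: ge0_subset_integral => // t; rewrite /= in_itv/= lee_fin; exact: df.
    apply: (@le_trans _ _ (\int[mu]_(t in `[c, (c + 1)%R]) (cst kappa%:E) t)%E).
      rewrite integral_cst//= [X in (_ * X)%E]lebesgue_measure_itvcc ?lerDl// -EFinM.
      by rewrite addrAC subrr add0r mulr1.
    apply: ge0_le_integral => //.
    - by move=> t _; rewrite lee_fin ltW.
    - exact: measurable_funS mD.
    move=> t; rewrite /= in_itv/= => tcc; have tab := ca t tcc.
    case/andP: (tcc) => ct tc; have xf : collision_free (x t) by apply: xfree; exact: le_trans ct.
    rewrite lee_fin; apply: le_trans (Upot_sub_softened_ge (arch a T t) xf ij).
    rewrite ler_pM2l//; apply: inv_sub_inv_sqrt_ge; [exact: mutual_dist_gt0|exact: (rK1 c)|].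
    (* As [T >= 2], the bump is at least 3/4 on [[c, c + 1]]. *)
    have -> : arch a T t = 1 - ((t - c) / T) ^+ 2 by rewrite /arch cE; field; rewrite gt_eqF.
    have u0 : 0 <= (t - c) / T by rewrite divr_ge0 ?(ltW T0)// subr_ge0.
    have u1 : (t - c) / T <= 2^-1 by rewrite ler_pdivrMr//; lra.
    by nra.
  move=> /le_trans /(_ hD'); rewrite lee_fin => /le_trans; apply.
  rewrite [leRHS]mulrDl; apply: lerD; last by rewrite le_eqVlt; apply/orP; left; apply/eqP; field; rewrite gt_eqF.
  rewrite ler_wpM2l ?mulr_ge0// lef_pV2 ?posrE ?exprn_gt0//.
  by rewrite expr2 ler_peMl// ltW.
(* Large enough for the upper bound in [key] to fall below [kappa]. *)
pose q := Num.max 2 ((8 * inertia m + 4 * C) / kappa + 1).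
have q2 : 2 <= q by rewrite le_max lexx.
have q0 : 0 < q by lra.
have := key q q2; rewrite ler_pdivlMr// mulrC -ler_pdivlMr// leNgt => /negP; apply.
by apply: (@lt_le_trans _ _ ((8 * inertia m + 4 * C) / kappa + 1)); rewrite ?ltrDl// le_max lexx orbT.
Qed.

End Window.

(** * Dimension one *)

(** Bookkeeping for [integral_gap_le]: [k1] and [k2] are kinetic terms, the [x] and [y] are
    potentials of the minimizer and of its variation on three successive intervals. Finiteness
    permits the cancellations. *)
Lemma ereal_budget {R : realType} (k1 k2 x1 x2 x3 y1 y2 y3 I : \bar R) (r1 r2 r : R) :
  (0 <= k1 -> 0 <= k2 -> 0 <= x1 -> 0 <= x2 -> 0 <= x3 -> 0 <= y1 -> 0 <= y2 -> 0 <= y3 -> 0 <= I ->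
  k1 < +oo -> k2 < +oo -> x1 + (x2 + x3) < +oo -> y1 <= x1 -> y2 + I <= x2 -> y3 <= x3 ->
  k1 + k2 + (x1 + (x2 + x3)) + r%:E <= k1 + r1%:E + (k2 + r2%:E) + (y1 + (y2 + y3)) + r%:E ->
  I <= (r1 + r2)%:E)%E.
Proof.
case: k1 => [k1| |]//; case: k2 => [k2| |]//; case: x1 => [x1| |]//; case: x2 => [x2| |]//;
case: x3 => [x3| |]//; case: y1 => [y1| |]//; case: y2 => [y2| |]//; case: y3 => [y3| |]//;
case: I => [I| |]// _ _ _ _ _ _ _ _ _ _ _ _; rewrite -?EFinD ?lee_fin; lra.
Qed.

(** * Kinetic energy under a constant change of velocity *)

Section KineticShift.
Context {R : realType} {N d : nat} (m : 'I_N -> R).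
Hypothesis m0 : forall i, 0 < m i.
Local Notation mu := (@lebesgue_measure R).
Local Notation conf := 'M[R]_(N, d).

Definition pairing (V z : conf) : R := \sum_(p : 'I_N * 'I_d) m p.1 * V p.1 p.2 * z p.1 p.2.

Lemma kin_shift (v V : conf) (c : R) :
  kin m (v + c *: V) = kin m v + 2 * c * pairing V v + c ^+ 2 * kin m V.
Proof.
rewrite /kin /pairing; under eq_bigr do rewrite mulr_sumr; rewrite pair_bigA/=.
under [X in _ = X + _ + _]eq_bigr do rewrite mulr_sumr; rewrite pair_bigA/=.
under [X in _ = _ + _ + _ * X]eq_bigr do rewrite mulr_sumr; rewrite pair_bigA/=.
rewrite !mulr_sumr -!big_split/=; apply: eq_bigr => -[i k] _ /=.
by rewrite !mxE; ring.
Qed.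

(** The cross term is the integral of [pairing V v], a difference of boundary values of
    [pairing V x]. Finiteness of [Kin] makes the integrand splittable. *)
Lemma Kin_shift (s t c : R) (x v : R -> conf) (V : conf) : s < t ->
  (forall i k, measurable_fun setT (fun u => v u i k)) ->
  (forall i k, mu.-integrable `[s, t] (fun u => (v u i k)%:E)) ->
  (forall i k, \int[mu]_(u in `[s, t]) v u i k = x t i k - x s i k) ->
  (Kin m s t v < +oo)%E ->
  Kin m s t (fun u => v u + c *: V) =
  (Kin m s t v + (c * (pairing V (x t) - pairing V (x s)) + 2^-1 * c ^+ 2 * kin m V * (t - s))%:E)%E.
Proof.
move=> st mv iv ftc Kf.
pose P u := pairing V (v u).
have iP : mu.-integrable `[s, t] (fun u => (P u)%:E).
  rewrite (_ : (fun u => _) = fun u => (\sum_(p : 'I_N * 'I_d) (m p.1 * V p.1 p.2)%:E * (v u p.1 p.2)%:E)%E); last first.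
    by apply/funext => u; rewrite /P /pairing -sumEFin; apply: eq_bigr => p _; rewrite EFinM.
  by apply: integrable_sum => // p _; apply: integrableZl.
have IP : (\int[mu]_(u in `[s, t]) (P u)%:E = (pairing V (x t) - pairing V (x s))%:E)%E.
  transitivity (\int[mu]_(u in `[s, t]) (\sum_(p : 'I_N * 'I_d) (m p.1 * V p.1 p.2)%:E * (v u p.1 p.2)%:E))%E.
    by apply: eq_integral => u _; rewrite /P /pairing -sumEFin; apply: eq_bigr => p _; rewrite EFinM.
  rewrite integral_sum//; last by move=> p; exact: integrableZl.
  rewrite /pairing -sumrB -sumEFin; apply: eq_bigr => p _.
  have IE : (\int[mu]_(u in `[s, t]) (v u p.1 p.2)%:E = (x t p.1 p.2 - x s p.1 p.2)%:E)%E.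
    by rewrite -ftc /Rintegral fineK//; exact: integrable_fin_num.
  by rewrite integralZl// IE -EFinM mulrBr.
have ik : mu.-integrable `[s, t] (fun u => (2^-1 * kin m (v u))%:E).
  apply/integrableP; split; first by apply: measurable_funTS; exact: measurable_half_kin.
  by under eq_integral do rewrite gee0_abs ?half_kin_ge0//.
have ic (r : R) : mu.-integrable `[s, t] (fun=> r%:E).
  apply/integrableP; split => //; rewrite integral_cst//= [X in (_ * X)%E]lebesgue_measure_itvcc ?(ltW st)//.
  by rewrite -EFinM ltry.
have icP : mu.-integrable `[s, t] (fun u => c%:E * (P u)%:E)%E by exact: integrableZl.
rewrite /Kin.
transitivity (\int[mu]_(u in `[s, t]) ((2^-1 * kin m (v u))%:E + (c%:E * (P u)%:E + (2^-1 * c ^+ 2 * kin m V)%:E)))%E.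
  by apply: eq_integral => u _; rewrite -EFinM -!EFinD kin_shift /P; congr EFin; field.
rewrite integralD//; last by apply: integrableD => //; exact: ic.
rewrite integralD//.
have cE (r : R) : (\int[mu]_(u in `[s, t]) r%:E = (r * (t - s))%:E)%E.
  by rewrite integral_cst//= [X in (_ * X)%E]lebesgue_measure_itvcc ?(ltW st)// -EFinM.
rewrite integralZl// IP cE.
by rewrite -!EFinM -!EFinD.
Qed.

End KineticShift.

(** * Spreading the bodies along the line *)

Section Line.
Context {R : realType} {N : nat} (m : 'I_N -> R) (h : R).
Hypothesis m0 : forall i, 0 < m i.
Hypothesis h0 : 0 <= h.
Local Notation mu := (@lebesgue_measure R).
Local Notation conf := 'M[R]_(N, 1).
Variable x : R -> conf.
Hypothesis hx : free_time_minimizer m h x.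

Let xac a b : 0 <= a -> a < b -> abs_continuous a b x.
Proof. by case: hx => _ + _; exact. Qed.

Let xfree t : 0 <= t -> collision_free (x t).
Proof. by case: hx => + _ _; exact. Qed.

Lemma mutual_dist1 (z : conf) i j : mutual_dist z i j = `|z i ord0 - z j ord0|.
Proof. by rewrite mutual_distE big_ord1 sqrtr_sqr. Qed.

Lemma collision_free1 (z : conf) i j : collision_free z -> i != j -> z i ord0 != z j ord0.
Proof.
by move=> zf ij; rewrite -subr_eq0 -normr_eq0 -mutual_dist1 gt_eqF// mutual_dist_gt0.
Qed.

(** By the intermediate value theorem, a change of order would pass through a collision. *)
Lemma order_preserved i j t : 0 <= t -> x 0 i ord0 < x 0 j ord0 -> x t i ord0 < x t j ord0.
Proof.
rewrite le_eqVlt => /predU1P[<-//|t0] ij.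
have ji : i != j by apply: contraTneq ij => ->; rewrite ltxx.
have tt := ltW t0.
pose f u := x (clamp 0 t u) j ord0 - x (clamp 0 t u) i ord0.
have cf : continuous f.
  by move=> u; apply: cvgB; apply: coord_clamp_continuous => //; exact: xac.
have f0 : 0 < f 0 by rewrite /f clamp_id ?lexx// subr_gt0.
rewrite ltNge; apply/negP => xtt.
have ft : f t <= 0 by rewrite /f clamp_id ?lexx// subr_le0.
have [|c] := IVT tt (continuous_subspaceT cf) (v := 0).
  by rewrite ge_min le_max ft orbT (ltW f0).
rewrite in_itv/= => /andP[c0 ct] /eqP; rewrite /f clamp_id// subr_eq0 => /eqP E.
by have := collision_free1 (xfree c0) ji; rewrite E eqxx.
Qed.

(** Taken at time 0 once and for all, since the order never changes. *)
Definition rank (i : 'I_N) : nat := #|[pred l | x 0 l ord0 < x 0 i ord0]|.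

Definition expansion : conf := \matrix_(i, k) (rank i)%:R.

Lemma rank_lt i j : x 0 i ord0 < x 0 j ord0 -> (rank i < rank j)%N.
Proof.
move=> ij; apply: proper_card; apply/properP; split.
  by apply/fintype.subsetP => l; rewrite !inE => /lt_trans; apply.
by exists i; rewrite !inE ?ltxx.
Qed.

Lemma expansion_ge i j t : 0 <= t -> x t i ord0 < x t j ord0 -> expansion i ord0 + 1 <= expansion j ord0.
Proof.
move=> t0 ij; rewrite !mxE natr1 ler_nat; apply: rank_lt.
have ij' : i != j by apply: contraTneq ij => ->; rewrite ltxx.
have [//|ji|/eqP] := ltgtP (x 0 i ord0) (x 0 j ord0).
  by have := order_preserved t0 ji => /(lt_trans ij); rewrite ltxx.
by rewrite (negPf (collision_free1 (xfree (lexx 0)) ij')).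
Qed.

(** Ranks grow by at least 1 from one body to any body on its right. *)
Lemma dist_expansion i j t r : 0 <= t -> 0 <= r -> i != j ->
  mutual_dist (x t) i j + r <= mutual_dist (x t + r *: expansion) i j.
Proof.
move=> t0 r0 ij; wlog lt : i j ij / x t i ord0 < x t j ord0.
  move=> H; have := collision_free1 (xfree t0) ij; rewrite neq_lt => /orP[|ji]; first exact: H.
  have := H j i; rewrite eq_sym => /(_ ij ji); rewrite !mutual_dist1 distrC => /le_trans; apply.
  by rewrite distrC.
rewrite !mutual_dist1 distrC gtr0_norm ?subr_gt0// distrC.
apply: le_trans (ler_norm _); rewrite [in leRHS]mxE [in leRHS]mxE [X in _ <= _ - X]mxE [X in _ <= _ - (_ + X)]mxE.
have := ler_wpM2l r0 (expansion_ge t0 lt); lra.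
Qed.

Lemma expansion_free t r : 0 <= t -> 0 <= r -> collision_free (x t + r *: expansion).
Proof.
move=> t0 r0 i j ij; rewrite -mutual_dist_eq0 gt_eqF//.
apply: lt_le_trans (dist_expansion t0 r0 ij).
by rewrite ltr_wpDr// mutual_dist_gt0//; exact: xfree.
Qed.

(* Each summand is [1 / r - 1 / (r + 1 / 2)] (and [0] at [r = 0]). *)
Definition gap (z : conf) : R :=
  \sum_(i < N) \sum_(j < N | (i < j)%N) m i * m j / (mutual_dist z i j * (2 * mutual_dist z i j + 1)).

Lemma gap_ge0 z : 0 <= gap z.
Proof.
apply: sumr_ge0 => i _; apply: sumr_ge0 => j _; rewrite divr_ge0 ?mulr_ge0 ?(ltW (m0 _))//.
  exact: mutual_dist_ge0.
by rewrite addr_ge0// mulr_ge0// mutual_dist_ge0.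
Qed.

(** The Boolean factor covers both uses: monotonicity alone for small [r], and a definite gain once
    [r] reaches 1/2. *)
Lemma Upot_expansion t r : 0 <= t -> 0 <= r ->
  Upot m (x t + r *: expansion) + (2^-1 <= r)%R%:R * gap (x t) <= Upot m (x t).
Proof.
move=> t0 r0; rewrite /Upot /gap mulr_sumr -big_split/=; apply: ler_sum => i _.
rewrite mulr_sumr -big_split/=; apply: ler_sum => j ij.
have ij' : i != j by apply: contraTN ij => /eqP->; rewrite ltnn.
have d0 := mutual_dist_gt0 (xfree t0) ij'.
have := dist_expansion t0 r0 ij'; set q := mutual_dist (x t) i j in d0 *; set p := mutual_dist _ i j => pq.
have p0 : 0 < p by apply: lt_le_trans pq; rewrite ltr_wpDr.
rewrite mulrCA -mulrDr ler_wpM2l ?mulr_ge0 ?(ltW (m0 _))//.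
case: (leP 2^-1 r) => r2; last first.
  rewrite mul0r addr0 lef_pV2 ?posrE//; lra.
rewrite mul1r; apply: (@le_trans _ _ ((q + 2^-1)^-1 + (q * (2 * q + 1))^-1)).
  by rewrite lerD2r lef_pV2 ?posrE ?addr_gt0//; lra.
rewrite le_eqVlt; apply/orP; left; apply/eqP; field.
by rewrite !gt_eqF//; lra.
Qed.

Lemma measurable_gap_curve (a b : R) : a <= b -> abs_continuous a b x ->
  measurable_fun `[a, b] (fun t => (gap (x t))%:E).
Proof.
move=> ab xab; apply/measurable_EFinP.
apply: (eq_measurable_fun (fun t => gap (x (clamp a b t)))).
  by move=> t; rewrite inE/= in_itv/= => /andP[at' tb]; rewrite clamp_id.
apply: measurable_funTS; rewrite /gap; apply: measurable_sum => i.
under eq_fun do rewrite big_mkcond/=.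
apply: measurable_sum => j; case: (i < j)%N => //.
have md : measurable_fun setT (fun t => mutual_dist (x (clamp a b t)) i j).
  apply: measurable_mutual_dist => k l; apply: continuous_measurable_fun.
  exact: coord_clamp_continuous.
apply: measurable_funM => //; apply: measurable_funV; apply: measurable_funM => //.
by apply: measurable_funD => //; exact: measurable_funM.
Qed.

Lemma pairing1 (V z : conf) : pairing m V z = \sum_(i < N) m i * V i ord0 * z i ord0.
Proof.
rewrite /pairing -(pair_bigA _ (fun i k => m i * V i k * z i k))/=.
by apply: eq_bigr => i _; rewrite big_ord1.
Qed.

(* Chebyshev's sum inequality: [expansion] and the configuration are similarly ordered. *)
Lemma pairing_expansion_ge : center_of_mass_at_rest m x -> (0 < N)%N ->
  exists c, forall t, 0 <= t -> c <= pairing m expansion (x t).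
Proof.
move=> [g hg] N0; pose M := \sum_(i < N) m i; pose E := \sum_(i < N) m i * expansion i ord0.
have M0 : 0 < M.
  rewrite /M (bigD1 (Ordinal N0))//= ltr_wpDr ?m0// sumr_ge0// => i _; exact: ltW.
exists (E * g ord0 ord0 / M) => t t0; rewrite ler_pdivrMr// pairing1.
set P := \sum_(i < N) _.
have X : \sum_(i < N) m i * x t i ord0 = g ord0 ord0.
  by rewrite -(hg t t0) summxE; apply: eq_bigr => i _; rewrite !mxE.
have : 0 <= \sum_(i < N) \sum_(j < N) m i * m j * ((expansion i ord0 - expansion j ord0) * (x t i ord0 - x t j ord0)).
  apply: sumr_ge0 => i _; apply: sumr_ge0 => j _; apply: mulr_ge0; first by rewrite mulr_ge0 ?(ltW (m0 _)).
  have [ij|ij|->] := ltgtP (x t i ord0) (x t j ord0); last by rewrite subrr mulr0.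
    have := expansion_ge t0 ij; nra.
  have := expansion_ge t0 ij; nra.
have -> : \sum_(i < N) \sum_(j < N) m i * m j * ((expansion i ord0 - expansion j ord0) * (x t i ord0 - x t j ord0))
    = P * M + M * P - E * g ord0 ord0 - g ord0 ord0 * E.
  rewrite -X /P /M /E !big_distrlr/= -big_split/= -!sumrB; apply: eq_bigr => i _.
  by rewrite -big_split/= -!sumrB; apply: eq_bigr => j _; ring.
by lra.
Qed.

(** A rise to height 1 at time 1, then a slow return to 0 at time [b]. The small slope of the return
    multiplies the boundary term at [b], for which only a one-sided bound is available. *)
Definition ramp (b t : R) : R := if t <= 1 then t else (b - 1)^-1 * (b - t).
Definition ramp' (b t : R) : R := if t <= 1 then 1 else - (b - 1)^-1.

Section Ramp.
Variable b : R.
Hypothesis b2 : 2 <= b.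

Let b10 : 0 < b - 1. Proof. by have := b2; lra. Qed.
Let s0 : 0 < (b - 1)^-1. Proof. by rewrite invr_gt0. Qed.
Let s1 : (b - 1)^-1 <= 1. Proof. by rewrite invf_le1//; have := b2; lra. Qed.

Lemma rampE t : (b - 1)^-1 * (b - t) = 1 - (b - 1)^-1 * (t - 1).
Proof. by field; rewrite gt_eqF. Qed.

Lemma ramp_lipschitz : abs_continuous 0 b (ramp b).
Proof.
apply: (@lipschitz_abs_continuous _ _ _ _ 1) => u t _ ut _; rewrite mul1r /ramp !rampE.
have H r : 0 <= r -> (b - 1)^-1 * r <= r by move=> r0; rewrite ler_piMl.
have H0 r : 0 <= r -> 0 <= (b - 1)^-1 * r by move=> r0; rewrite mulr_ge0// ltW.
case: (leP t 1) => t1; case: (leP u 1) => u1.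
- by rewrite ger0_norm// subr_ge0.
- by exfalso; lra.
- have h1 : 0 <= t - 1 by lra.
  have := H _ h1; have := H0 _ h1; move: (_ * _) => p p0 pt.
  by rewrite ler_norml; apply/andP; split; lra.
have h1 : 0 <= t - u by lra.
rewrite (_ : _ - _ = - ((b - 1)^-1 * (t - u))); last by ring.
by rewrite normrN ger0_norm ?H0// H.
Qed.

Lemma ramp_derive : {ae mu, forall t, 0 < t < b -> is_derive t 1 (ramp b) (ramp' b t)}.
Proof.
exists [set 1]; split => //; first exact: lebesgue_measure_set1.
move=> t /=; apply: contra_notP => /eqP t1 _; rewrite /ramp'.
case: (ltgtP t 1) t1 => // t1 _.
- apply: (near_eq_is_derive _ (is_derive_id (t : R) (1 : R))).
  by near=> u; rewrite /ramp ifT//; apply: ltW; near: u; exact: lt_nbhsl.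
- apply: (near_eq_is_derive _ (is_derive_affine (- (b - 1)^-1) ((b - 1)^-1 * b) t)).
  near=> u; rewrite /ramp ifF; first by ring.
  by apply/negbTE; rewrite -ltNge; near: u; exact: lt_nbhsr.
Unshelve. all: by end_near. Qed.

Lemma measurable_ramp' : measurable_fun setT (ramp' b).
Proof. by apply: measurable_fun_ifT => //; exact: measurable_fun_ler. Qed.

Lemma ramp_ge0 t : 0 <= t <= b -> 0 <= ramp b t.
Proof.
by move=> /andP[t0 tb]; rewrite /ramp; case: ifP => // _; rewrite mulr_ge0 ?(ltW s0)// subr_ge0.
Qed.

Lemma ramp_ge_half t : 1 <= t -> t <= b / 2 -> 2^-1 <= ramp b t.
Proof.
move=> t1 tb; rewrite /ramp; case: ifP => [_|_]; first by lra.
by rewrite mulrC ler_pdivlMr//; have := b2; lra.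
Qed.

Lemma ramp_start : ramp b 0 = 0. Proof. by rewrite /ramp ler01. Qed.
Lemma ramp_end : ramp b b = 0.
Proof. by rewrite /ramp ifF ?subrr ?mulr0//; apply/negbTE; have := b2; rewrite -ltNge; lra. Qed.

End Ramp.

Lemma Pot_expansion_le (a b : R) (rho : R -> R) : 0 <= a -> a <= b -> abs_continuous a b x ->
  abs_continuous a b (fun t => x t + rho t *: expansion) -> (forall t, a <= t <= b -> 0 <= rho t) ->
  (Pot m a b (fun t => x t + rho t *: expansion)%R <= Pot m a b x)%E.
Proof.
move=> a0 ab xab gab r0; apply: ge0_le_integral => //.
- by move=> t _; exact: potential_ge0.
- exact: measurable_potential_curve.
- exact: measurable_potential_curve.
move=> t; rewrite /= in_itv/= => tab; have t0 : 0 <= t by case/andP: tab => at' _; exact: le_trans at'.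
rewrite !potential_free; [|exact: xfree|by apply: expansion_free => //; exact: r0].
rewrite lee_fin; apply: le_trans (Upot_expansion t0 (r0 t tab)).
by rewrite lerDl mulr_ge0 ?gap_ge0.
Qed.

Lemma Pot_expansion_gap (a b : R) (rho : R -> R) : 0 <= a -> a <= b -> abs_continuous a b x ->
  abs_continuous a b (fun t => x t + rho t *: expansion) -> (forall t, a <= t <= b -> 2^-1 <= rho t) ->
  (Pot m a b (fun t => x t + rho t *: expansion)%R + \int[mu]_(t in `[a, b]) (gap (x t))%:E <= Pot m a b x)%E.
Proof.
move=> a0 ab xab gab r0; rewrite /Pot -ge0_integralD//; first last.
- exact: measurable_gap_curve.
- by move=> t _; rewrite lee_fin gap_ge0.
- exact: measurable_potential_curve.
- by move=> t _; exact: potential_ge0.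
apply: ge0_le_integral => //.
- by move=> t _; rewrite adde_ge0 ?potential_ge0// lee_fin gap_ge0.
- by apply: emeasurable_funD; [exact: measurable_potential_curve|exact: measurable_gap_curve].
- exact: measurable_potential_curve.
move=> t; rewrite /= in_itv/= => tab; have t0 : 0 <= t by case/andP: tab => at' _; exact: le_trans at'.
have rt := r0 t tab; have rt0 : 0 <= rho t by lra.
rewrite !potential_free; [|exact: xfree|exact: expansion_free].
by rewrite -EFinD lee_fin; have := Upot_expansion t0 rt0; rewrite rt mul1r.
Qed.

(** For the variation by [ramp b], the cross term is [P 1 - P 0 - s * (P b - P 1)], bounded above
    independently of [b] because [c <= P b] and [0 < s <= 1]. The gain in potential on [[1, T]] is
    at least the integral of [gap]. *)
Lemma integral_gap_le : center_of_mass_at_rest m x -> (0 < N)%N ->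
  exists C : R, forall T, 1 <= T -> (\int[mu]_(t in `[1%R, T]) (gap (x t))%:E <= C%:E)%E.
Proof.
move=> hG N0; have [c hc] := pairing_expansion_ge hG N0.
pose P t := pairing m expansion (x t).
pose K := kin m expansion; have K0 : 0 <= K by exact: kin_ge0.
exists (P 1 - P 0 + K + `|P 1| + `|c|) => T T1.
(* This keeps the ramp above 1/2 on [[1, T]]. *)
pose b := 2 * T; have b2 : 2 <= b by rewrite /b; lra.
have b0 : 0 < b by lra. have b1 : 1 < b by lra.
pose s := (b - 1)^-1; have sb : s * (b - 1) = 1 by rewrite mulVf// gt_eqF//; lra.
have s0 : 0 < s by rewrite invr_gt0; lra.
have s1 : s <= 1 by rewrite invf_le1//; lra.
have xb := xac (lexx 0) b0.
have [v [vx vi vftc]] := curve_velocity b0 xb.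
have gac : abs_continuous 0 b (fun t => x t + ramp b t *: expansion).
  by apply: abs_continuousD => //; apply: abs_continuousZr; exact: ramp_lipschitz.
have gw := velocity_variation expansion vx (measurable_ramp' b) (ramp_derive b).
have mv := vx.1; have mw := gw.1.
set g := (fun t => x t + ramp b t *: expansion) in gac gw *.
set w := (fun t => v t + ramp' b t *: expansion) in gw mw *.
have Kf a' b' : 0 <= a' -> a' < b' -> b' <= b -> (Kin m a' b' v < +oo)%E.
  move=> a'0 a'b' b'b; apply: (minimizer_Kin_lty m0 h0 hx) => //.
  exact: velocityS vx.
have shift a' b' r : 0 <= a' -> a' < b' -> b' <= b ->
  Kin m a' b' (fun u => v u + r *: expansion) = (Kin m a' b' v + (r * (P b' - P a') + 2^-1 * r ^+ 2 * K * (b' - a'))%:E)%E.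
  move=> a'0 a'b' b'b; apply: Kin_shift => //.
  - by move=> i k; apply: integrableS (vi i k).
  - by move=> i k; apply: vftc => //; exact: ltW.
  - exact: Kf.
have Kw1 : Kin m 0 1 w = (Kin m 0 1 v + (P 1 - P 0 + 2^-1 * K)%:E)%E.
  transitivity (Kin m 0 1 (fun u => v u + 1 *: expansion)).
    apply: eq_integral => t; rewrite inE/= in_itv/= => /andP[_ t1].
    by rewrite /w /ramp' t1.
  rewrite shift ?lexx// ?(ltW b1)//; congr (_ + _%:E)%E; ring.
have Kw2 : Kin m 1 b w = (Kin m 1 b v + (- s * (P b - P 1) + 2^-1 * s * K)%:E)%E.
  transitivity (Kin m 1 b (fun u => v u + (- s) *: expansion)).
    (* At time 1 itself [ramp'] has the value of the rising branch. *)
    rewrite /Kin; apply: eq_integral_null_set.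
    - exact: (measurable_set1 1).
    - exact: lebesgue_measure_set1.
    - by move=> t _; exact: half_kin_ge0.
    - by move=> t _; exact: half_kin_ge0.
    move=> t; rewrite /= in_itv/= => /andP[t1 _] /eqP t1'.
    by rewrite /w /ramp' ifF//; apply/negbTE; rewrite -ltNge lt_neqAle eq_sym t1' t1.
  rewrite shift ?lexx//; congr (_ + _%:E)%E.
  have -> : 2^-1 * (- s) ^+ 2 * K * (b - 1) = 2^-1 * s * K * (s * (b - 1)) by ring.
  by rewrite sb mulr1.
have ac1 a' b' : 0 <= a' -> b' <= b -> abs_continuous a' b' x by move=> ? ?; apply: abs_continuousS xb.
have ac2 a' b' : 0 <= a' -> b' <= b -> abs_continuous a' b' g by move=> ? ?; apply: abs_continuousS gac.
have Tb : T <= b by rewrite /b; lra.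
have T0 : 0 <= T by lra.
have P1 : (Pot m 0 1 g <= Pot m 0 1 x)%E.
  apply: Pot_expansion_le => //; [exact: ac1 (ltW b1)|exact: ac2 (ltW b1)|].
  by move=> t /andP[t0 t1]; apply: ramp_ge0 => //; rewrite t0 (le_trans t1)// ltW.
have P2 : (Pot m 1 T g + \int[mu]_(t in `[1%R, T]) (gap (x t))%:E <= Pot m 1 T x)%E.
  apply: Pot_expansion_gap => //; [exact: ac1|exact: ac2|].
  by move=> t /andP[t1 tT]; apply: ramp_ge_half => //; rewrite /b; lra.
have P3 : (Pot m T b g <= Pot m T b x)%E.
  apply: Pot_expansion_le => //; [exact: ac1|exact: ac2|].
  by move=> t /andP[t0 t1]; apply: ramp_ge0 => //; rewrite (le_trans T0).
have gE : Pot m 0 b g = (Pot m 0 1 g + (Pot m 1 T g + Pot m T b g))%E.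
  by rewrite (Pot_split m0 ler01 (ltW b1) gac) (Pot_split m0 T1 Tb (ac2 1 b ler01 (lexx b))).
have xE : Pot m 0 b x = (Pot m 0 1 x + (Pot m 1 T x + Pot m T b x))%E.
  rewrite (Pot_split m0 ler01 (ltW b1) xb); congr (_ + _)%E.
  exact: (Pot_split m0 T1 Tb (ac1 1 b ler01 (lexx b))).
have e0 r u : r = 0 -> x u + r *: expansion = x u by move=> ->; rewrite scale0r addr0.
have H := minimizer_le m0 hx (lexx 0) b0 ltr01 vx gac gw (e0 _ _ (ramp_start b)) (e0 _ _ (ramp_end b2)).
have E1 (A B : \bar R) (r : R) : (1%:E * A + (1^-1)%:E * B + (h * (r / 1))%:E = A + B + (h * r)%:E)%E.
  by rewrite invr1 mulr1 !mul1e.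
rewrite E1 in H.
move: H; rewrite (Kin_split m0 ler01 (ltW b1) mv) (Kin_split m0 ler01 (ltW b1) mw) Kw1 Kw2 gE xE.
have I0 : (0 <= \int[mu]_(t in `[1%R, T]) (gap (x t))%:E)%E by apply: integral_ge0 => t _; rewrite lee_fin gap_ge0.
have F1 := Kf 0 1 (lexx 0) ltr01 (ltW b1); have F2 := Kf 1 b ler01 b1 (lexx b).
have G1 := Kin_ge0 m0 0 1 v; have G2 := Kin_ge0 m0 1 b v.
have X1 := Pot_ge0 m0 0 1 x; have X2 := Pot_ge0 m0 1 T x; have X3 := Pot_ge0 m0 T b x.
have Y1 := Pot_ge0 m0 0 1 g; have Y2 := Pot_ge0 m0 1 T g; have Y3 := Pot_ge0 m0 T b g.
have Xf : (Pot m 0 1 x + (Pot m 1 T x + Pot m T b x) < +oo)%E.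
  by rewrite -xE -(fineK (minimizer_Pot_fin m0 hx (lexx 0) b0)) ltry.
move=> H; apply: le_trans (ereal_budget G1 G2 X1 X2 X3 Y1 Y2 Y3 I0 F1 F2 Xf P1 P2 P3 H) _.
rewrite lee_fin; have := hc b (ltW b0); rewrite -/(P b) => cb.
have sK : s * K <= K by rewrite ler_piMl.
have sP : s * P 1 <= `|P 1|.
  by apply: le_trans (ler_norm _) _; rewrite normrM gtr0_norm// ler_piMl.
have sc : - (s * c) <= `|c|.
  by apply: le_trans (ler_norm _) _; rewrite normrN normrM gtr0_norm// ler_piMl.
have sb' : s * c <= s * P b by rewrite ler_pM2l.
by lra.
Qed.

(** Whenever the distance returns below [K], it stays below [K1] for a unit of time, which costs
    [kappa] in the integral of [gap]; that integral is bounded, so such returns cannot recur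
    forever. *)
Lemma minimizer_dist_diverges1 (i j : 'I_N) : center_of_mass_at_rest m x -> (i < j)%N ->
  mutual_dist (x t) i j @[t --> +oo] --> +oo.
Proof.
move=> hG ij; apply: contrapT => /not_cvgryP[K hK].
have N0 : (0 < N)%N by apply: leq_ltn_trans (ltn_ord i).
have ij' : i != j by apply: contraTN ij => /eqP->; rewrite ltnn.
have [C hC] := integral_gap_le hG N0.
have mm (k l : 'I_N) : 0 <= m k * m l by rewrite mulr_ge0 ?(ltW (m0 _)).
(* [1 / r <= 2 + 2 (1 / r - 1 / (r + 1 / 2))] *)
pose Q := \sum_(k < N) \sum_(l < N | (k < l)%N) 2 * (m k * m l).
have UQ t : 0 <= t -> Upot m (x t) <= Q + 2 * gap (x t).
  move=> t0; rewrite /Upot /Q /gap mulr_sumr -big_split/=; apply: ler_sum => k _.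
  rewrite mulr_sumr -big_split/=; apply: ler_sum => l kl.
  have kl' : k != l by apply: contraTN kl => /eqP->; rewrite ltnn.
  have d0 := mutual_dist_gt0 (xfree t0) kl'; set r := mutual_dist _ _ _ in d0 *.
  rewrite [2 * (m k * m l)]mulrC mulrCA -mulrDr ler_wpM2l//.
  rewrite -subr_ge0 (_ : _ - _ = 4 * r / (2 * r + 1) + (r * (2 * r + 1))^-1).
    by rewrite addr_ge0 ?divr_ge0 ?invr_ge0 ?mulr_ge0 ?addr_ge0 ?(ltW d0)// mulr_ge0// ltW.
  field; rewrite !gt_eqF//; lra.
have xt a b : 0 <= a -> a < b -> abs_continuous a b x by exact: xac.
have gap0 t : (0 <= (gap (x t))%:E)%E by rewrite lee_fin gap_ge0.
(* The windows start no earlier than time 1, as does the integral of [gap]. *)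
have unit t : 1 <= t -> (Pot m t (t + 1) x <= (Q + 2 * C)%:E)%E.
  move=> t1; have t0 : 0 <= t by lra.
  have tt : t < t + 1 by rewrite ltrDl.
  have fr u : t <= u <= t + 1 -> collision_free (x u) by move=> /andP[tu _]; apply: xfree; exact: le_trans tu.
  have mg := measurable_gap_curve (ltW tt) (xt _ _ t0 tt).
  have b1 : 1 < t + 1 by lra.
  have mg1 := measurable_gap_curve (ltW b1) (xt _ _ ler01 b1).
  have Q0 : 0 <= Q by apply: sumr_ge0 => k _; apply: sumr_ge0 => l _; rewrite mulr_ge0.
  apply: (@le_trans _ _ (\int[mu]_(u in `[t, (t + 1)%R]) ((cst Q%:E) u + 2%:E * (gap (x u))%:E))%E).
    apply: ge0_le_integral => //.
    - by move=> u _; exact: potential_ge0.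
    - by apply: measurable_potential_curve => //; [exact: ltW|exact: xac].
    - by apply: emeasurable_funD; [exact: measurable_cst|exact: measurable_funeM].
    move=> u; rewrite /= in_itv/= => tu; rewrite potential_free; last exact: fr.
    rewrite -EFinM -EFinD lee_fin; apply: UQ; case/andP: tu => tu _; exact: le_trans tu.
  rewrite ge0_integralD//; first last.
  - exact: measurable_funeM.
  - by move=> u _; rewrite mule_ge0.
  rewrite integral_cst//= [X in (_ * X)%E]lebesgue_measure_itvcc ?lerDl// ge0_integralZl_EFin//.
  rewrite (_ : t + 1 - t = 1); last by ring.
  rewrite mule1 [leRHS]EFinD [(2 * C)%:E]EFinM; apply: leeD => //; apply: lee_wpmul2l => //.
  apply: (le_trans _ (hC (t + 1) (ltW b1))).
  by apply: ge0_subset_integral => //; apply: subset_itv; rewrite bnd_simp.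
have [D D0 hD] := minimizer_dist_unit m0 h0 hx ler01 unit i j.
(* The factor [1%:R] is the dimension occurring in [minimizer_dist_unit]. *)
pose K1 := 1%:R * (K + D).
have rK1 t s : 1 <= t -> mutual_dist (x t) i j <= K -> t <= s -> s <= t + 1 -> mutual_dist (x s) i j <= K1.
  move=> t0 tK ts st; apply: (le_trans (hD t s t0 ts st)).
  by rewrite /K1 ler_wpM2l// lerD2r.
have K10 : 0 < K1.
  have [t t1 tK] := hK 1.
  apply: lt_le_trans (rK1 t t t1 tK (lexx t) _); last by rewrite lerDl.
  by apply: mutual_dist_gt0 => //; apply: xfree; lra.
pose kappa := m i * m j / (K1 * (2 * K1 + 1)).
have K2 : 0 < 2 * K1 + 1 by lra.
have kappa0 : 0 < kappa by apply: divr_gt0; apply: mulr_gt0; rewrite ?m0.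
have gapk t : 0 <= t -> mutual_dist (x t) i j <= K1 -> kappa <= gap (x t).
  move=> t0 tK; rewrite /gap (bigD1 i)//= (bigD1 j)//= -addrA.
  have r0 : 0 <= mutual_dist (x t) i j by exact: mutual_dist_ge0.
  have d0 := mutual_dist_gt0 (xfree t0) ij'.
  apply: (@le_trans _ _ (m i * m j / (mutual_dist (x t) i j * (2 * mutual_dist (x t) i j + 1)))).
    have q1 : 0 < 2 * mutual_dist (x t) i j + 1 by lra.
    have q2 := mulr_gt0 d0 q1; have q3 := mulr_gt0 K10 K2.
    by rewrite ler_wpM2l// lef_pV2//; apply: ler_pM => //; lra.
  have pos k l : 0 <= m k * m l / (mutual_dist (x t) k l * (2 * mutual_dist (x t) k l + 1)).
    by rewrite divr_ge0// mulr_ge0 ?mutual_dist_ge0// addr_ge0// mulr_ge0// mutual_dist_ge0.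
  by rewrite lerDl addr_ge0 ?sumr_ge0// => k _; rewrite sumr_ge0.
(* Each new window begins after the previous [T], so the windows overlap at most in end points and
   their costs add up. *)
have step (p : nat) : exists2 T, 1 < T & ((p%:R * kappa)%:E <= \int[mu]_(t in `[1%R, T]) (gap (x t))%:E)%E.
  elim: p => [|p [T T1 IH]].
    by exists 2; rewrite ?ltr1n// mul0r; apply: integral_ge0 => t _; exact: gap0.
  have [t Tt tK] := hK T; exists (t + 1); first by lra.
  have t1 : 1 <= t by lra.
  have t0 : 0 <= t by lra.
  have tt : t < t + 1 by rewrite ltrDl.
  have b1 : 1 < t + 1 by lra.
  have mg := measurable_gap_curve (ltW b1) (xt _ _ ler01 b1).
  have mg1 : measurable_fun `[1, t] (fun t => (gap (x t))%:E).
    by apply: measurable_funS mg => //; apply: subset_itv; rewrite bnd_simp// ltW.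
  rewrite (@ge0_integral_itv_split _ 1 t)//; last exact: ltW.
  rewrite -natr1 mulrDl mul1r EFinD; apply: leeD.
    by apply: (le_trans IH); apply: ge0_subset_integral => //; apply: subset_itv; rewrite bnd_simp.
  apply: (@le_trans _ _ (\int[mu]_(u in `[t, (t + 1)%R]) (cst kappa%:E) u)%E).
    rewrite integral_cst//= [X in (_ * X)%E]lebesgue_measure_itvcc ?lerDl// -EFinM.
    by rewrite addrAC subrr add0r mulr1.
  apply: ge0_le_integral => //.
  - by move=> u _; rewrite lee_fin ltW.
  - by apply: measurable_funS mg => //; apply: subset_itv; rewrite bnd_simp.
  move=> u; rewrite /= in_itv/= => /andP[tu ut]; rewrite lee_fin; apply: gapk; first exact: le_trans tu.
  exact: (rK1 t).
have [T T1 hT] := step (Num.truncn (C / kappa)).+1.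
have := le_trans hT (hC T (ltW T1)); rewrite lee_fin -ler_pdivlMr// leNgt => /negP; apply.
exact: truncnS_gt.
Qed.

End Line.

Unset Implicit Arguments.

Theorem theorem1 (R : realType) (N d : nat) (hN : (2 <= N)%N)
    (m : 'I_N -> R) (hm : forall i : 'I_N, 0 < m i) (h : R) (hh : 0 < h)
    (x : R -> 'M[R]_(N, d)) (hx : free_time_minimizer m h x)
    (hG : center_of_mass_at_rest m x) (i j : 'I_N) (hij : (i < j)%N) :
  enorm (row i (x t) - row j (x t)) @[t --> +oo] --> +oo.
Proof.
case: d x hx hG => [|[|n]] x hx hG.
(* In dimension 0 all positions coincide, so two bodies always collide. *)
- have [xf _ _] := hx; have ij : i != j by apply: contraTN hij => /eqP->; rewrite ltnn.
  by have := xf 0 (lexx 0) i j ij; rewrite !thinmx0 eqxx.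
- exact: (minimizer_dist_diverges1 hm (ltW hh) hx hG hij).
- exact: (minimizer_dist_diverges_ge2 hm (ltW hh) hx hij).
Qed.
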